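(* Consider a sample $(X_1,Y_1),\dots,(X_n,Y_n)$ made of $n$ independent copies of the couple of random variables $(X,Y)\in\mathbb{R}^d\times\mathbb{R}$. Let $G=\mathbb{E}(XX^\top)$ be the Gram matrix of the design $X$ and $G^{-1}$ its pseudo-inverse. Let $R(\theta)=\mathbb{E}[(Y-\langle\theta,X\rangle)^2]$ and let $\theta_*\in\arg\min_{\theta\in\mathbb{R}^d}R(\theta)$ be some optimal regression parameter. Assume that $$\kappa=\sup\{\mathbb{E}(\langle\theta,X\rangle^4):\theta\in\mathbb{R}^d,\ \mathbb{E}(\langle\theta,X\rangle^2)\le1\}<\infty\quad\text{and that}\quad C=\mathbb{E}\bigl[(Y-\langle\theta_*,X\rangle)^2\|G^{-1/2}X\|^2\bigr]<\infty.$$ Let $n_\epsilon,\mu,\widehat\delta,\gamma_-$ be as in the context, and consider any empirical risk minimizer $\widehat\theta\in\arg\min_{\theta\in\mathbb{R}^d}\sum_{i=1}^n(Y_i-\langle\theta,X_i\rangle)^2$. (1) For any $n\ge n_\epsilon=\mathbf{O}(\kappa[d+\log(\epsilon^{-1})])$, there is an event $\Omega$ of probability at least $1-\epsilon$, such that the excess risk conditional to $\Omega$ satisfies $$\frac nC\,\mathbb{E}\bigl[R(\widehat\theta)-R(\theta_* )\,\big|\,\Omega\bigr]\le\frac{(1+\widehat\delta)^2}{(1-\gamma_-)^2\,\mathbb{P}(\Omega)}\le\Biggl(1+\mathbf{O}\Biggl(\sqrt{\frac{\kappa[d+\log(\epsilon^{-1})]}{n}}\Biggr)\Biggr)(1-\epsilon)^{-1}.$$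 (2) Consequently, for any $\epsilon$ and $n$ satisfying $n>n_\epsilon$, for any positive constant $M\in\mathbb{R}_+$, $$\mathbb{E}\bigl[\min\{R(\widehat\theta)-R(\theta_* ),M\}\bigr]\le\frac{(1+\widehat\delta)^2C}{(1-\gamma_-)^2n}+\epsilon M .$$ (3) Taking $\epsilon=\frac{C}{Mn^2}$, the condition $n>n_\epsilon$ is satisfied for $n>\mathbf{O}\bigl(\kappa[d+\log(\kappa M/C)]\bigr)$, and $$\frac nC\,\mathbb{E}\bigl[\min\{R(\widehat\theta)-R(\theta_* ),M\}\bigr]\le1+\mathbf{O}\Biggl(\sqrt{\frac{\kappa[d+\log(Mn/C)]}{n}}\Biggr).$$ (4) Assume now moreover that $Y=\langle\theta_*,X\rangle+\eta$, where $\theta_*\in\mathbb{R}^d$ and $\eta$ is a random variable independent of $X$ such that $\mathbb{E}(\eta)=0$ and $0<\mathbb{E}(\eta^2)=\sigma^2<\infty$. In this case, for $n\ge\mathbf{O}\bigl(\kappa[d+\log(\kappa M/\sigma^2)]\bigr)$, $$\mathbb{E}\bigl[\min\{R(\widehat\theta)-R(\theta_* ),M\}\bigr]\le\Biggl(1+\mathbf{O}\Biggl(\sqrt{\frac{\kappa[d+\log(Mn/\sigma^2)]}{n}}\Biggr)\Biggr)\frac{\sigma^2d}{n}.$$ Moreover, when $n\ge\mathbf{O}(\kappa[d+\log(\epsilon^{-1})])$ satisfies $n>n_\epsilon$, with probability at least $1-\epsilon$, $$\mathbb{E}\bigl[R(\widehat\theta)-R(\theta_* )\,\big|\,X_1,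\dots,X_n\bigr]\le\frac{(1+\widehat\delta)\,d\,\sigma^2}{(1-\gamma_-)n}=\Biggl(1+\mathbf{O}\Biggl(\sqrt{\frac{\kappa[d+\log(\epsilon^{-1})]}{n}}\Biggr)\Biggr)\frac{d\,\sigma^2}{n}.$$
   Context: $G^{-1/2}$ is the symmetric square root of the pseudo-inverse of $G$. $R(\widehat\theta)$ is the function $R$ evaluated at the random point $\widehat\theta$. $\epsilon>0$ is a confidence parameter. $$n_\epsilon=\Biggl[20\sqrt{\kappa d}+\Bigl(\frac52+\frac1{2(\kappa-1)}\Bigr)\sqrt{2(\kappa-1)\bigl[\log(\epsilon^{-1})+0.73\,d\bigr]}\Biggr]^2,$$ $$\mu=\sqrt{\frac{2(\kappa-1)}{n}[\log(\epsilon^{-1})+0.73\,d]}+6.81\sqrt{\frac{2\kappa d}{n}},\qquad\widehat\delta=\frac{\mu}{1-2\mu},\qquad\gamma_-=\frac{2[\log(\epsilon^{-1})+0.73\,d]}{3(\kappa-1)n}.$$ $A=\mathbf{O}(B)$ means that there is a numerical constant $c$ such that $A\le cB$; a condition ''$n\ge\mathbf{O}(B)$'' (or ''$n>\mathbf{O}(B)$'') means $n\ge cB$ (or $n>cB$) for some numerical constant $c$.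
   Formalization: κ>1 assumed; γ₋≠1 in (1),(2), γ₋<1 in the conditional bound of (4); O-constants for n_ε, for n>n_ε in (3), in (1) and in the last bound of (4) depend on m with κ≥1+m (and γ₋≤1−m in (1),(4)), being false uniformly; ''n>n_ε is satisfied'' in (3) assumes C≤M. *)

(* Defs.v *)
(* Random vectors of R^d take values in the measurable type [d.-tuple R]
   (product sigma-algebra); parameters live in the same type. *)
From HB Require Import structures.
From mathcomp Require Export all_boot all_order all_algebra.
From mathcomp Require Export all_classical all_reals all_analysis.
(* not exported by all_analysis; provides the sigma-algebra of \bar R *)
From mathcomp Require Export measurable_realfun.

Set Implicit Arguments.
Unset Strict Implicit.
Unset Printing Implicit Defensive.

Import Order.TTheory GRing.Theory Num.Theory.
Import numFieldNormedType.Exports.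

Local Open Scope classical_set_scope.
Local Open Scope ring_scope.
Local Open Scope ereal_scope.

Section Vectors.
Context {R : realType} {d : nat}.

Definition dot (u v : d.-tuple R) : R :=
  (\sum_(j < d) tnth u j * tnth v j)%R.

Definition vec (u : d.-tuple R) : 'cV[R]_d := \col_j tnth u j.

Definition sqnorm (v : 'cV[R]_d) : R := (\sum_(j < d) v j ord0 ^+ 2)%R.

Definition moore_penrose (A B : 'M[R]_d) : Prop :=
  [/\ A *m B *m A = A, B *m A *m B = B,
      (A *m B)^T = (A *m B)%R & (B *m A)^T = (B *m A)%R].

Definition psd (A : 'M[R]_d) : Prop :=
  A^T = A /\ forall v : 'cV[R]_d, (0 <= (v^T *m A *m v) ord0 ord0)%R.

(* [S] is G^{-1/2}: it is unique, and exists whenever G is symmetric positive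
   semi-definite. *)
Definition is_pinv_sqrt (G S : 'M[R]_d) : Prop :=
  psd S /\ moore_penrose G (S *m S).

End Vectors.

Section Regression.
Context {disp : measure_display} {T : measurableType disp} {R : realType}.
Variable P : probability T R.
Context {d : nat}.

Definition gram (X : T -> d.-tuple R) : 'M[R]_d :=
  \matrix_(i, j) fine 'E_P[(fun w => tnth (X w) i * tnth (X w) j)%R].

Definition risk (X : T -> d.-tuple R) (Y : T -> R) (theta : d.-tuple R) : R :=
  fine 'E_P[(fun w => (Y w - dot theta (X w)) ^+ 2)%R].

Definition kurtosis (X : T -> d.-tuple R) : \bar R :=
  ereal_sup [set 'E_P[(fun w => dot theta (X w) ^+ 4)%R] | theta in
    [set theta : d.-tuple R |
      'E_P[(fun w => dot theta (X w) ^+ 2)%R] <= 1]].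

Definition noise_level (X : T -> d.-tuple R) (Y : T -> R)
    (theta : d.-tuple R) (S : 'M[R]_d) : \bar R :=
  'E_P[(fun w => (Y w - dot theta (X w)) ^+ 2 * sqnorm (S *m vec (X w)))%R].

(* Taking some of the [B i] full gives the product rule for subfamilies. *)
Definition mutually_independent {dU : measure_display}
    {U : measurableType dU} (n : nat) (Z : 'I_n -> T -> U) : Prop :=
  forall B : 'I_n -> set U, (forall i, measurable (B i)) ->
    P (\bigcap_(i in [set: 'I_n]) (Z i @^-1` B i)) =
    \prod_(i < n) P (Z i @^-1` B i).

Definition independent2 {dU dV : measure_display} {U : measurableType dU}
    {V : measurableType dV} (Z : T -> U) (W : T -> V) : Prop :=
  forall (A : set U) (B : set V), measurable A -> measurable B ->
    P (Z @^-1` A `&` W @^-1` B) = P (Z @^-1` A) * P (W @^-1` B).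

Definition same_law {dU : measure_display} {U : measurableType dU}
    (Z W : T -> U) : Prop :=
  forall B : set U, measurable B -> P (Z @^-1` B) = P (W @^-1` B).

Definition cond_expectation_event (f : T -> R) (Om : set T) : \bar R :=
  ((fine (P Om))^-1)%:E * \int[P]_(w in Om) (f w)%:E.

(* [Z] is a version of E[f | F], for f nonnegative but possibly not
   integrable, whence the extended-real values of [Z]. *)
Definition is_cond_expectation (F : set (set T)) (f : T -> R)
    (Z : T -> \bar R) : Prop :=
  [/\ forall w, 0 <= Z w,
      forall B : set (\bar R), measurable B -> F (Z @^-1` B) &
      forall A, F A -> \int[P]_(w in A) Z w = \int[P]_(w in A) (f w)%:E].

(* [ls_X2] and [ls_Y2] make [gram] and [risk], which are totalized by [fine],
   well defined. [ls_kurtosis] and [ls_noise] contain the finiteness of the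
   extended-real kurtosis and noise level. When the Gram matrix is not 0 the
   kurtosis is at least 1; [1 < kappa] makes the divisions by [kappa - 1] in
   the constants below meaningful. *)
Record least_squares (n : nat)
    (X : {RV P >-> d.-tuple R}) (Y : {RV P >-> R})
    (Xs : 'I_n -> {RV P >-> d.-tuple R}) (Ys : 'I_n -> {RV P >-> R})
    (thetastar : d.-tuple R) (S : 'M[R]_d) (kappa C : R)
    (thetahat : {RV P >-> d.-tuple R}) : Prop := LeastSquares {
  ls_size : (0 < n)%N ;
  ls_X2 : forall j, 'E_P[(fun w => tnth (X w) j ^+ 2)%R] < +oo ;
  ls_Y2 : 'E_P[(fun w => Y w ^+ 2)%R] < +oo ;
  ls_indep : mutually_independent (fun i w => (Xs i w, Ys i w)) ;
  ls_law : forall i,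
    same_law (fun w => (Xs i w, Ys i w)) (fun w => (X w, Y w)) ;
  ls_opt : forall theta, (risk X Y thetastar <= risk X Y theta)%R ;
  ls_sqrt : is_pinv_sqrt (gram X) S ;
  ls_kurtosis : kurtosis X = kappa%:E ;
  ls_kappa : (1 < kappa)%R ;
  ls_noise : noise_level X Y thetastar S = C%:E ;
  ls_erm : forall w theta,
    (\sum_(i < n) (Ys i w - dot (thetahat w) (Xs i w)) ^+ 2 <=
     \sum_(i < n) (Ys i w - dot theta (Xs i w)) ^+ 2)%R }.

Definition excess_risk (X : T -> d.-tuple R) (Y : T -> R)
    (thetastar : d.-tuple R) (thetahat : T -> d.-tuple R) (w : T) : R :=
  (risk X Y (thetahat w) - risk X Y thetastar)%R.

End Regression.

Section Constants.
Local Open Scope ring_scope.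
Context {R : realType}.
Implicit Types kappa eps : R.

Definition conf (d : nat) eps : R := ln eps^-1 + 73 / 100 * d%:R.

Definition neps kappa (d : nat) eps : R :=
  (20 * Num.sqrt (kappa * d%:R)
   + (5 / 2 + 1 / (2 * (kappa - 1)))
     * Num.sqrt (2 * (kappa - 1) * conf d eps)) ^+ 2.

Definition mu_ kappa (d n : nat) eps : R :=
  Num.sqrt (2 * (kappa - 1) / n%:R * conf d eps)
  + 681 / 100 * Num.sqrt (2 * kappa * d%:R / n%:R).

Definition deltahat kappa (d n : nat) eps : R :=
  mu_ kappa d n eps / (1 - 2 * mu_ kappa d n eps).

Definition gammam kappa (d n : nat) eps : R :=
  2 * conf d eps / (3 * (kappa - 1) * n%:R).

End Constants.

(* Main.v *)
Require Import Defs.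
From HB Require Import structures.
From mathcomp Require Import all_boot all_order all_algebra.
From mathcomp Require Import all_classical all_reals all_analysis.
From mathcomp Require Import perm ring lra.
Import Order.TTheory GRing.Theory Num.Theory.
Import numFieldNormedType.Exports.
Local Open Scope classical_set_scope.
Local Open Scope ereal_scope.
Local Open Scope ring_scope.

Set Implicit Arguments.
Unset Strict Implicit.
Unset Printing Implicit Defensive.


(** The excess risk of a least squares estimator is governed by a lower bound on
   the empirical Gram matrix. Whiten the design, [x_i = G^{-1/2} X_i], and let
   [v = G^{1/2} (thetahat - thetastar)] be the estimation error ([rooterr]): the
   excess risk is [|v|^2] ([excessE]) and the normal equations of the empirical
   risk read [sum_i <v, x_i> x_i = W], where [W = sum_i xi_i x_i] collects the
   residuals at the optimum ([rooterr_normal_equation]). If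
   [sum_i <v, x_i>^2 >= n a |v|^2], then [n^2 a^2 |v|^2 <= |W|^2] by
   Cauchy-Schwarz ([excess_le_noise]), while [E |W|^2 = n C], the summands of [W]
   being independent and centred ([noisevec_second_moment]).

   The lower bound is a PAC-Bayes inequality. The variables [1 - <v, x>^2] are
   bounded above, so that they have exponential moments with four moments only;
   uniformity in the direction [v] comes from averaging over a posterior around
   [v]. The posterior is a random rounding of [v / h] to the integer lattice with
   the weights of the quadratic B-spline: the mean is exact and the variance of
   each coordinate is 1/4 for every [v] ([spline_rounding]), so that the excess of
   the mean square over [<v, x>^2] is a known multiple of [|x|^2], which is
   subtracted ([latq]). The entropy of the posterior with respect to a discrete
   Gaussian prior is a second moment ([pac_bayes]). The mixture over the prior of
   the exponential likelihood ratios has expectation at most one; this gives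
   [gram_lower_bound], and Markov's inequality with a tuned inverse temperature
   ([confidence_constants]) gives [confidence_event], with
   [a = |1 - gammam| / (1 + deltahat)]. Integrating the excess risk on that event
   bounds its conditional expectation ([conditional_excess_le]); bounding it by
   [M] on the complement yields the truncated bound ([truncated_excess_le]).

   The sharp truncated bounds have a numerical constant, whatever the distance of
   [kappa] to 1, so that no confidence level is fixed for them. The lower bound holds
   with [1 - a] proportional to [ln m + loss], where [m] is the mixture; the
   product of [ln m] with the truncated excess risk is controlled by the entropy
   inequality [a t <= a ln y + exp t], and [E m <= 1] ([entropy_young],
   [sharp_truncated_excess]). With a noise independent of the design, [C] is at
   most [sigma^2 d] ([noise_level_le]).

   For the expectation conditional on the design, the Gram matrix of the whitened sample is
   completed into an invertible matrix [B] on the kernel of [G]; then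
   [v = B^{-1} W], and integrating the noise given the design yields
   [sigma^2] times the trace of [B^{-2} sum_i x_i x_i^T], which is at most
   [sigma^2 d / (n a)] ([reg_inv_frob_le], [integral_excess_design]). The
   confidence event depends on the design only, so that every version of the
   conditional expectation is bounded almost surely on it
   ([conditional_expectation_le]). *)

(** * Taylor bounds for the exponential *)

Lemma le_of_eq (disp : Order.disp_t) (V : porderType disp) (x y : V) :
  x = y -> (x <= y)%O.
Proof. by move=> ->. Qed.

Section ExpBounds.
Context {R : realType}.
Implicit Types x y : R.

Lemma derive_ge0_ge0 (f f' : R -> R) (b : R) :
  (forall x, is_derive x 1 f (f' x)) -> f 0 = 0 ->
  (forall x, 0 <= x <= b -> 0 <= f' x) ->
  forall x, 0 <= x <= b -> 0 <= f x.
Proof.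
move=> fd f0 f'ge0 x /andP[x0 xb].
have fc : {within `[0, x], continuous f}.
  apply: continuous_subspaceT => z.
  by apply: differentiable_continuous; apply/derivable1_diffP; case: (fd z).
have [c] := MVT_segment x0 (fun z _ => fd z) fc.
rewrite in_itv /= => /andP[c0 cx] E.
rewrite f0 !subr0 in E; rewrite E mulr_ge0// f'ge0//.
by rewrite c0 (le_trans cx xb).
Qed.

Lemma expR_ge_quadratic x : 0 <= x -> 1 + x + x ^+ 2 / 2 <= expR x.
Proof.
move=> x0; rewrite -subr_ge0.
have H1 : forall y, 0 <= y <= x -> 0 <= expR y - (1 + y).
  by move=> y _; rewrite subr_ge0 expR_ge1Dx.
apply: (@derive_ge0_ge0 (fun y => expR y - (1 + y + y ^+ 2 / 2))
  (fun y => expR y - (1 + y)) x); rewrite ?lexx ?x0//.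
- move=> y; apply: is_derive_eq.
  by rewrite /GRing.scale /=; lra.
- by rewrite expR0; lra.
Qed.

Lemma expR_le_quadratic x : x <= 0 -> expR x <= 1 + x + x ^+ 2 / 2.
Proof.
move=> x0.
have := expR_ge_quadratic (x := - x); rewrite oppr_ge0 => /(_ x0).
rewrite expRN => H.
have e0 := expR_gt0 x.
suff : 1 <= (1 + - x + (- x) ^+ 2 / 2) * (1 + x + x ^+ 2 / 2).
  move=> H1; have H2 : expR x * (1 + - x + (- x) ^+ 2 / 2) <= 1.
    by rewrite -ler_pdivlMl// mulr1.
  have p0 : 0 < 1 + - x + (- x) ^+ 2 / 2 by nra.
  by rewrite -(ler_pM2l p0) mulrC (le_trans H2).
have -> : (1 + - x + (- x) ^+ 2 / 2) * (1 + x + x ^+ 2 / 2) = 1 + (x ^+ 2 / 2) ^+ 2.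
  by field.
by rewrite lerDl sqr_ge0.
Qed.

(** The third derivative of the right-hand side is 3/2, which dominates that of
   the exponential on this interval. *)
Let expR_le_cubic0 x : 0 <= x <= 5 / 16 ->
  expR x <= 1 + x + x ^+ 2 / 2 + 4^-1 * x ^+ 3.
Proof.
move=> xb; rewrite -subr_ge0; move: x xb.
have H3 : forall y, 0 <= y <= 5 / 16 -> 0 <= 3 / 2 - expR y.
  move=> y /andP[y0 yb]; have := expR_ge1Dx (- y); rewrite expRN => H.
  have e0 := expR_gt0 y.
  have : (1 - y) * expR y <= 1 by rewrite -ler_pdivlMr// mul1r.
  nra.
have H2 : forall y, 0 <= y <= 5 / 16 -> 0 <= 1 + 3 / 2 * y - expR y.
  apply: derive_ge0_ge0 H3.
  - by move=> y; apply: is_derive_eq; rewrite /GRing.scale /=; lra.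
  - by rewrite expR0; lra.
have H1 : forall y, 0 <= y <= 5 / 16 -> 0 <= 1 + y + 3 / 4 * y ^+ 2 - expR y.
  apply: derive_ge0_ge0 H2.
  - by move=> y; apply: is_derive_eq; rewrite /GRing.scale /=; lra.
  - by rewrite expR0; lra.
apply: derive_ge0_ge0 H1.
- by move=> y; apply: is_derive_eq; rewrite /GRing.scale /=; lra.
- by rewrite expR0; lra.
Qed.

(** Squaring the bound at [x / 2] doubles its range: a cubic coefficient [c]
   becomes [c / 4 + 1 / 8], and the room left absorbs the terms of higher order. *)
Lemma expR_le_cubic x : 0 <= x <= 5 / 4 ->
  expR x <= 1 + x + x ^+ 2 / 2 + 3 / 10 * x ^+ 3.
Proof.
have sqb (y a : R) : expR y <= a -> expR (y + y) <= a ^+ 2.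
  by move=> H; rewrite expRD -expr2; apply: lerXn2r; rewrite ?nnegrE ?expR_ge0//
    (le_trans (expR_ge0 y)).
have H1 y : 0 <= y <= 5 / 8 ->
    expR y <= 1 + y + y ^+ 2 / 2 + 23 / 100 * y ^+ 3.
  move=> /andP[y0 yb]; have -> : y = y / 2 + y / 2 by field.
  apply: le_trans (sqb _ _ (@expR_le_cubic0 (y / 2) _)) _; first by lra.
  set z := y / 2; have z0 : 0 <= z <= 5 / 16 by rewrite /z; lra.
  rewrite -subr_ge0.
  have -> : 1 + (z + z) + (z + z) ^+ 2 / 2 + 23 / 100 * (z + z) ^+ 3
     - (1 + z + z ^+ 2 / 2 + 4^-1 * z ^+ 3) ^+ 2
     = z ^+ 3 * (34 / 100 - 3 / 4 * z - 4^-1 * z ^+ 2 - 16^-1 * z ^+ 3) by field.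
  by apply: mulr_ge0; [apply: exprn_ge0|]; nra.
move=> /andP[x0 xb]; have -> : x = x / 2 + x / 2 by field.
apply: le_trans (sqb _ _ (H1 (x / 2) _)) _; first by lra.
set z := x / 2; have z0 : 0 <= z <= 5 / 8 by rewrite /z; lra.
rewrite -subr_ge0.
have -> : 1 + (z + z) + (z + z) ^+ 2 / 2 + 3 / 10 * (z + z) ^+ 3
   - (1 + z + z ^+ 2 / 2 + 23 / 100 * z ^+ 3) ^+ 2
   = z ^+ 3 * (94 / 100 - 71 / 100 * z - 23 / 100 * z ^+ 2
               - 529 / 10000 * z ^+ 3) by field.
by apply: mulr_ge0; [apply: exprn_ge0|]; nra.
Qed.

(** The second order term carries the variance; the third order term only
   matters for [0 < x], that is below the mean, where the argument is bounded. *)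
Lemma expR_le_taylor3 x : x <= 5 / 4 ->
  expR x <= 1 + x + x ^+ 2 / 2 + 3 / 10 * (Num.max x 0) ^+ 3.
Proof.
move=> xb; case: (leP x 0) => x0.
- have -> : (0 : R) ^+ 3 = 0 by rewrite expr0n.
  by rewrite mulr0 addr0 expR_le_quadratic.
- by rewrite expR_le_cubic// (ltW x0).
Qed.

End ExpBounds.

(** * Rounding on an integer lattice *)

Section Lattice.
Context {R : realType} {I : finType} (c : I -> R).

(** Recursion on the dimension makes sums over the lattice iterated sums, so that
   the moments below are computed one coordinate at a time. *)
Fixpoint lattice (d : nat) : finType :=
  if d is d'.+1 then (I * lattice d')%type : finType else unit.

Fixpoint latdot (d : nat) : lattice d -> ('I_d -> R) -> R :=
  if d is d'.+1 return lattice d -> ('I_d -> R) -> R then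
    fun k x => c k.1 * x ord0 + latdot k.2 (fun j => x (lift ord0 j))
  else fun _ _ => 0.

Fixpoint latsq (d : nat) : lattice d -> R :=
  if d is d'.+1 return lattice d -> R then fun k => c k.1 ^+ 2 + latsq k.2
  else fun _ => 0.

Fixpoint latwt (d : nat) : ('I_d -> I -> R) -> lattice d -> R :=
  if d is d'.+1 return ('I_d -> I -> R) -> lattice d -> R then
    fun b k => b ord0 k.1 * latwt (fun j => b (lift ord0 j)) k.2
  else fun _ _ => 1.

(** A discrete Gaussian; the factor [expR (- (4 / 5))] per coordinate makes its
   total mass at most one on any symmetric integer grid. *)
Definition latprior (d : nat) (k : lattice d) : R :=
  expR (- (3 / 2 * latsq k + 4 / 5 * d%:R)).

(** A random rounding of [t] to the grid [c] whose variance does not depend on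
   [t]: it replaces a Gaussian perturbation of fixed covariance, and keeps the
   posterior finitely supported. *)
Record rounding (t : R) (b : I -> R) : Prop := Rounding {
  rd_ge0 : forall i, 0 <= b i ;
  rd_sum : \sum_i b i = 1 ;
  rd_mean : \sum_i b i * (c i - t) = 0 ;
  rd_var : \sum_i b i * (c i - t) ^+ 2 = 1 / 4 ;
  rd_m4 : \sum_i b i * (c i - t) ^+ 4 <= 1 / 4 }.

Lemma sum_lattice0 (F : lattice 0 -> R) : \sum_k F k = F tt.
Proof. by rewrite (big_pred1 tt)// => -[]. Qed.

Lemma sum_latticeS d (F : lattice d.+1 -> R) :
  \sum_k F k = \sum_(i : I) \sum_(k : lattice d) F (i, k).
Proof. by rewrite pair_bigA; apply: eq_bigr => -[]. Qed.

Lemma latwt_ge0 d (b : 'I_d -> I -> R) k :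
  (forall j i, 0 <= b j i) -> 0 <= latwt b k.
Proof.
by elim: d b k => [|d IH] b k b0 //=; rewrite mulr_ge0// IH.
Qed.

Lemma sum_latwt d (b : 'I_d -> I -> R) :
  (forall j, \sum_i b j i = 1) -> \sum_k latwt b k = 1.
Proof.
elim: d b => [|d IH] b b1; first by rewrite sum_lattice0.
rewrite sum_latticeS -[RHS](b1 ord0); apply: eq_bigr => i _ /=.
by rewrite -mulr_sumr IH ?mulr1.
Qed.

Lemma latwt_le1 d (b : 'I_d -> I -> R) k :
  (forall j i, 0 <= b j i) -> (forall j, \sum_i b j i = 1) -> latwt b k <= 1.
Proof.
move=> b0 b1; rewrite -(sum_latwt b1) (bigD1 k)//= lerDl sumr_ge0// => k' _.
exact: latwt_ge0.
Qed.

Lemma sum_latprior d :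
  \sum_i expR (- (3 / 2 * c i ^+ 2 + 4 / 5)) <= 1 ->
  \sum_(k : lattice d) latprior k <= 1.
Proof.
move=> c1; elim: d => [|d IH].
  by rewrite sum_lattice0 /latprior /= !mulr0 addr0 oppr0 expR0.
rewrite sum_latticeS; apply: le_trans c1; apply: ler_sum => i _.
rewrite -[leRHS]mulr1 -subr_ge0.
have -> : \sum_(k : lattice d) latprior ((i, k) : lattice d.+1) =
    expR (- (3 / 2 * c i ^+ 2 + 4 / 5)) * \sum_(k : lattice d) latprior k.
  rewrite mulr_sumr; apply: eq_bigr => k _.
  rewrite /latprior /= -expRD; congr expR.
  by rewrite -natr1; lra.
by rewrite subr_ge0 ler_pM2l ?expR_gt0.
Qed.

(** Independent coordinates: the deviation at [d.+1] is the sum of a scalar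
   deviation and of an independent deviation at [d]. In the fourth moment the
   cross term is [6 / 16] times [x_0^2 N], below the [2 / 4] that the square of
   the sum of squares allows. *)
Lemma lat_dev_moments d (t x : 'I_d -> R) (b : 'I_d -> I -> R) :
  (forall j, rounding (t j) (b j)) ->
  let z k := latdot k x - \sum_j t j * x j in
  [/\ \sum_k latwt b k * z k = 0,
      \sum_k latwt b k * z k ^+ 2 = (\sum_j x j ^+ 2) / 4 &
      \sum_k latwt b k * z k ^+ 4 <= (\sum_j x j ^+ 2) ^+ 2 / 4].
Proof.
elim: d t x b => [|d IH] t x b rb z.
  by rewrite /z !sum_lattice0 /= !big_ord0 subrr !expr0n !mulr0 !mul0r.
pose b' := fun j => b (lift ord0 j).
pose z' := fun k : lattice d =>
  latdot k (fun j => x (lift ord0 j)) - \sum_j t (lift ord0 j) * x (lift ord0 j).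
have [E1 E2 E4] : [/\ \sum_k latwt b' k * z' k = 0,
      \sum_k latwt b' k * z' k ^+ 2 = (\sum_j x (lift ord0 j) ^+ 2) / 4 &
      \sum_k latwt b' k * z' k ^+ 4 <= (\sum_j x (lift ord0 j) ^+ 2) ^+ 2 / 4].
  exact: IH (fun j => rb (lift ord0 j)).
have E0 : \sum_k latwt b' k = 1 by apply: sum_latwt => j; exact: rd_sum (rb _).
set a := fun i => (c i - t ord0) * x ord0.
have zE i k : z (i, k) = a i + z' k.
  by rewrite /z /z' /a /= big_ord_recl; lra.
have R0 := rd_sum (rb ord0).
have M1 : \sum_i b ord0 i * a i = 0.
  rewrite (eq_bigr (fun i => b ord0 i * (c i - t ord0) * x ord0)).
    by rewrite -mulr_suml (rd_mean (rb ord0)) mul0r.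
  by move=> i _; rewrite mulrA.
have M2 : \sum_i b ord0 i * a i ^+ 2 = x ord0 ^+ 2 / 4.
  rewrite (eq_bigr (fun i => b ord0 i * (c i - t ord0) ^+ 2 * x ord0 ^+ 2)).
    by rewrite -mulr_suml (rd_var (rb ord0)); lra.
  by move=> i _; rewrite /a exprMn mulrA.
have M4 : \sum_i b ord0 i * a i ^+ 4 <= x ord0 ^+ 4 / 4.
  rewrite (eq_bigr (fun i => b ord0 i * (c i - t ord0) ^+ 4 * x ord0 ^+ 4)).
    rewrite -mulr_suml mulrC ler_wpM2l ?exprn_even_ge0//.
    by have := rd_m4 (rb ord0); rewrite div1r.
  by move=> i _; rewrite /a exprMn mulrA.
have sumE (F : lattice d.+1 -> R) (g : I -> lattice d -> R) :
    (forall i k, F (i, k) = g i k) ->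
    \sum_k latwt b k * F k =
    \sum_i b ord0 i * \sum_k latwt b' k * g i k.
  move=> Fg; rewrite sum_latticeS; apply: eq_bigr => i _.
  by rewrite mulr_sumr; apply: eq_bigr => k _; rewrite Fg /= mulrA.
have lin p q r s u (w : R) :
    (forall k, latwt b' k * p k = latwt b' k * (q + r * z' k + s * z' k ^+ 2
      + u * z' k ^+ 3 + w * z' k ^+ 4)) ->
    \sum_k latwt b' k * p k = q + s * ((\sum_j x (lift ord0 j) ^+ 2) / 4)
      + u * (\sum_k latwt b' k * z' k ^+ 3) + w * (\sum_k latwt b' k * z' k ^+ 4).
  move=> H; rewrite (eq_bigr _ (fun k _ => H k)).
  rewrite -E2.
  rewrite (eq_bigr (fun k => q * latwt b' k + r * (latwt b' k * z' k)
    + s * (latwt b' k * z' k ^+ 2) + u * (latwt b' k * z' k ^+ 3)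
    + w * (latwt b' k * z' k ^+ 4))); last by move=> k _; ring.
  by rewrite !big_split /= -!mulr_sumr E0 E1; ring.
set N' := \sum_j x (lift ord0 j) ^+ 2 in E2 E4 lin.
have NE : \sum_j x j ^+ 2 = x ord0 ^+ 2 + N' by rewrite big_ord_recl.
split.
- rewrite (sumE _ _ (fun i k => zE i k)).
  rewrite -[RHS]M1; apply: eq_bigr => i _; congr (_ * _).
  rewrite (@lin (fun k => a i + z' k) (a i) 1 0 0 0); first by ring.
  by move=> k; congr (_ * _); ring.
- rewrite (sumE _ (fun i k => (a i + z' k) ^+ 2)); last by move=> i k; rewrite zE.
  rewrite (eq_bigr (fun i => b ord0 i * a i ^+ 2 + b ord0 i * (N' / 4))).
    by rewrite big_split /= M2 -mulr_suml R0 NE; lra.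
  move=> i _; rewrite -mulrDr; congr (_ * _).
  rewrite (@lin (fun k => (a i + z' k) ^+ 2) (a i ^+ 2) (2 * a i) 1 0 0); first by ring.
  by move=> k; congr (_ * _); ring.
- rewrite (sumE _ (fun i k => (a i + z' k) ^+ 4)); last by move=> i k; rewrite zE.
  set E3 := \sum_k latwt b' k * z' k ^+ 3 in lin.
  set E4' := \sum_k latwt b' k * z' k ^+ 4 in lin E4.
  rewrite (eq_bigr (fun i => b ord0 i * a i ^+ 4 + b ord0 i * a i ^+ 2 * (6 * (N' / 4))
      + b ord0 i * a i * (4 * E3) + b ord0 i * E4')).
    rewrite !big_split /= -!mulr_suml M2 M1 R0 NE.
    have N0 : 0 <= N' by apply: sumr_ge0 => j _; exact: sqr_ge0.
    have := mulr_ge0 (sqr_ge0 (x ord0)) N0; move: M4 E4.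
    rewrite mul0r addr0 mul1r.
    have -> : x ord0 ^+ 4 = (x ord0 ^+ 2) ^+ 2 by rewrite -exprM.
    by rewrite !expr2; lra.
  move=> i _.
  rewrite (@lin (fun k => (a i + z' k) ^+ 4) (a i ^+ 4) (4 * a i ^+ 3)
    (6 * a i ^+ 2) (4 * a i) 1); first by ring.
  by move=> k; congr (_ * _); ring.
Qed.

Lemma lat_sq_mean d (t : 'I_d -> R) (b : 'I_d -> I -> R) :
  (forall j, rounding (t j) (b j)) ->
  \sum_k latwt b k * latsq k = \sum_j t j ^+ 2 + d%:R / 4.
Proof.
elim: d t b => [|d IH] t b rb.
  by rewrite sum_lattice0 /= big_ord0 mulr0 mul0r addr0.
have {IH} E := IH (fun j => t (lift ord0 j)) (fun j => b (lift ord0 j))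
  (fun j => rb (lift ord0 j)).
have E0 : \sum_k latwt (fun j => b (lift ord0 j)) k = 1.
  by apply: sum_latwt => j; exact: rd_sum (rb _).
rewrite sum_latticeS big_ord_recl -natr1.
rewrite (eq_bigr (fun i => b ord0 i * c i ^+ 2
   + b ord0 i * (\sum_j t (lift ord0 j) ^+ 2 + d%:R / 4))).
  rewrite big_split /= -mulr_suml (rd_sum (rb ord0)) mul1r.
  rewrite (eq_bigr (fun i => b ord0 i * (c i - t ord0) ^+ 2
     + 2 * t ord0 * (b ord0 i * (c i - t ord0)) + t ord0 ^+ 2 * b ord0 i)); last first.
    by move=> i _; ring.
  rewrite !big_split /= -!mulr_sumr (rd_var (rb ord0)) (rd_mean (rb ord0)).
  by rewrite (rd_sum (rb ord0)); lra.
move=> i _; rewrite -mulrDr -E /=.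
rewrite (eq_bigr (fun k => b ord0 i * (c i ^+ 2 * latwt (fun j => b (lift ord0 j)) k
   + latwt (fun j => b (lift ord0 j)) k * latsq k))); last by move=> k _; ring.
by rewrite -mulr_sumr big_split /= -mulr_sumr E0 mulr1.
Qed.

End Lattice.
Arguments lattice I d : clear implicits.

Section Spline.
Context {R : realType}.

Definition gridpt (K : nat) (i : 'I_(K.*2.+1)) : R := i%:R - K%:R.

(** The tails decrease at least like powers of 1/3, hence the sum without
   normalization is at most 2. *)
Lemma sum_gridpt_prior K :
  \sum_(i < K.*2.+1) expR (- (3 / 2 * gridpt i ^+ 2 + 4 / 5)) <= 1 :> R.
Proof.
have H K' : \sum_(i < K'.*2.+1) expR (- (3 / 2 * (i%:R - K'%:R) ^+ 2))
    <= 2 - 3^-1 ^+ K' :> R.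
  elim: K' => [|K' IH].
    by rewrite big_ord1 subrr expr0n !mulr0 oppr0 expR0 expr0; lra.
  rewrite doubleS big_ord_recl big_ord_recr /=.
  have e1 : expR (- (3 / 2 * (K'.+1%:R) ^+ 2)) <= 3^-1 ^+ K'.+1 :> R.
    apply: (@le_trans _ _ (expR (- (3 / 2)) ^+ K'.+1)).
      rewrite -expRM_natr ler_expR.
      have : 1 <= K'.+1%:R :> R by rewrite ler1n.
      nra.
    apply: lerXn2r; rewrite ?nnegrE ?expR_ge0 ?invr_ge0//.
    rewrite expRN lef_pV2 ?posrE ?expR_gt0//.
    have : 0 <= 3 / 2 :> R by lra.
    move=> /expR_ge_quadratic; lra.
  rewrite sub0r sqrrN (_ : (bump 0 _)%:R - _ = K'.+1%:R); last first.
    by rewrite /bump /= add1n -addnn -addSn -addnS natrD addrK.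
  rewrite (eq_bigr (fun i : 'I_(K'.*2.+1) =>
    expR (- (3 / 2 * (i%:R - K'%:R) ^+ 2)))).
    by move: IH e1; rewrite [3^-1 ^+ K'.+1]exprS; lra.
  move=> i _; congr (expR (- (_ * _ ^+ 2))).
  by rewrite /bump /= add1n -!natr1; lra.
rewrite (eq_bigr (fun i : 'I_(K.*2.+1) => expR (- (4 / 5)) *
   expR (- (3 / 2 * gridpt i ^+ 2)))); last first.
  by move=> i _; rewrite -expRD; congr expR; lra.
rewrite -mulr_sumr.
have S2 := H K.
have e0 : expR (- (4 / 5)) <= 2^-1 :> R.
  rewrite expRN lef_pV2 ?posrE ?expR_gt0//.
  have : 0 <= 4 / 5 :> R by lra.
  by move=> /expR_ge_quadratic; lra.
have : 0 <= 3^-1 ^+ K :> R by apply: exprn_ge0; rewrite invr_ge0.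
have := expR_ge0 (- (4 / 5) : R).
nra.
Qed.

(** The weights are those of the quadratic B-spline at the three nearest
   integers: for [t = m + r] with [m] the nearest integer, [m] receives
   [3 / 4 - r^2] and [m - 1], [m + 1] receive [(r -+ 1/2)^2 / 2]. *)
Lemma spline_rounding (K : nat) (t : R) : `|t| + 2 <= K%:R ->
  exists b, rounding (@gridpt K) t b.
Proof.
move=> tK.
have tK1 : - K%:R + 2 <= t by have := ler_norm (- t); rewrite normrN; lra.
have tK2 : t <= K%:R - 2 by have := ler_norm t; lra.
pose m := Num.floor (t + 2^-1); pose r := t - m%:~R.
have mt : m%:~R <= t + 2^-1 by exact: floor_le.
have mt' : t + 2^-1 < m%:~R + 1.
  by have := floorD1_gt (t + 2^-1); rewrite intrD.
have r1 : - 2^-1 <= r by rewrite /r; lra.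
have r2 : r <= 2^-1 by rewrite /r; lra.
(* [j], [j.+1] and [j.+2] are the grid indices of [m - 1], [m] and [m + 1]. *)
have [j jE] : exists j : nat, (m + K%:Z = j.+1%:Z).
  have : 0 < m + K%:Z.
    rewrite -(ltr_int R) intrD -[(K%:Z)%:~R]/(K%:R : R); lra.
  by case: (m + K%:Z)%R => // -[//|j] _; exists j.
have mE : m%:~R = j.+1%:R - K%:R :> R.
  by rewrite -[j.+1%:R]/((j.+1%:Z)%:~R : R) -jE intrD addrK.
have jK : (j.+2 < K.*2.+1)%N.
  rewrite -(ltr_nat R) -addnn -addSn natrD -[K.+1%:R]natr1 -[j.+2%:R]natr1.
  by lra.
have jK1 : (j.+1 < K.*2.+1)%N by apply: ltn_trans jK.
have jK0 : (j < K.*2.+1)%N by apply: ltn_trans jK1.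
pose b (i : 'I_(K.*2.+1)) : R :=
  ((r - 2^-1) ^+ 2 / 2) * (i == Ordinal jK0)%:R
  + (3 / 4 - r ^+ 2) * (i == Ordinal jK1)%:R
  + ((r + 2^-1) ^+ 2 / 2) * (i == Ordinal jK)%:R.
have pick (g : 'I_(K.*2.+1) -> R) i0 : \sum_i (i == i0)%:R * g i = g i0.
  rewrite (bigD1 i0)//= eqxx mul1r big1 ?addr0// => i /negbTE ->.
  by rewrite mul0r.
have sumb (g : R -> R) : \sum_i b i * g (gridpt i - t) =
    ((r - 2^-1) ^+ 2 / 2) * g (- r - 1) + (3 / 4 - r ^+ 2) * g (- r)
    + ((r + 2^-1) ^+ 2 / 2) * g (1 - r).
  rewrite (eq_bigr (fun i => ((r - 2^-1) ^+ 2 / 2) * ((i == Ordinal jK0)%:R * g (gridpt i - t))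
   + (3 / 4 - r ^+ 2) * ((i == Ordinal jK1)%:R * g (gridpt i - t))
   + ((r + 2^-1) ^+ 2 / 2) * ((i == Ordinal jK)%:R * g (gridpt i - t)))).
    rewrite !big_split /= -!mulr_sumr !pick /gridpt /=.
    congr (_ * g _ + _ * g _ + _ * g _).
    - by rewrite /r mE -natr1; lra.
    - by rewrite /r mE; lra.
    - by rewrite /r mE -[j.+2%:R]natr1; lra.
  by move=> i _; rewrite /b !mulrDl -!mulrA.
exists b; split.
- move=> i; rewrite /b; repeat apply: addr_ge0; apply: mulr_ge0 => //; nra.
- rewrite (eq_bigr (fun i => b i * 1)); last by move=> i; rewrite mulr1.
  by rewrite (sumb (fun=> 1)); field.
- by rewrite (sumb id); field.
- by rewrite (sumb (fun u => u ^+ 2)); field.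
- rewrite (sumb (fun u => u ^+ 4)).
  have -> : (r - 2^-1) ^+ 2 / 2 * (- r - 1) ^+ 4 + (3 / 4 - r ^+ 2) * (- r) ^+ 4 +
     (r + 2^-1) ^+ 2 / 2 * (1 - r) ^+ 4 = 1 / 4 - 3 / 2 * r ^+ 2 + 3 * r ^+ 4.
    by field.
  have -> : r ^+ 4 = r ^+ 2 * r ^+ 2 by rewrite -exprD.
  have := sqr_ge0 r; have : r ^+ 2 <= 4^-1 by nra.
  nra.
Qed.

End Spline.

(** * The PAC-Bayes inequality on the lattice *)

Section OneObservation.
Context {R : realType} {I : finType} (c : I -> R) {d : nat}.
Variables (s h B : R).
Implicit Types (x v : 'I_d -> R) (k : lattice I d).

Definition nrm2 x : R := \sum_j x j ^+ 2.

Definition lin v x : R := \sum_j v j * x j.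

Let w := h ^+ 2 / 4.

(** An unbiased version of [lin v x ^+ 2] when [k] is a rounding of [v / h]: the
   rounding adds [w * nrm2 x] to the mean of the square, which is subtracted.
   Observations of large norm are discarded, which only decreases the mean. *)
Definition latq k x : R :=
  if nrm2 x <= B then (h * latdot c k x) ^+ 2 - w * nrm2 x else 0.

Definition latexp k x : R := expR (s * (1 - latq k x)).

Lemma nrm2_ge0 x : 0 <= nrm2 x.
Proof. by apply: sumr_ge0 => j _; exact: sqr_ge0. Qed.

Lemma latexp_gt0 k x : 0 < latexp k x. Proof. exact: expR_gt0. Qed.

Let w0 : 0 <= w. Proof. by rewrite /w divr_ge0// sqr_ge0. Qed.

Lemma latq_ge k x : - (w * nrm2 x) <= latq k x.
Proof.
rewrite /latq; case: ifP => _; last by rewrite oppr_le0 mulr_ge0// nrm2_ge0.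
by rewrite lerDr sqr_ge0.
Qed.

Variables (v : 'I_d -> R) (b : 'I_d -> I -> R).
Hypothesis h0 : 0 < h.
Hypothesis rb : forall j, rounding c (v j / h) (b j).

Let wt_sum : \sum_k latwt b k = 1.
Proof. by apply: sum_latwt => j; exact: rd_sum (rb j). Qed.

Let wt_ge0 k : 0 <= latwt b k.
Proof. by apply: latwt_ge0 => j; exact: rd_ge0 (rb j). Qed.

(** Adding the square of [(h a)^2 - W - 2 u (h a)], where [a] is the rounding error,
   cancels the cubic terms: only the second and fourth moments of [a] remain. *)
Let latq_moments x : nrm2 x <= B ->
  \sum_k latwt b k * latq k x = lin v x ^+ 2 /\
  \sum_k latwt b k * latq k x ^+ 2 <=
    lin v x ^+ 4 + 8 * lin v x ^+ 2 * (w * nrm2 x) + 6 * (w * nrm2 x) ^+ 2.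
Proof.
move=> NB; have [E1 E2 E4] := lat_dev_moments x rb.
pose z k := latdot c k x - \sum_j v j / h * x j.
rewrite -/(nrm2 x) in E2 E4.
have hz k : h * latdot c k x = lin v x + h * z k.
  rewrite /z mulrBr (_ : h * \sum_j _ = lin v x) 1?addrC ?subrK//.
  rewrite mulr_sumr; apply: eq_bigr => j _; field.
  by rewrite gt_eqF.
have qE k : latq k x = (lin v x + h * z k) ^+ 2 - w * nrm2 x.
  by rewrite /latq NB hz.
set u := lin v x in qE *; set W := w * nrm2 x in qE *.
rewrite -/z in E1 E2 E4.
have E1' : \sum_k latwt b k * z k = 0 by exact: E1.
have E2' : \sum_k latwt b k * z k ^+ 2 = nrm2 x / 4 by exact: E2.
have E4' : \sum_k latwt b k * z k ^+ 4 <= nrm2 x ^+ 2 / 4 by exact: E4.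
split.
  rewrite (eq_bigr (fun k => (u ^+ 2 - W) * latwt b k
    + (2 * u * h) * (latwt b k * z k) + h ^+ 2 * (latwt b k * z k ^+ 2))).
    by rewrite !big_split /= -!mulr_sumr wt_sum E1' E2' /W /w; field.
  by move=> k _; rewrite qE; ring.
apply: (@le_trans _ _ (\sum_k ((u ^+ 4 - 2 * u ^+ 2 * W + 2 * W ^+ 2) * latwt b k
   + (4 * u ^+ 3 * h) * (latwt b k * z k)
   + (10 * u ^+ 2 * h ^+ 2 - 4 * W * h ^+ 2) * (latwt b k * z k ^+ 2)
   + 2 * h ^+ 4 * (latwt b k * z k ^+ 4)))).
  apply: ler_sum => k _; rewrite qE; set a := z k.
  have -> : (u ^+ 4 - 2 * u ^+ 2 * W + 2 * W ^+ 2) * latwt b k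
   + (4 * u ^+ 3 * h) * (latwt b k * a)
   + (10 * u ^+ 2 * h ^+ 2 - 4 * W * h ^+ 2) * (latwt b k * a ^+ 2)
   + 2 * h ^+ 4 * (latwt b k * a ^+ 4) =
   latwt b k * (((u + h * a) ^+ 2 - W) ^+ 2
     + ((h * a) ^+ 2 - W - 2 * u * (h * a)) ^+ 2) by ring.
  by rewrite ler_wpM2l// lerDl sqr_ge0.
rewrite !big_split /= -!mulr_sumr wt_sum E1' E2'.
have : 2 * h ^+ 4 * (\sum_k latwt b k * z k ^+ 4) <= 8 * W ^+ 2.
  apply: le_trans (ler_wpM2l _ E4') _.
    by rewrite mulr_ge0// exprn_even_ge0.
  by apply: le_of_eq; rewrite /W /w; field.
have -> : (10 * u ^+ 2 * h ^+ 2 - 4 * W * h ^+ 2) * (nrm2 x / 4) =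
  10 * u ^+ 2 * W - 4 * W ^+ 2 by rewrite /W /w; field.
rewrite -!mulrA; lra.
Qed.

Lemma latq_mean_le x : \sum_k latwt b k * latq k x <= lin v x ^+ 2.
Proof.
have [NB|NB] := leP (nrm2 x) B; first by rewrite (latq_moments NB).1.
rewrite big1 ?sqr_ge0// => k _.
by rewrite /latq leNgt NB /= mulr0.
Qed.

Hypothesis s01 : 0 < s <= 1.
Hypothesis B0 : 0 < B.
Hypothesis swB : s * w * B <= 1 / 4.

Let A := s ^+ 2 / 2 + 3 / 10 * s ^+ 3.

(** The argument of the exponential is at most [s * (1 + w * nrm2 x)], hence
   at most 5/4, and the cubic term of the Taylor bound is only paid where it is
   positive. When the observation is discarded, [nrm2 x / B] exceeds 1 and
   compensates the missing square. *)
Lemma latexp_mean_le x :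
  \sum_k latwt b k * latexp k x <=
  1 + s - (s + 2 * A) * lin v x ^+ 2 + (s + 2 * A) * (lin v x ^+ 2 * nrm2 x / B)
  + A * (1 + lin v x ^+ 4 + 8 * w * (lin v x ^+ 2 * nrm2 x)
         + 6 * w ^+ 2 * nrm2 x ^+ 2)
  + 3 / 5 * s ^+ 3 * w * nrm2 x + 3 / 20 * s ^+ 2 * w ^+ 2 * nrm2 x ^+ 2.
Proof.
set N := nrm2 x; set u := lin v x; have /andP[s0 s1] := s01.
have s3 : 0 < s ^+ 3 by apply: exprn_gt0.
have s2 : 0 < s ^+ 2 by apply: exprn_gt0.
have A0 : 0 <= A by rewrite /A; lra.
have N0 : 0 <= N := nrm2_ge0 x.
have u0 := sqr_ge0 u.
have W0 : 0 <= w * N by rewrite mulr_ge0.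
have [NB|NB] := leP N B; last first.
  rewrite (eq_bigr (fun k => latwt b k * expR s)); last first.
    by move=> k _; rewrite /latexp /latq leNgt NB /= subr0 mulr1.
  rewrite -mulr_suml wt_sum mul1r.
  have es : expR s <= 1 + s + s ^+ 2 / 2 + 3 / 10 * s ^+ 3.
    by apply: expR_le_cubic; rewrite (ltW s0)/=; lra.
  have H1 : u ^+ 2 <= u ^+ 2 * N / B.
    by rewrite -mulrA ler_peMr// ler_pdivlMr// mul1r ltW.
  have H2 : 0 <= A * (u ^+ 4 + 8 * w * (u ^+ 2 * N) + 6 * w ^+ 2 * N ^+ 2).
    apply: mulr_ge0 => //; apply: addr_ge0; first apply: addr_ge0.
    - by rewrite exprn_even_ge0.
    - by apply: mulr_ge0; apply: mulr_ge0.
    - by apply: mulr_ge0; rewrite ?sqr_ge0// mulr_ge0// sqr_ge0.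
  have H3 : 0 <= 3 / 5 * s ^+ 3 * w * N + 3 / 20 * s ^+ 2 * w ^+ 2 * N ^+ 2.
    have := mulr_ge0 (ltW s3) W0.
    by have := mulr_ge0 (ltW s2) (sqr_ge0 (w * N)); rewrite exprMn; lra.
  have H4 : 0 <= (s + 2 * A) * (u ^+ 2 * N / B - u ^+ 2).
    by rewrite mulr_ge0 ?subr_ge0//; lra.
  move: es; rewrite /A in H2 H4 *; lra.
have [Q1 Q2] := latq_moments NB; rewrite -/N -/u in Q1 Q2.
set W := w * N in W0 Q2.
have sW : s * W <= 1 / 4.
  by apply: le_trans swB; rewrite /W -mulrA ler_wpM2l ?(ltW s0)// ler_wpM2l.
have pw k : latexp k x <= 1 + s * (1 - latq k x) + A * (1 - latq k x) ^+ 2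
     + 3 / 5 * s ^+ 3 * W + 3 / 20 * s ^+ 2 * W ^+ 2.
  rewrite /latexp; set y := 1 - latq k x.
  have yW : y <= 1 + W by rewrite /y lerD2l lerNl; exact: latq_ge.
  have sy : s * y <= 5 / 4 by have := ler_wpM2l (ltW s0) yW; lra.
  have h1 := mulr_ge0 (ltW s3) W0.
  have h2 := mulr_ge0 (ltW s2) (sqr_ge0 W).
  have h3 := mulr_ge0 (ltW s3) (sqr_ge0 y).
  apply: le_trans (expR_le_taylor3 sy) _.
  have -> : A * y ^+ 2 = (s * y) ^+ 2 / 2 + 3 / 10 * (s ^+ 3 * y ^+ 2).
    by rewrite /A; ring.
  suff : (Num.max (s * y) 0) ^+ 3 <= s ^+ 3 * y ^+ 2 + 2 * (s ^+ 3 * W)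
      + 2^-1 * (s ^+ 2 * W ^+ 2) by lra.
  have [y0|y0] := leP y 0.
    by rewrite max_r ?pmulr_rle0//; rewrite expr0n /=; lra.
  rewrite max_l ?pmulr_rge0 ?(ltW y0)// exprMn.
  have [y1|y1] := leP y 1.
    have : s ^+ 3 * y ^+ 3 <= s ^+ 3 * y ^+ 2.
      by rewrite ler_pM2l// [leLHS]exprS ler_piMl ?sqr_ge0.
    by lra.
  have H1 : y ^+ 3 <= y ^+ 2 + (1 + W) ^+ 2 * W.
    have -> : y ^+ 3 = y ^+ 2 + y ^+ 2 * (y - 1) by ring.
    rewrite lerD2l; apply: ler_pM; rewrite ?sqr_ge0//; try lra.
    by apply: lerXn2r; rewrite ?nnegrE; lra.
  have H2 : (1 + W) ^+ 2 * W <= 2 * W + 2 * W ^+ 3.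
    have -> : 2 * W + 2 * W ^+ 3 = (1 + W) ^+ 2 * W + (1 - W) ^+ 2 * W by ring.
    by rewrite lerDl mulr_ge0// sqr_ge0.
  have H3 : s ^+ 3 * W ^+ 3 <= 4^-1 * (s ^+ 2 * W ^+ 2).
    have -> : s ^+ 3 * W ^+ 3 = (s * W) * (s ^+ 2 * W ^+ 2) by ring.
    by apply: ler_wpM2r => //; lra.
  have : s ^+ 3 * y ^+ 3 <= s ^+ 3 * (y ^+ 2 + (2 * W + 2 * W ^+ 3)).
    by rewrite ler_pM2l//; lra.
  lra.
apply: le_trans (ler_sum _ (fun k _ => ler_wpM2l (wt_ge0 k) (pw k))) _.
rewrite (eq_bigr (fun k => (1 + s + A + 3 / 5 * s ^+ 3 * W + 3 / 20 * s ^+ 2 * W ^+ 2)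
    * latwt b k - (s + 2 * A) * (latwt b k * latq k x)
    + A * (latwt b k * latq k x ^+ 2))); last by move=> k _; ring.
rewrite !big_split /= sumrN -!mulr_sumr wt_sum Q1.
have := ler_wpM2l A0 Q2.
have : 0 <= (s + 2 * A) * (u ^+ 2 * N / B).
  apply: mulr_ge0; first by lra.
  by rewrite divr_ge0 ?(ltW B0)// mulr_ge0.
rewrite /W; lra.
Qed.

End OneObservation.

Section PacBayes.
Context {R : realType} {I : finType} (c : I -> R) {d n : nat}.
Variables (s h B : R).

(** A mixture of exponential likelihood ratios: every factor has expectation
   one when [L k] is the expectation of [latexp k], so that the mixture over a
   subprobability has expectation at most one on independent observations. *)
Definition pacmix (L : lattice I d -> R) (xs : 'I_n -> 'I_d -> R) : R :=
  \sum_(k : lattice I d)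
    latprior c k * \prod_(i < n) (latexp c s h B k (xs i) / L k).

Lemma pacmix_gt0 (k0 : lattice I d) L xs : (forall k, 0 < L k) ->
  0 < pacmix L xs.
Proof.
move=> L0; rewrite /pacmix (bigD1 k0)//= ltr_pwDl//.
  by rewrite mulr_gt0 ?expR_gt0// prodr_gt0// => i _; rewrite divr_gt0// latexp_gt0.
apply: sumr_ge0 => k _; rewrite mulr_ge0 ?expR_ge0// prodr_ge0// => i _.
by rewrite divr_ge0// ltW// latexp_gt0.
Qed.

Lemma jensen_expR (K : finType) (p F : K -> R) :
  (forall k, 0 <= p k) -> \sum_k p k = 1 ->
  expR (\sum_k p k * F k) <= \sum_k p k * expR (F k).
Proof.
move=> p0 p1; set m := \sum_k _ * F k.
apply: (@le_trans _ _ (\sum_k p k * (expR m * (1 + (F k - m))))).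
  rewrite (eq_bigr (fun k => expR m * ((1 - m) * p k + p k * F k))).
    by rewrite -mulr_sumr big_split /= -mulr_sumr p1 mulr1 subrK mulr1.
  by move=> k _; ring.
apply: ler_sum => k _; rewrite ler_wpM2l//.
have -> : expR (F k) = expR m * expR (F k - m).
  by rewrite -expRD; congr expR; ring.
by rewrite ler_pM2l ?expR_gt0// expR_ge1Dx.
Qed.

(** Jensen's inequality for the posterior weights [latwt b] against the prior.
   These weights are at most 1, so that their relative entropy is at most the
   mean of [- ln (latprior c k)], a second moment of the rounding. *)
Lemma pac_bayes (v : 'I_d -> R) (b : 'I_d -> I -> R) (L : lattice I d -> R)
    (xs : 'I_n -> 'I_d -> R) :
  0 < h -> 0 <= s -> (forall j, rounding c (v j / h) (b j)) ->
  (forall k, 0 < L k) ->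
  s * \sum_i (1 - lin v (xs i) ^+ 2) <=
  ln (pacmix L xs) + n%:R * (\sum_k latwt b k * L k - 1)
  + (3 / 2 * (nrm2 v / h ^+ 2 + d%:R / 4) + 4 / 5 * d%:R).
Proof.
move=> h0 s0 rb L0.
have wt0 k : 0 <= latwt b k by apply: latwt_ge0 => j; exact: rd_ge0 (rb j).
have wt1 : \sum_k latwt b k = 1 by apply: sum_latwt => j; exact: rd_sum (rb j).
pose F k := - (3 / 2 * latsq c k + 4 / 5 * d%:R)
  + s * \sum_i (1 - latq c h B k (xs i)) - n%:R * ln (L k).
have FE : pacmix L xs = \sum_k expR (F k).
  apply: eq_bigr => k _; rewrite /F 2!expRD; rewrite -mulrA; congr (_ * _).
  rewrite expRN expRM_natl lnK ?posrE// prodf_div prodr_const card_ord.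
  by rewrite mulr_sumr expR_sum.
have M0 : 0 < pacmix L xs.
  case: (pickP (fun k : lattice I d => true)) => [k0 _|k0]; first exact: pacmix_gt0.
  by move: wt1; rewrite big_pred0// => /eqP; rewrite eq_sym oner_eq0.
have H1 : \sum_k latwt b k * F k <= ln (pacmix L xs).
  rewrite -ler_expR lnK ?posrE// FE.
  apply: le_trans (jensen_expR _ wt0 wt1) _.
  apply: ler_sum => k _; rewrite ler_piMl ?expR_ge0//.
  by apply: latwt_le1 => j; [exact: rd_ge0 (rb j)|exact: rd_sum (rb j)].
have H2 : \sum_k latwt b k * latsq c k = nrm2 v / h ^+ 2 + d%:R / 4.
  rewrite (lat_sq_mean rb) /nrm2 mulr_suml; congr (_ + _).
  by apply: eq_bigr => j _; rewrite exprMn exprVn.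
have H3 : s * \sum_i (1 - lin v (xs i) ^+ 2) <=
    s * \sum_k latwt b k * \sum_i (1 - latq c h B k (xs i)).
  rewrite ler_wpM2l//.
  rewrite (eq_bigr (fun k => \sum_i (latwt b k * (1 - latq c h B k (xs i))))); last first.
    by move=> k _; rewrite mulr_sumr.
  rewrite exchange_big /=; apply: ler_sum => i _.
  rewrite (eq_bigr (fun k => latwt b k - latwt b k * latq c h B k (xs i))); last first.
    by move=> k _; rewrite mulrBr mulr1.
  rewrite big_split /= sumrN wt1 lerD2l lerN2.
  exact: latq_mean_le.
have H4 : \sum_k latwt b k * ln (L k) <= \sum_k latwt b k * L k - 1.
  rewrite -[X in _ <= _ - X]wt1 -sumrB; apply: ler_sum => k _.
  rewrite -[X in _ - X]mulr1 -mulrBr ler_wpM2l//.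
  have := @le_ln1Dx R (L k - 1); rewrite (_ : 1 + (L k - 1) = L k).
    by apply; have := L0 k; lra.
  by ring.
have E : \sum_k latwt b k * F k = - (3 / 2 * (\sum_k latwt b k * latsq c k))
   - 4 / 5 * d%:R + s * \sum_k latwt b k * \sum_i (1 - latq c h B k (xs i))
   - n%:R * \sum_k latwt b k * ln (L k).
  rewrite (eq_bigr (fun k => - (3 / 2) * (latwt b k * latsq c k)
    + (- (4 / 5 * d%:R)) * latwt b k
    + s * (latwt b k * \sum_i (1 - latq c h B k (xs i)))
    + (- n%:R) * (latwt b k * ln (L k)))).
    rewrite !big_split /= -!mulr_sumr wt1; ring.
  by move=> k _; rewrite /F; ring.
have := ler_wpM2l (ler0n R n) H4.
move: H1; rewrite E H2; lra.
Qed.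

End PacBayes.

(** * Integrals, independence and equality in law *)

Section NonnegExpectation.
Context {disp : measure_display} {T : measurableType disp} {R : realType}
  (P : {measure set T -> \bar R}).
Implicit Types f g : T -> R.

Lemma ge0_Eint_Zl (r : R) f : 0 <= r -> measurable_fun setT f ->
  (forall x, 0 <= f x) ->
  (\int[P]_x (r * f x)%:E = r%:E * \int[P]_x (f x)%:E)%E.
Proof.
move=> r0 mf f0; under eq_integral do rewrite EFinM.
apply: ge0_integralZl_EFin => //; last exact/measurable_EFinP.
by move=> x _; rewrite lee_fin.
Qed.

Lemma ge0_Eint_D f g : measurable_fun setT f -> measurable_fun setT g ->
  (forall x, 0 <= f x) -> (forall x, 0 <= g x) ->
  (\int[P]_x (f x + g x)%:E = \int[P]_x (f x)%:E + \int[P]_x (g x)%:E)%E.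
Proof.
move=> mf mg f0 g0; under eq_integral do rewrite EFinD.
apply: ge0_integralD => //; first [exact/measurable_EFinP|by move=> x _; rewrite lee_fin].
Qed.

Lemma ge0_Eint_le f g : measurable_fun setT f -> measurable_fun setT g ->
  (forall x, 0 <= f x) -> (forall x, f x <= g x) ->
  (\int[P]_x (f x)%:E <= \int[P]_x (g x)%:E)%E.
Proof.
move=> mf mg f0 fg; apply: ge0_le_integral => //;
  by [exact/measurable_EFinP|move=> x _; rewrite lee_fin].
Qed.

Lemma ge0_Eint_sum (I : finType) (F : I -> T -> R) :
  (forall i, measurable_fun setT (F i)) -> (forall i x, 0 <= F i x) ->
  (\int[P]_x (\sum_i F i x)%:E = \sum_i \int[P]_x (F i x)%:E)%E.
Proof.
move=> mF F0; under eq_integral do rewrite -sumEFin.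
apply: ge0_integral_sum => // [i|i x _]; last by rewrite lee_fin.
exact/measurable_EFinP.
Qed.

Lemma measurable_level (f : T -> R) (r : R) :
  measurable_fun setT f -> measurable [set w | f w <= r].
Proof.
move=> mf; rewrite (_ : [set w | _] = setT `&` f @^-1` `]-oo, r]%classic).
  by apply: mf => //; exact: measurable_itv.
by rewrite setTI; apply/seteqP; split=> w /=; rewrite in_itv.
Qed.

End NonnegExpectation.

Section Transfer.
Context {disp dU : measure_display} {T : measurableType disp}
  {U : measurableType dU} {R : realType} (P : probability T R).
Import HBNNSimple.

(** An identity between integrals that holds for indicators extends to nonnegative
   functions by simple approximation. Equality in law ([h = 1], [c = 1]) and the
   two factors of an independent product are instances. *)
Lemma ge0_integral_ext (h : T -> R) (Z Z0 : T -> U) (c : R) :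
  measurable_fun setT h -> (forall x, 0 <= h x) ->
  measurable_fun setT Z -> measurable_fun setT Z0 -> 0 <= c ->
  (forall B, measurable B ->
     \int[P]_x (h x * \1_B (Z x))%:E = c%:E * P (Z0 @^-1` B))%E ->
  forall f : U -> R, measurable_fun setT f -> (forall u, 0 <= f u) ->
  (\int[P]_x (h x * f (Z x))%:E = c%:E * \int[P]_x (f (Z0 x))%:E)%E.
Proof.
move=> mh h0 mZ mZ0 c0 HB f mf f0.
have mfE : measurable_fun setT (EFin \o f) by exact/measurable_EFinP.
pose f_ := nnsfun_approx measurableT mfE.
have cvf u : (EFin \o f_ ^~ u) @ \oo --> (f u)%:E.
  by apply: (cvg_nnsfun_approx measurableT mfE) => // v _; rewrite lee_fin.
have ndf u a b : (a <= b)%N -> f_ a u <= f_ b u.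
  by move=> ab; exact/lefP/nd_nnsfun_approx.
have step n : (\int[P]_x (h x * f_ n (Z x))%:E = c%:E * \int[P]_x (f_ n (Z0 x))%:E)%E.
  have nn r u : 0 <= r * \1_(f_ n @^-1` [set r]) u.
    by have := nnfun_muleindic_ge0 (f_ n) r u; rewrite -EFinM lee_fin.
  have mind r (W : T -> U) : measurable_fun setT W ->
      measurable_fun setT (fun x => r * \1_(f_ n @^-1` [set r]) (W x)).
    by move=> mW; apply: measurable_funM => //; apply: measurableT_comp mW;
       exact: measurable_indic.
  transitivity (\sum_(r \in range (f_ n))
      \int[P]_x (h x * (r * \1_(f_ n @^-1` [set r]) (Z x)))%:E)%E.
    rewrite -ge0_integral_fsum//; last 2 first.
    - by move=> r; apply/measurable_EFinP; apply: measurable_funM => //; exact: mind.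
    - by move=> r x _; rewrite lee_fin mulr_ge0.
    apply: eq_integral => x _; rewrite fimfunE fsumEFin//; congr EFin.
    by rewrite fsbig_finite//= fsbig_finite//= mulr_sumr.
  transitivity (\sum_(r \in range (f_ n))
      c%:E * \int[P]_x (r * \1_(f_ n @^-1` [set r]) (Z0 x))%:E)%E.
    apply: eq_fsbigr => r _.
    have [r0|r0] := leP 0 r; last first.
      rewrite preimage_nnfun0//.
      under eq_integral do rewrite indic0 /= mulr0 mulr0.
      under [in RHS]eq_integral do rewrite indic0 /= mulr0.
      by rewrite !integral0 mule0.
    under eq_integral do rewrite mulrCA.
    have mA : measurable (f_ n @^-1` [set r]) by [].
    have mi (W : T -> U) : measurable_fun setT W ->
        measurable_fun setT (fun x => \1_(f_ n @^-1` [set r]) (W x) : R).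
      by move=> mW; apply: measurableT_comp mW; exact: measurable_indic.
    rewrite ge0_Eint_Zl//; last by move=> x; rewrite mulr_ge0// indicE.
      rewrite ge0_Eint_Zl//; last exact: mi.
      rewrite HB// muleCA; congr (_ * (_ * _))%E.
      have mZA : measurable (Z0 @^-1` (f_ n @^-1` [set r])).
        by rewrite -[X in measurable X]setTI; exact: mZ0.
      have -> : (fun x => (\1_(f_ n @^-1` [set r]) (Z0 x))%:E) =
         (fun x => (\1_(Z0 @^-1` (f_ n @^-1` [set r])) x)%:E : \bar R) by [].
      by rewrite integral_indic// setIT.
    by apply: measurable_funM => //; exact: mi.
  rewrite -ge0_mule_fsumr; last first.
    by move=> r; apply: integral_ge0 => x _; rewrite lee_fin.
  congr (_ * _)%E; rewrite -ge0_integral_fsum//; last 2 first.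
  - by move=> r; apply/measurable_EFinP; exact: mind.
  - by move=> r x _; rewrite lee_fin.
  by apply: eq_integral => x _; rewrite [in RHS]fimfunE fsumEFin.
transitivity (limn (fun n => \int[P]_x (h x * f_ n (Z x))%:E)%E).
  rewrite -monotone_convergence//.
  - apply: eq_integral => x _; apply/esym/cvg_lim => //.
    under eq_fun do rewrite EFinM.
    by rewrite EFinM; apply: cvgeZl => //; exact: cvf.
  - move=> n; apply/measurable_EFinP; apply: measurable_funM => //.
    exact: measurableT_comp mZ.
  - by move=> n x _; rewrite lee_fin mulr_ge0.
  - by move=> x _ a b ab; rewrite lee_fin ler_wpM2l// ndf.
have -> : (\int[P]_x (f (Z0 x))%:E = limn (fun n => \int[P]_x (f_ n (Z0 x))%:E))%E.
  rewrite -monotone_convergence//.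
  - by apply: eq_integral => x _; apply/esym/cvg_lim => //; exact: cvf.
  - by move=> n; apply/measurable_EFinP; exact: measurableT_comp mZ0.
  - by move=> n x _; rewrite lee_fin.
  - by move=> x _ a b ab; rewrite lee_fin ndf.
rewrite -limeMl//.
  by congr (limn _); apply/funext => n; exact: step.
apply/ereal_nondecreasing_is_cvgn => a b ab; apply: ge0_le_integral => //.
- by move=> x _; rewrite lee_fin.
- by apply/measurable_EFinP; exact: measurableT_comp mZ0.
- by apply/measurable_EFinP; exact: measurableT_comp mZ0.
- by move=> x _; rewrite lee_fin ndf.
Qed.

Lemma Eint_cst (c : R) : (\int[P]__ c%:E = c%:E)%E.
Proof. by rewrite integral_cst// [X in (_ * X)%E](probability_setT P) mule1. Qed.

Lemma measurable_preimage (Z : T -> U) (B : set U) :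
  measurable_fun setT Z -> measurable B -> measurable (Z @^-1` B).
Proof. by move=> mZ mB; rewrite -[X in measurable X]setTI; exact: mZ. Qed.

Lemma integral_indic_comp (Z : T -> U) (B : set U) :
  measurable_fun setT Z -> measurable B ->
  (\int[P]_x (\1_B (Z x))%:E = P (Z @^-1` B))%E.
Proof.
move=> mZ mB; have mZB := measurable_preimage mZ mB.
have -> : (fun x => (\1_B (Z x))%:E) = (fun x => (\1_(Z @^-1` B) x)%:E : \bar R) by [].
by rewrite integral_indic// setIT.
Qed.

Lemma ge0_same_law_integral (Z Z0 : T -> U) (f : U -> R) :
  measurable_fun setT Z -> measurable_fun setT Z0 -> same_law P Z Z0 ->
  measurable_fun setT f -> (forall u, 0 <= f u) ->
  (\int[P]_x (f (Z x))%:E = \int[P]_x (f (Z0 x))%:E)%E.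
Proof.
move=> mZ mZ0 law mf f0.
transitivity (\int[P]_x (cst 1 x * f (Z x))%:E)%E.
  by apply: eq_integral => x _; rewrite mul1r.
rewrite (@ge0_integral_ext (cst 1) Z Z0 1) ?mul1e// => B mB.
rewrite mul1e -law// -integral_indic_comp//.
by apply: eq_integral => x _; rewrite mul1r.
Qed.

(** The factors are replaced one by one, from indicators to arbitrary functions:
   in the induction the factors of index at least [m] are indicators. *)
Lemma ge0_integral_prod_indep (n : nat) (Z : 'I_n -> T -> U) (f : 'I_n -> U -> R) :
  (forall i, measurable_fun setT (Z i)) -> mutually_independent P Z ->
  (forall i, measurable_fun setT (f i)) -> (forall i u, 0 <= f i u) ->
  (forall i, (\int[P]_x (f i (Z i x))%:E < +oo)%E) ->
  (\int[P]_x (\prod_i f i (Z i x))%:E = \prod_i \int[P]_x (f i (Z i x))%:E)%E.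
Proof.
move=> mZ indep.
suff H (m : nat) : (m <= n)%N -> forall f : 'I_n -> U -> R,
  (forall i, measurable_fun setT (f i)) -> (forall i u, 0 <= f i u) ->
  (forall i, (\int[P]_x (f i (Z i x))%:E < +oo)%E) ->
  (forall i : 'I_n, (m <= i)%N -> exists2 B, measurable B & f i = \1_B) ->
  (\int[P]_x (\prod_i f i (Z i x))%:E = \prod_i \int[P]_x (f i (Z i x))%:E)%E.
  move=> mf f0 foo; apply: (H n) => // i; by rewrite leqNgt ltn_ord.
elim: m => [_|m IH mn] {}f mf f0 foo fB.
  have /choice[B BP] : forall i, exists B, measurable B /\ f i = \1_B.
    by move=> i; have [B mB fE] := fB i isT; exists B.
  transitivity (P (\bigcap_(i in [set: 'I_n]) (Z i @^-1` B i))).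
    have mI : measurable (\bigcap_(i in [set: 'I_n]) (Z i @^-1` B i)).
      apply: fin_bigcap_measurable => // i _.
      by apply: measurable_preimage => //; have [] := BP i.
    rewrite -[X in P X]setIT -integral_indic//.
    apply: eq_integral => x _; congr EFin; rewrite indicE.
    have [xI|xI] := boolP (x \in _).
      rewrite big1// => i _; have [_ ->] := BP i; rewrite indicE mem_set//.
      by move: xI; rewrite inE; apply.
    have [i iP] : exists i, ~ B i (Z i x).
      by apply/existsNP => H; move/negP: xI; apply; rewrite inE => i _; exact: H.
    apply/eqP/prodf_eq0; exists i => //.
    by have [_ ->] := BP i; rewrite indicE memNset.
  rewrite indep; last by move=> i; have [] := BP i.
  apply: eq_bigr => i _; have [mB ->] := BP i.
  by rewrite integral_indic_comp.
pose m' := Ordinal mn.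
pose h x := \prod_(i < n | i != m') f i (Z i x).
have E1 x : \prod_i f i (Z i x) = h x * f m' (Z m' x).
  by rewrite (bigD1 m')//= mulrC.
under eq_integral do rewrite E1.
rewrite (bigD1 m')//= muleC.
have c0 : (0 <= \prod_(i < n | i != m') \int[P]_x (f i (Z i x))%:E)%E.
  by apply: prode_ge0 => i _; apply: integral_ge0 => x _; rewrite lee_fin.
have cfin : (\prod_(i < n | i != m') \int[P]_x (f i (Z i x))%:E)%E \is a fin_num.
  elim/big_ind: _ => //; first by move=> x y xf yf; rewrite fin_numM.
  move=> i _; rewrite ge0_fin_numE ?foo//; apply: integral_ge0 => x _.
  by rewrite lee_fin.
rewrite -(fineK cfin); apply: ge0_integral_ext => //.
- rewrite (_ : h = fun x => \prod_i (if i != m' then f i (Z i x) else 1)).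
    apply: measurable_prod => i _; case: (i != m') => //.
    exact: measurableT_comp (mZ i).
  by apply/funext => x; rewrite /h big_mkcond.
- by move=> x; apply: prodr_ge0 => i _.
- exact: fine_ge0.
rewrite fineK//.
move=> B mB; rewrite -integral_indic_comp// muleC.
pose g i := if i == m' then \1_B else f i.
have gne i : i != m' -> g i = f i by rewrite /g => /negbTE ->.
have gm : g m' = \1_B by rewrite /g eqxx.
have := IH (ltnW mn) g; rewrite [in RHS](bigD1 m')//= gm.
rewrite (eq_bigr (fun i => \int[P]_x (f i (Z i x))%:E)%E); last first.
  by move=> i /gne ->.
move=> <-.
- apply: eq_integral => x _; rewrite [in RHS](bigD1 m')//= gm mulrC.
  by congr (_ * _)%:E; apply: eq_bigr => i /gne ->.
- by move=> i; rewrite /g; case: eqP => _ //; exact: measurable_indic.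
- by move=> i u; rewrite /g; case: eqP => _ //; rewrite indicE.
- move=> i; rewrite /g; case: eqP => [->|_]; last exact: foo.
  rewrite integral_indic_comp//; apply: le_lt_trans (ltry 1).
  exact/probability_le1/measurable_preimage.
- move=> i; rewrite leq_eqVlt => /orP[/eqP mi|mi].
    by exists B => //; rewrite (_ : i = m') ?gm//; exact/val_inj.
  have [B' mB' fB'] := fB i mi; exists B' => //; rewrite gne//.
  by apply/eqP => im; rewrite im /= ltnn in mi.
Qed.

End Transfer.

(** * Lower bound on the empirical Gram matrix *)

Section Moments.
Context {R : realType} {d : nat}.
Implicit Types x v : 'I_d -> R.

Lemma mean_sq_le (a b : R) : a * b <= (a ^+ 2 + b ^+ 2) / 2.
Proof. by have := sqr_ge0 (a - b); rewrite sqrrB; lra. Qed.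

Lemma nrm2_sq_le x : nrm2 x ^+ 2 <= d%:R * \sum_j x j ^+ 4.
Proof.
rewrite expr2 {1}/nrm2 mulr_suml.
apply: (@le_trans _ _ (\sum_j \sum_k (x j ^+ 4 + x k ^+ 4) / 2)).
  apply: ler_sum => j _; rewrite /nrm2 mulr_sumr; apply: ler_sum => k _.
  by have := mean_sq_le (x j ^+ 2) (x k ^+ 2); rewrite -!exprM.
apply: le_of_eq.
rewrite (eq_bigr (fun j => 2^-1 * (d%:R * x j ^+ 4) + 2^-1 * \sum_k x k ^+ 4)).
  by rewrite big_split /= -!mulr_sumr sumr_const card_ord -[_ *+ d]mulr_natl; field.
move=> j _; rewrite -mulr_suml big_split /= sumr_const card_ord -[_ *+ d]mulr_natl.
by ring.
Qed.

Lemma lin_sq_nrm2_le v x :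
  lin v x ^+ 2 * nrm2 x <= 2^-1 * (d%:R * lin v x ^+ 4 + \sum_j x j ^+ 4).
Proof.
rewrite /nrm2 mulr_sumr.
apply: (@le_trans _ _ (\sum_j 2^-1 * (lin v x ^+ 4 + x j ^+ 4))).
  apply: ler_sum => j _.
  by have := mean_sq_le (lin v x ^+ 2) (x j ^+ 2); rewrite -!exprM; lra.
by rewrite -mulr_sumr big_split /= sumr_const card_ord -[_ *+ d]mulr_natl.
Qed.

End Moments.

(** Bookkeeping of the expected exponential against the entropy for the truncation
   level [B = n D] with [D^2 = (1 + k) d / n] and the rounding variance
   [w = 1 / (4 s B)], which balance the terms of order [n s D]. *)
Lemma pac_constants (R : realType) (s k d n D B S : R) :
  0 < s <= 1 -> 0 <= k -> 0 <= d -> 0 < n -> 0 < D -> 0 < B ->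
  B = n * D -> D * B = (1 + k) * d ->
  let A := s ^+ 2 / 2 + 3 / 10 * s ^+ 3 in
  let w := (4 * s * B)^-1 in
  S + (s + 2 * A) <= 1 + s + (s + 2 * A) * (((1 + k) * d) / B)
    + A * (1 + (1 + k) + 8 * w * ((1 + k) * d) + 6 * w ^+ 2 * ((1 + k) * d ^+ 2))
    + 3 / 5 * s ^+ 3 * w * d + 3 / 20 * s ^+ 2 * w ^+ 2 * ((1 + k) * d ^+ 2) ->
  n * (S - 1) + (3 / 2 * (s * B + d / 4) + 4 / 5 * d) <=
  n * k * A + 585 / 100 * (n * s * D) + 149 / 100 * d.
Proof.
move=> /andP[s0 s1] k0 d0 n0 D0 B0 BE DB A w.
have s2 : 0 < s ^+ 2 by apply: exprn_gt0.
have s32 : s ^+ 3 <= s ^+ 2 by rewrite exprS ler_piMl// ltW.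
have s21 : s ^+ 2 <= s by rewrite expr2 ler_piMl// ltW.
have s3 : 0 < s ^+ 3 by apply: exprn_gt0.
have -> : ((1 + k) * d) / B = D by rewrite -DB mulfK ?gt_eqF.
have -> : 8 * w * ((1 + k) * d) = 2 * D / s.
  by rewrite -DB /w; field; rewrite !gt_eqF.
have -> : 6 * w ^+ 2 * ((1 + k) * d ^+ 2) = 3 / 8 * d / (s ^+ 2 * n).
  have -> : (1 + k) * d ^+ 2 = D * B * d by rewrite DB; ring.
  by rewrite /w BE; field; rewrite !gt_eqF.
have -> : 3 / 20 * s ^+ 2 * w ^+ 2 * ((1 + k) * d ^+ 2) = 3 / 320 * d / n.
  have -> : (1 + k) * d ^+ 2 = D * B * d by rewrite DB; ring.
  by rewrite /w BE; field; rewrite !gt_eqF.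
have wd : w * d <= D / (4 * s).
  have : d <= D * B by rewrite DB; nra.
  rewrite -(ler_pM2l (_ : 0 < w)) ?invr_gt0 ?mulr_gt0//; try lra.
  move/le_trans; apply; apply: le_of_eq.
  by rewrite /w; field; rewrite !gt_eqF.
have H1 : 3 / 5 * s ^+ 3 * w * d <= 3 / 20 * (s * D).
  rewrite -[leLHS]mulrA; apply: (@le_trans _ _ (3 / 5 * s ^+ 3 * (D / (4 * s)))).
    by rewrite ler_wpM2l//; lra.
  have -> : 3 / 5 * s ^+ 3 * (D / (4 * s)) = 3 / 20 * (s ^+ 2 * D).
    by field; rewrite gt_eqF.
  by rewrite ler_pM2l ?ler_pM2r//; lra.
have A1 : A <= 8 / 10 * s ^+ 2 by rewrite /A; lra.
have A0 : 0 < A by rewrite /A; lra.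
have H2 : A * (2 * D / s) <= 16 / 10 * (s * D).
  have -> : A * (2 * D / s) = A * (2 / s * D) by ring.
  apply: (@le_trans _ _ (8 / 10 * s ^+ 2 * (2 / s * D))).
    by rewrite ler_pM2r// mulr_gt0// divr_gt0.
  by apply: le_of_eq; field; rewrite gt_eqF.
have H3 : A * (3 / 8 * d / (s ^+ 2 * n)) <= 3 / 10 * d / n.
  apply: (@le_trans _ _ (8 / 10 * s ^+ 2 * (3 / 8 * d / (s ^+ 2 * n)))).
    by rewrite ler_wpM2r// divr_ge0 ?mulr_ge0// ltW.
  by apply: le_of_eq; field; rewrite !gt_eqF.
have H4 : (s + 2 * A) * D <= 26 / 10 * (s * D).
  by rewrite mulrA ler_pM2r//; lra.
have H5 : 0 <= d / n by rewrite divr_ge0// ltW.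
move: H1 H2 H3 H4; rewrite -[3 / 10 * d / n]mulrA -[3 / 320 * d / n]mulrA.
set t1 := 3 / 5 * s ^+ 3 * w * d; set X2 := 2 * D / s; set X3 := 3 / 8 * d / _.
set t4 := (s + 2 * A) * D => H1 H2 H3 H4 H.
have {H} H : S - 1 <= A * k + A * X2 + A * X3 + t4 + t1 + 3 / 320 * (d / n).
  have E : A * (1 + (1 + k) + X2 + X3) = 2 * A + A * k + A * X2 + A * X3 by ring.
  by move: H; rewrite E; lra.
have {H1 H2 H3 H4} H6 : S - 1 <= k * A + 585 / 100 * (s * D) - 3 / 2 * (s * D)
    + 31 / 100 * (d / n).
  by rewrite [k * A]mulrC; lra.
have := ler_wpM2l (ltW n0) H6.
have -> : n * (k * A + 585 / 100 * (s * D) - 3 / 2 * (s * D) + 31 / 100 * (d / n))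
  = n * k * A + 585 / 100 * (n * s * D) - 3 / 2 * (n * s * D) + 31 / 100 * d.
  by field; rewrite gt_eqF.
have -> : s * B = n * s * D by rewrite BE; ring.
by rewrite mulrBr mulr1; lra.
Qed.

Ltac meas := repeat first
  [ exact: measurable_cst | assumption | solve [auto]
  | apply: measurable_funD | apply: measurable_funB | apply: measurable_funM
  | apply: measurable_funX | apply: measurable_funN
  | apply: measurable_sum => ? | apply: measurable_prod => ? _
  | apply: (measurableT_comp (@measurable_expR _)) ].

Section Core.
Context {disp dU : measure_display} {T : measurableType disp}
  {U : measurableType dU} {R : realType} (P : probability T R) {d : nat}.
Variables (x : U -> 'I_d -> R) (Z0 : T -> U) (kappa : R).
Hypothesis mx : forall j, measurable_fun setT (x ^~ j).
Hypothesis mZ0 : measurable_fun setT Z0.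
Hypothesis x2 : forall j, (\int[P]_w (x (Z0 w) j ^+ 2)%:E <= 1)%E.
Hypothesis x4 : forall v : 'I_d -> R, nrm2 v <= 1 ->
  (\int[P]_w (lin v (x (Z0 w)) ^+ 4)%:E <= kappa%:E)%E.

Let X w := x (Z0 w).

Let mX j : measurable_fun setT (fun w => X w j).
Proof. exact: measurableT_comp (mx j) mZ0. Qed.

Let mN : measurable_fun setT (fun w => nrm2 (X w)).
Proof. by rewrite /nrm2; meas. Qed.

Let mlin v : measurable_fun setT (fun w => lin v (X w)).
Proof. by rewrite /lin; meas. Qed.

Let xj4 j : (\int[P]_w (X w j ^+ 4)%:E <= kappa%:E)%E.
Proof.
have := @x4 (fun k => (k == j)%:R); rewrite /nrm2 (bigD1 j)//= eqxx expr1n.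
rewrite big1 ?addr0; last by move=> k /negbTE ->; rewrite mulr0n expr0n.
move=> /(_ (lexx _)); apply: le_trans; apply: le_of_eq.
apply: eq_integral => w _; rewrite /lin (bigD1 j)//= eqxx mul1r big1 ?addr0//.
by move=> k /negbTE ->; rewrite mulr0n mul0r.
Qed.

Let EN : (\int[P]_w (nrm2 (X w))%:E <= d%:R%:E)%E.
Proof.
rewrite /nrm2 ge0_Eint_sum; last 2 first.
- by move=> j; meas.
- by move=> j w; exact: sqr_ge0.
apply: (@le_trans _ _ (\sum_(j < d) 1%:E)%E); first by apply: lee_sum => j _; exact: x2.
by rewrite sumEFin sumr_const card_ord.
Qed.

Let Es4 : (\int[P]_w (\sum_j X w j ^+ 4)%:E <= (d%:R * kappa)%:E)%E.
Proof.
rewrite ge0_Eint_sum; last 2 first.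
- by move=> j; meas.
- by move=> j w; rewrite exprn_even_ge0.
apply: (@le_trans _ _ (\sum_(j < d) kappa%:E)%E); first by apply: lee_sum => j _; exact: xj4.
by rewrite sumEFin sumr_const card_ord -[_ *+ d]mulr_natl.
Qed.

Let EN2 : (\int[P]_w (nrm2 (X w) ^+ 2)%:E <= (kappa * d%:R ^+ 2)%:E)%E.
Proof.
apply: (@le_trans _ _ (\int[P]_w (d%:R * \sum_j X w j ^+ 4)%:E)%E).
  apply: ge0_Eint_le; [by meas|by meas|by move=> w; exact: sqr_ge0|].
  by move=> w; exact: nrm2_sq_le.
rewrite ge0_Eint_Zl//; last 2 first.
- by meas.
- by move=> w; apply: sumr_ge0 => j _; rewrite exprn_even_ge0.
apply: le_trans (lee_pmul _ _ (lexx _) Es4) _ => //.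
  by apply: integral_ge0 => w _; rewrite lee_fin; apply: sumr_ge0 => j _; rewrite exprn_even_ge0.
by rewrite -EFinM lee_fin; apply: le_of_eq; ring.
Qed.

Section Direction.
Variable v : 'I_d -> R.
Hypothesis v1 : nrm2 v <= 1.

Let Eu2N : (\int[P]_w (lin v (X w) ^+ 2 * nrm2 (X w))%:E <= (kappa * d%:R)%:E)%E.
Proof.
have u40 w : 0 <= d%:R * lin v (X w) ^+ 4 by rewrite mulr_ge0// exprn_even_ge0.
have s40 w : 0 <= \sum_j X w j ^+ 4 by apply: sumr_ge0 => j _; rewrite exprn_even_ge0.
apply: (@le_trans _ _ (\int[P]_w
   (2^-1 * (d%:R * lin v (X w) ^+ 4 + \sum_j X w j ^+ 4))%:E)%E).
  apply: ge0_Eint_le; [by meas|by meas| |].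
    by move=> w; rewrite mulr_ge0 ?sqr_ge0 ?nrm2_ge0.
  by move=> w; exact: lin_sq_nrm2_le.
rewrite ge0_Eint_Zl//; [|by meas|by move=> w; rewrite addr_ge0].
rewrite ge0_Eint_D//; [|by meas|by meas].
rewrite ge0_Eint_Zl//; [|by meas|by move=> w; rewrite exprn_even_ge0].
apply: (@le_trans _ _ (2^-1%:E * (d%:R%:E * kappa%:E + (d%:R * kappa)%:E))%E).
  apply: lee_wpmul2l => //; apply: leeD => //; apply: lee_wpmul2l => //.
  exact: x4.
rewrite -!EFinM -?EFinD -?EFinM lee_fin; apply: le_of_eq.
by field.
Qed.

(** The second moments and the kurtosis control the expectation of each monomial on
   the right, the mixed ones through [a b <= (a^2 + b^2) / 2] coordinate by
   coordinate. *)
Lemma integrated_bound (F : T -> R) (a c1 c2 c3 c4 c5 : R) (I : R) :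
  measurable_fun setT F -> (forall w, 0 <= F w) ->
  (\int[P]_w (F w)%:E = I%:E)%E ->
  (\int[P]_w (lin v (X w) ^+ 2)%:E = 1)%E ->
  0 <= a -> 0 <= c1 -> 0 <= c2 -> 0 <= c3 -> 0 <= c4 -> 0 <= c5 ->
  (forall w, F w + a * lin v (X w) ^+ 2 <= c1
     + c2 * (lin v (X w) ^+ 2 * nrm2 (X w)) + c3 * lin v (X w) ^+ 4
     + c4 * nrm2 (X w) ^+ 2 + c5 * nrm2 (X w)) ->
  I + a <= c1 + c2 * (kappa * d%:R) + c3 * kappa + c4 * (kappa * d%:R ^+ 2)
    + c5 * d%:R.
Proof.
move=> mF F0 IE Eu a0 c10 c20 c30 c40 c50 H.
have u20 w := sqr_ge0 (lin v (X w)).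
have u40 w : 0 <= lin v (X w) ^+ 4 by rewrite exprn_even_ge0.
have N0 w := nrm2_ge0 (X w).
have N20 w := sqr_ge0 (nrm2 (X w)).
have uN0 w : 0 <= lin v (X w) ^+ 2 * nrm2 (X w) by rewrite mulr_ge0.
have t2 w := mulr_ge0 c20 (uN0 w).
have t3 w := mulr_ge0 c30 (u40 w).
have t4 w := mulr_ge0 c40 (N20 w).
have t5 w := mulr_ge0 c50 (N0 w).
rewrite -lee_fin.
have -> : ((I + a)%:E = \int[P]_w (F w + a * lin v (X w) ^+ 2)%:E)%E.
  rewrite ge0_Eint_D//; [|by meas|by move=> w; rewrite mulr_ge0].
  by rewrite ge0_Eint_Zl// ?IE ?Eu ?mule1//; meas.
apply: (@le_trans _ _ (\int[P]_w (c1
     + c2 * (lin v (X w) ^+ 2 * nrm2 (X w)) + c3 * lin v (X w) ^+ 4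
     + c4 * nrm2 (X w) ^+ 2 + c5 * nrm2 (X w))%:E)%E).
  apply: ge0_Eint_le => //; [by meas|by meas|].
  by move=> w; rewrite addr_ge0// mulr_ge0.
rewrite ge0_Eint_D//; [|by meas|by meas|by move=> w; rewrite !addr_ge0].
rewrite ge0_Eint_D//; [|by meas|by meas|by move=> w; rewrite !addr_ge0].
rewrite ge0_Eint_D//; [|by meas|by meas|by move=> w; rewrite !addr_ge0].
rewrite ge0_Eint_D//; [|by meas].
rewrite Eint_cst !EFinD.
rewrite ge0_Eint_Zl//; last by meas.
rewrite ge0_Eint_Zl//; last by meas.
rewrite ge0_Eint_Zl//; last by meas.
rewrite ge0_Eint_Zl//.
repeat apply: leeD => //; rewrite EFinM; apply: lee_wpmul2l => //.
exact: x4.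
Qed.

End Direction.

Context {n : nat}.
Variable Z : 'I_n -> T -> U.
Hypothesis mZ : forall i, measurable_fun setT (Z i).
Hypothesis indep : mutually_independent P Z.
Hypothesis law : forall i, same_law P (Z i) Z0.
Hypothesis d0 : (0 < d)%N.
Hypothesis n0 : (0 < n)%N.
Hypothesis kappa1 : 1 <= kappa.

Lemma measurable_latdot (I : finType) (c : I -> R) (m : nat) (k : lattice I m)
    d' (T' : measurableType d') (y : T' -> 'I_m -> R) :
  (forall j, measurable_fun setT (fun t => y t j)) ->
  measurable_fun setT (fun t => latdot c k (y t)).
Proof.
elim: m k y => [|m IH] k y my /=; first exact: measurable_cst.
apply: measurable_funD; first by apply: measurable_funM => //; exact: my.
by apply: (IH k.2 (fun t j => y t (lift ord0 j))) => j; exact: my.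
Qed.

Lemma measurable_latexp (I : finType) (c : I -> R) (s h B : R) (k : lattice I d)
    d' (T' : measurableType d') (y : T' -> 'I_d -> R) :
  (forall j, measurable_fun setT (fun t => y t j)) ->
  measurable_fun setT (fun t => latexp c s h B k (y t)).
Proof.
move=> my; have my2 : measurable_fun setT (fun t => nrm2 (y t)) by rewrite /nrm2; meas.
rewrite /latexp; apply: (measurableT_comp (@measurable_expR _)).
apply: measurable_funM => //; apply: measurable_funB => //.
rewrite /latq; apply: measurable_fun_ifT.
- exact: measurable_fun_ler.
- apply: measurable_funB; last by meas.
  by apply: measurable_funX; apply: measurable_funM => //; exact: measurable_latdot.
- exact: measurable_cst.
Qed.

Lemma latexp_le (I : finType) (c : I -> R) (s h B : R) (k : lattice I d) y :
  0 <= s -> 0 <= B -> latexp c s h B k y <= expR (s * (1 + h ^+ 2 / 4 * B)).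
Proof.
move=> s0 B0; have w0 : 0 <= h ^+ 2 / 4 by rewrite divr_ge0 ?sqr_ge0.
rewrite /latexp ler_expR ler_wpM2l// lerD2l lerNl /latq.
case: ifP => NB; last by rewrite oppr_le0 mulr_ge0.
apply: (@le_trans _ _ (- (h ^+ 2 / 4 * nrm2 y))); last by rewrite lerDr sqr_ge0.
by rewrite lerN2 ler_wpM2l.
Qed.

Lemma Eint_gt0 (f : T -> R) : measurable_fun setT f -> (forall w, 0 < f w) ->
  (0 < \int[P]_w (f w)%:E)%E.
Proof.
move=> mf f0; rewrite lt0e; apply/andP; split; last first.
  by apply: integral_ge0 => w _; rewrite lee_fin ltW.
apply/eqP => I0.
have mfE : measurable_fun setT (EFin \o f) by exact/measurable_EFinP.
have : (\int[P]_w `|(EFin \o f) w| = 0)%E.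
  by rewrite -[RHS]I0; apply: eq_integral => w _ /=; rewrite gtr0_norm.
move/(ae_eq_integral_abs P measurableT mfE) => [N [measN PN HN]].
have NT : N = setT.
  apply/seteqP; split=> // w _; apply: HN => /= /(_ I) []; apply/eqP.
  by rewrite gt_eqF.
have := probability_setT P; rewrite -NT => P1.
by move: PN; rewrite [LHS]P1 => /eqP; rewrite onee_eq0.
Qed.

(** The statistic is the mixture of likelihood ratios on a grid of mesh [h] large
   enough to round every unit vector. The quadratic term of the exponential
   costs the variance of [lin v x ^+ 2], at most [kappa - 1]. *)
Lemma gram_lower_bound (s : R) : 0 < s <= 1 ->
  exists m : ('I_n -> 'I_d -> R) -> R,
  [/\ forall xs, 0 < m xs,
      forall d' (T' : measurableType d') (y : T' -> 'I_n -> 'I_d -> R),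
        (forall i j, measurable_fun setT (fun t => y t i j)) ->
        measurable_fun setT (fun t => m (y t)),
      (\int[P]_w (m (fun i => x (Z i w)))%:E <= 1)%E &
      forall v : 'I_d -> R, nrm2 v = 1 ->
        (\int[P]_w (lin v (x (Z0 w)) ^+ 2)%:E = 1)%E ->
        forall xs, s * \sum_i (1 - lin v (xs i) ^+ 2) <= ln (m xs)
          + n%:R * (kappa - 1) * (s ^+ 2 / 2 + 3 / 10 * s ^+ 3)
          + 585 / 100 * (n%:R * s * Num.sqrt (kappa * d%:R / n%:R))
          + 149 / 100 * d%:R].
Proof.
move=> s01; have /andP[s0 s1] := s01.
have dR : 0 < d%:R :> R by rewrite ltr0n.
have nR : 0 < n%:R :> R by rewrite ltr0n.
have k0 : 0 < kappa by apply: lt_le_trans kappa1.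
have r0 : 0 < kappa * d%:R / n%:R by rewrite divr_gt0// mulr_gt0.
set D := Num.sqrt _.
have D0 : 0 < D by rewrite sqrtr_gt0.
have D2 : D ^+ 2 = kappa * d%:R / n%:R by rewrite sqr_sqrtr// ltW.
pose B := n%:R * D.
have B0 : 0 < B by rewrite mulr_gt0.
have DB : D * B = kappa * d%:R.
  by rewrite /B mulrCA -expr2 D2 mulrC divfK ?gt_eqF.
pose w := (4 * s * B)^-1.
have w0 : 0 < w by rewrite invr_gt0 !mulr_gt0.
pose h := 2 * Num.sqrt w.
have h0 : 0 < h by rewrite mulr_gt0// sqrtr_gt0.
have hw : h ^+ 2 / 4 = w by rewrite /h exprMn sqr_sqrtr ?(ltW w0)//; field.
have swB : s * (h ^+ 2 / 4) * B <= 1 / 4.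
  rewrite hw /w; apply: le_of_eq.
  by field; rewrite !gt_eqF.
(* The coordinates of [v / h] are at most [h^-1], and rounding needs a margin of 2. *)
pose K := (Num.truncn (h^-1 + 2)).+1.
have KP : h^-1 + 2 <= K%:R by rewrite ltW// truncnS_gt.
pose I : finType := 'I_(K.*2.+1).
pose c : I -> R := @gridpt R K.
pose e := latexp c s h B : lattice I d -> ('I_d -> R) -> R.
have me k i : measurable_fun setT (fun t => e k (x (Z i t))).
  by apply: measurable_latexp => j; exact: measurableT_comp (mx j) (mZ i).
have meU k : measurable_fun setT (fun u => e k (x u)).
  by apply: measurable_latexp => j; exact: mx.
have me0 k : measurable_fun setT (fun t => e k (x (Z0 t))).
  exact: measurableT_comp (meU k) mZ0.
have e0 k y : 0 < e k y by exact: latexp_gt0.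
have e0' k y : 0 <= e k y by exact: ltW.
have efin k : (\int[P]_t (e k (x (Z0 t)))%:E)%E \is a fin_num.
  rewrite ge0_fin_numE; last by apply: integral_ge0 => t _; rewrite lee_fin.
  apply: (@le_lt_trans _ _ (\int[P]__ (expR (s * (1 + h ^+ 2 / 4 * B)))%:E)%E).
    by apply: ge0_Eint_le => // t; apply: latexp_le; exact: ltW.
  by rewrite Eint_cst ltry.
pose L k := fine (\int[P]_t (e k (x (Z0 t)))%:E)%E.
have LE k : (L k)%:E = (\int[P]_t (e k (x (Z0 t)))%:E)%E by rewrite /L fineK.
have L0 k : 0 < L k by rewrite -lte_fin LE; exact: Eint_gt0.
have LZ k i : (\int[P]_t (e k (x (Z i t)))%:E)%E = (L k)%:E.
  rewrite LE; apply: (ge0_same_law_integral (f := fun u => e k (x u))) => //.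
exists (pacmix c s h B L); split.
- by move=> xs; apply: pacmix_gt0 => //; elim: (d) => [|d' IH] /=; [exact: tt|exact: (ord0, IH)].
- move=> d' T' y my; rewrite /pacmix; apply: measurable_sum => k.
  apply: measurable_funM => //; apply: measurable_prod => i _.
  by apply: measurable_funM => //; apply: measurable_latexp => j.
- rewrite /pacmix ge0_Eint_sum; last 2 first.
  + move=> k; apply: measurable_funM => //; apply: measurable_prod => i _.
    by apply: measurable_funM => //; exact: me.
  + move=> k t; rewrite mulr_ge0 ?expR_ge0// prodr_ge0// => i _.
    by rewrite divr_ge0// ltW.
  apply: (@le_trans _ _ (\sum_(k : lattice I d) (latprior c k)%:E)%E); last first.
    rewrite sumEFin lee_fin; apply: sum_latprior; exact: sum_gridpt_prior.
  apply: lee_sum => k _; rewrite ge0_Eint_Zl ?expR_ge0//; last 2 first.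
  + by apply: measurable_prod => i _; apply: measurable_funM => //; exact: me.
  + by move=> t; apply: prodr_ge0 => i _; rewrite divr_ge0// ltW.
  rewrite (@ge0_integral_prod_indep _ _ _ _ _ P n Z (fun _ u => e k (x u) / L k))//.
  + rewrite (eq_bigr (fun=> 1%E)); first by rewrite big1_eq mule1.
    move=> i _; under eq_integral do rewrite mulrC.
    rewrite ge0_Eint_Zl ?invr_ge0 ?(ltW (L0 k))//.
    by rewrite LZ -EFinM mulVf// gt_eqF.
  + by move=> i; apply: measurable_funM.
  + by move=> i u; rewrite divr_ge0// ltW.
  + move=> i; under eq_integral do rewrite mulrC.
    rewrite ge0_Eint_Zl ?invr_ge0 ?(ltW (L0 k))//.
    by rewrite LZ -EFinM ltry.
move=> v v1 Eu xs.
have vj j : `|v j| <= 1.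
  rewrite -(@expr_le1 _ 2)// -normrX ger0_norm ?sqr_ge0//.
  rewrite -v1 /nrm2 (bigD1 j)//= lerDl sumr_ge0// => i _; exact: sqr_ge0.
have /choice[b rb] : forall j, exists b, rounding c (v j / h) b.
  move=> j; apply: spline_rounding; apply: le_trans KP; rewrite lerD2r.
  by rewrite normrM [X in _ * X]gtr0_norm ?invr_gt0// ler_piMl ?invr_ge0 ?(ltW h0).
have wt0 k : 0 <= latwt b k by apply: latwt_ge0 => j; exact: rd_ge0 (rb j).
pose A := s ^+ 2 / 2 + 3 / 10 * s ^+ 3.
have A0 : 0 <= A by rewrite /A addr_ge0// mulr_ge0// ?exprn_ge0// ltW.
have SL : ((\sum_k latwt b k * L k)%:E =
    \int[P]_t (\sum_k latwt b k * e k (x (Z0 t)))%:E)%E.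
  rewrite ge0_Eint_sum; last 2 first.
  + by move=> k; apply: measurable_funM.
  + by move=> k t; rewrite mulr_ge0.
  rewrite -sumEFin; apply: eq_bigr => k _.
  by rewrite EFinM LE ge0_Eint_Zl.
have sA0 : 0 <= s + 2 * A by rewrite addr_ge0 ?mulr_ge0// ltW.
have w2 : 0 <= w ^+ 2 := sqr_ge0 w.
have s2 : 0 <= s ^+ 2 := sqr_ge0 s.
have s3 : 0 <= s ^+ 3 by rewrite exprn_ge0// ltW.
have mF : measurable_fun setT (fun t => \sum_k latwt b k * e k (x (Z0 t))).
  by apply: measurable_sum => k; apply: measurable_funM.
have F0 t : 0 <= \sum_k latwt b k * e k (x (Z0 t)).
  by apply: sumr_ge0 => k _; rewrite mulr_ge0.
have v1' : nrm2 v <= 1 by rewrite v1.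
have := @integrated_bound v v1'
  (fun t => \sum_k latwt b k * e k (x (Z0 t)))
  (s + 2 * A) (1 + s + A) ((s + 2 * A) / B + 8 * w * A) A
  (6 * w ^+ 2 * A + 3 / 20 * s ^+ 2 * w ^+ 2) (3 / 5 * s ^+ 3 * w)
  (\sum_k latwt b k * L k) mF F0 (esym SL) Eu sA0.
have s0' := ltW s0; have w0' := ltW w0; have B0' := ltW B0.
have c1p : 0 <= 1 + s + A by do 2 apply: addr_ge0 => //.
have c2p : 0 <= (s + 2 * A) / B + 8 * w * A.
  by apply: addr_ge0; [exact: divr_ge0|apply: mulr_ge0 => //; exact: mulr_ge0].
have c4p : 0 <= 6 * w ^+ 2 * A + 3 / 20 * s ^+ 2 * w ^+ 2.
  by apply: addr_ge0; (apply: mulr_ge0 => //; exact: mulr_ge0).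
have c5p : 0 <= 3 / 5 * s ^+ 3 * w by apply: mulr_ge0 => //; exact: mulr_ge0.
move=> /(_ c1p c2p A0 c4p c5p) IB.
have {IB}H1 : \sum_k latwt b k * L k + (s + 2 * A) <= 1 + s
    + (s + 2 * A) * (((1 + (kappa - 1)) * d%:R) / B)
    + A * (1 + (1 + (kappa - 1)) + 8 * w * ((1 + (kappa - 1)) * d%:R)
           + 6 * w ^+ 2 * ((1 + (kappa - 1)) * d%:R ^+ 2))
    + 3 / 5 * s ^+ 3 * w * d%:R
    + 3 / 20 * s ^+ 2 * w ^+ 2 * ((1 + (kappa - 1)) * d%:R ^+ 2).
  apply: le_trans (IB _) _; last first.
    by apply: le_of_eq; ring.
  move=> t /=.
  have := latexp_mean_le h0 rb s01 B0 swB (x (Z0 t)).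
  rewrite hw -/A => H; rewrite -lerBrDr; apply: le_trans H _.
  by apply: le_of_eq; ring.
have PB := @pac_bayes R I c d n s h B v b L xs h0 (ltW s0) rb L0.
apply: le_trans PB _.
have kp : 0 <= kappa - 1 by rewrite subr_ge0.
have DB' : D * B = (1 + (kappa - 1)) * d%:R by rewrite DB; ring.
have PC := pac_constants s01 kp (ltW dR) nR D0 B0 (erefl : B = n%:R * D) DB' H1.
have -> : nrm2 v / h ^+ 2 = s * B.
  rewrite v1 -[h ^+ 2](@divfK _ 4) ?hw /w//; field.
  by rewrite !gt_eqF.
by rewrite -!addrA lerD2l; move: PC; rewrite !addrA.
Qed.

End Core.

(** * Real-valued expectations *)

Section RealExpectation.
Context {disp : measure_display} {T : measurableType disp} {R : realType}
  (P : probability T R).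
Implicit Types f g : T -> R.

Definition intg f := P.-integrable setT (EFin \o f).

Lemma intg_meas f : intg f -> measurable_fun setT f.
Proof. by move=> /measurable_int/measurable_EFinP. Qed.

Lemma EFin_Rint f : intg f -> ((\int[P]_w f w)%R)%:E = (\int[P]_w (f w)%:E)%E.
Proof. by move=> fi; rewrite /Rintegral fineK//; exact: integrable_fin_num. Qed.

Lemma ge0_intg f : measurable_fun setT f -> (forall w, 0 <= f w) ->
  (\int[P]_w (f w)%:E < +oo)%E -> intg f.
Proof.
move=> mf f0 foo; apply/integrableP; split; first exact/measurable_EFinP.
by under eq_integral do rewrite /= ger0_norm//.
Qed.

Lemma ge0_Rint_lt f (c : R) : measurable_fun setT f -> (forall w, 0 <= f w) ->
  (\int[P]_w (f w)%:E <= c%:E)%E -> intg f /\ (\int[P]_w f w)%R <= c.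
Proof.
move=> mf f0 fc; have fi : intg f by apply: ge0_intg => //; apply: le_lt_trans (ltry c).
by split=> //; rewrite -lee_fin EFin_Rint.
Qed.

Lemma intg_cst (c : R) : intg (fun=> c).
Proof.
by apply: finite_measure_integrable_cst.
Qed.

Lemma intgZ (c : R) f : intg f -> intg (fun w => c * f w).
Proof. move=> fi; apply: eq_integrable (integrableZl measurableT c fi) => //. Qed.

Lemma intgD f g : intg f -> intg g -> intg (fun w => f w + g w).
Proof. move=> fi gi; apply: eq_integrable (integrableD measurableT fi gi) => //. Qed.

Lemma intgB f g : intg f -> intg g -> intg (fun w => f w - g w).
Proof. move=> fi gi; apply: eq_integrable (integrableB measurableT fi gi) => //. Qed.

Lemma intg_sum (I : finType) (F : I -> T -> R) :
  (forall i, intg (F i)) -> intg (fun w => \sum_i F i w).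
Proof.
move=> Fi; have := @integrable_sum _ _ _ P setT measurableT I (index_enum I) predT
  (fun i => EFin \o F i) (fun i _ => Fi i).
by apply: eq_integrable => // w _; rewrite /= sumEFin.
Qed.

Lemma intg_le f g : measurable_fun setT f -> (forall w, `|f w| <= g w) ->
  intg g -> intg f.
Proof.
move=> mf fg gi; apply: le_integrable gi => //; first exact/measurable_EFinP.
by move=> w _ /=; rewrite lee_fin (le_trans (fg w))// ler_norm.
Qed.

Lemma intg_mul f g : measurable_fun setT f -> measurable_fun setT g ->
  intg (fun w => f w ^+ 2) -> intg (fun w => g w ^+ 2) -> intg (fun w => f w * g w).
Proof.
move=> mf mg f2 g2; apply: (@intg_le _ (fun w => 2^-1 * (f w ^+ 2 + g w ^+ 2))).
- exact: measurable_funM.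
- move=> w; rewrite normrM.
  by have := mean_sq_le `|f w| `|g w|; rewrite !real_normK ?num_real//; lra.
- by apply: intgZ; apply: intgD.
Qed.

Lemma intg_sq f : measurable_fun setT f -> intg (fun w => f w ^+ 2) -> intg f.
Proof.
move=> mf f2; have := @intg_mul f (fun=> 1) mf (measurable_cst _) f2.
have -> : (fun w => f w * 1) = f by apply/funext => w; rewrite mulr1.
by apply; rewrite expr1n; exact: intg_cst.
Qed.

Lemma RintD f g : intg f -> intg g ->
  (\int[P]_w (f w + g w))%R = (\int[P]_w f w)%R + (\int[P]_w g w)%R.
Proof. by move=> fi gi; rewrite RintegralD. Qed.

Lemma RintB f g : intg f -> intg g ->
  (\int[P]_w (f w - g w))%R = (\int[P]_w f w)%R - (\int[P]_w g w)%R.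
Proof. by move=> fi gi; rewrite RintegralB. Qed.

Lemma RintZ (c : R) f : intg f -> (\int[P]_w (c * f w))%R = c * (\int[P]_w f w)%R.
Proof. by move=> fi; rewrite RintegralZl. Qed.

Lemma Rint_sum (I : finType) (F : I -> T -> R) : (forall i, intg (F i)) ->
  (\int[P]_w (\sum_i F i w))%R = \sum_i (\int[P]_w F i w)%R.
Proof.
move=> Fi; apply: EFin_inj; rewrite EFin_Rint; last exact: intg_sum.
under eq_integral do rewrite -sumEFin.
rewrite integral_sum//.
by rewrite -sumEFin; apply: eq_bigr => i _; rewrite EFin_Rint.
Qed.

Lemma Rint_eq f g : f =1 g -> (\int[P]_w f w)%R = (\int[P]_w g w)%R.
Proof. by move=> fg; apply: eq_Rintegral => w _; exact: fg. Qed.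

Lemma Rint_ge0 f : (forall w, 0 <= f w) -> 0 <= (\int[P]_w f w)%R.
Proof. by move=> f0; apply: Rintegral_ge0. Qed.

Lemma Rint_le f g : intg f -> intg g -> (forall w, f w <= g w) ->
  (\int[P]_w f w)%R <= (\int[P]_w g w)%R.
Proof. by move=> fi gi fg; apply: le_Rintegral. Qed.

Lemma Rint_sq_eq0 f : intg (fun w => f w ^+ 2) -> (\int[P]_w f w ^+ 2)%R = 0 ->
  {ae P, forall w, f w = 0}.
Proof.
move=> fi f0; have mf2 := intg_meas fi.
pose g w := f w ^+ 2.
have mfE : measurable_fun setT (EFin \o g) by exact/measurable_EFinP.
have : (\int[P]_w `|(EFin \o g) w| = 0)%E.
  under eq_integral do rewrite /= ger0_norm ?sqr_ge0//.
  by rewrite -EFin_Rint// f0.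
move/(ae_eq_integral_abs P measurableT mfE); apply: filterS => w /= /(_ I) [] /eqP.
by rewrite sqrf_eq0 => /eqP.
Qed.

End RealExpectation.

Section Independence.
Context {disp dU dV : measure_display} {T : measurableType disp}
  {U : measurableType dU} {V : measurableType dV} {R : realType}
  (P : probability T R).
Variables (Z : T -> U) (W : T -> V).
Hypothesis mZ : measurable_fun setT Z.
Hypothesis mW : measurable_fun setT W.
Hypothesis ind : independent2 P Z W.

(** Two extensions from indicators, one for each factor. *)
Lemma ge0_indep_integral (f : U -> R) (g : V -> R) :
  measurable_fun setT f -> measurable_fun setT g ->
  (forall u, 0 <= f u) -> (forall u, 0 <= g u) ->
  intg P (fun w => f (Z w)) -> intg P (fun w => g (W w)) ->
  (\int[P]_w (f (Z w) * g (W w))%:E =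
   (\int[P]_w f (Z w))%:E * (\int[P]_w g (W w))%:E)%E.
Proof.
move=> mf mg f0 g0 fi gi.
have step1 B : measurable B -> (\int[P]_w (\1_B (Z w) * g (W w))%:E =
    (fine (P (Z @^-1` B)))%:E * \int[P]_w (g (W w))%:E)%E.
  move=> mB; have mZB := measurable_preimage mZ mB.
  have PB : (fine (P (Z @^-1` B)))%:E = P (Z @^-1` B).
    by rewrite fineK// fin_num_measure.
  apply: (@ge0_integral_ext _ _ _ _ _ P (fun w => \1_B (Z w)) W W) => //.
  - by apply: measurableT_comp mZ; exact: measurable_indic.
  - by apply: fine_ge0; exact: measure_ge0.
  move=> A mA; rewrite PB -ind// -[X in P X]setIT -integral_indic//; last first.
    by apply: measurableI => //; exact: measurable_preimage mW mA.
  apply: eq_integral => w _; rewrite !indicE in_setI.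
  by rewrite -[w \in Z @^-1` B]/(Z w \in B) -[w \in W @^-1` A]/(W w \in A) -natrM mulnb.
under eq_integral do rewrite mulrC.
rewrite (@ge0_integral_ext _ _ _ _ _ P (fun w => g (W w)) Z Z
  (\int[P]_w g (W w))%R)//.
- by rewrite EFin_Rint// EFin_Rint// muleC.
- exact: measurableT_comp mW.
- exact: Rint_ge0.
move=> B mB; under eq_integral do rewrite mulrC.
rewrite step1// EFin_Rint// muleC fineK// fin_num_measure//.
exact: measurable_preimage mZ mB.
Qed.

Let pos_neg (r : R) : r = Num.max r 0 - Num.max (- r) 0.
Proof. by case: (leP r 0) => r0; [rewrite max_l|rewrite max_r]; lra. Qed.

Let intg_max (f : T -> R) : intg P f -> intg P (fun w => Num.max (f w) 0).
Proof.
move=> fi; apply: (@intg_le _ _ _ _ _ (fun w => `|f w|)).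
- by apply: measurable_maxr => //; exact: intg_meas fi.
- by move=> w; case: (leP (f w) 0) => f0; rewrite ?normr0// ler_norm.
- exact: integrable_norm.
Qed.

Lemma indep_Rint (f : U -> R) (g : V -> R) :
  measurable_fun setT f -> measurable_fun setT g ->
  intg P (fun w => f (Z w)) -> intg P (fun w => g (W w)) ->
  intg P (fun w => f (Z w) * g (W w)) /\
  (\int[P]_w (f (Z w) * g (W w)))%R = (\int[P]_w f (Z w))%R * (\int[P]_w g (W w))%R.
Proof.
move=> mf mg fi gi.
have H0 (a : U -> R) (b : V -> R) : measurable_fun setT a -> measurable_fun setT b ->
    (forall u, 0 <= a u) -> (forall u, 0 <= b u) ->
    intg P (fun w => a (Z w)) -> intg P (fun w => b (W w)) ->
    intg P (fun w => a (Z w) * b (W w)) /\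
    (\int[P]_w (a (Z w) * b (W w)))%R = (\int[P]_w a (Z w))%R * (\int[P]_w b (W w))%R.
  move=> ma mb a0 b0 ai bi; have E := ge0_indep_integral ma mb a0 b0 ai bi.
  have I : intg P (fun w => a (Z w) * b (W w)).
    apply: ge0_intg.
    - by apply: measurable_funM; [exact: measurableT_comp mZ|exact: measurableT_comp mW].
    - by move=> w; rewrite mulr_ge0.
    - by rewrite E -EFinM ltry.
  by split=> //; apply: EFin_inj; rewrite EFin_Rint// E EFinM.
have iN (h : T -> R) : intg P h -> intg P (fun w => - h w).
  move=> hi; have := intgZ (-1) hi.
  by rewrite (_ : (fun w => -1 * h w) = (fun w => - h w))//; apply/funext => w; rewrite mulN1r.
pose fp u := Num.max (f u) 0; pose fn u := Num.max (- f u) 0.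
pose gp u := Num.max (g u) 0; pose gn u := Num.max (- g u) 0.
have mfp : measurable_fun setT fp by exact: measurable_maxr.
have mfn : measurable_fun setT fn by apply: measurable_maxr => //; exact: measurable_funN.
have mgp : measurable_fun setT gp by exact: measurable_maxr.
have mgn : measurable_fun setT gn by apply: measurable_maxr => //; exact: measurable_funN.
have fpi : intg P (fun w => fp (Z w)) by exact: intg_max.
have fni : intg P (fun w => fn (Z w)) by apply: intg_max; exact: iN.
have gpi : intg P (fun w => gp (W w)) by exact: intg_max.
have gni : intg P (fun w => gn (W w)) by apply: intg_max; exact: iN.
have p0 (r : R) : 0 <= Num.max r 0 by rewrite le_max lexx orbT.
have [I1 E1] := H0 fp gp mfp mgp (fun=> p0 _) (fun=> p0 _) fpi gpi.
have [I2 E2] := H0 fp gn mfp mgn (fun=> p0 _) (fun=> p0 _) fpi gni.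
have [I3 E3] := H0 fn gp mfn mgp (fun=> p0 _) (fun=> p0 _) fni gpi.
have [I4 E4] := H0 fn gn mfn mgn (fun=> p0 _) (fun=> p0 _) fni gni.
have Ef : (\int[P]_w f (Z w))%R = (\int[P]_w fp (Z w))%R - (\int[P]_w fn (Z w))%R.
  by rewrite -RintB//; apply: Rint_eq => w; exact: pos_neg.
have Eg : (\int[P]_w g (W w))%R = (\int[P]_w gp (W w))%R - (\int[P]_w gn (W w))%R.
  by rewrite -RintB//; apply: Rint_eq => w; exact: pos_neg.
have EE : (fun w => f (Z w) * g (W w)) = (fun w =>
    (fp (Z w) * gp (W w) - fp (Z w) * gn (W w))
    - (fn (Z w) * gp (W w) - fn (Z w) * gn (W w))).
  apply/funext => w; rewrite {1}(pos_neg (f (Z w))) {1}(pos_neg (g (W w))) /fp /fn /gp /gn.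
  ring.
have IA := intgB I1 I2; have IB := intgB I3 I4.
rewrite EE; split; first exact: intgB.
by rewrite RintB// RintB// RintB// E1 E2 E3 E4 Ef Eg; ring.
Qed.

End Independence.

Section IdenticallyDistributed.
Context {disp dU : measure_display} {T : measurableType disp}
  {U : measurableType dU} {R : realType} (P : probability T R).

Lemma same_law_Rint (Z W : T -> U) (f : U -> R) :
  measurable_fun setT Z -> measurable_fun setT W -> same_law P Z W ->
  measurable_fun setT f -> intg P (fun w => f (W w)) ->
  intg P (fun w => f (Z w)) /\ (\int[P]_w f (Z w))%R = (\int[P]_w f (W w))%R.
Proof.
move=> mZ mW law mf fi.
have mfZ : measurable_fun setT (fun w => f (Z w)) by exact: measurableT_comp mZ.
have mfW : measurable_fun setT (fun w => f (W w)) by exact: measurableT_comp mW.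
have mn : measurable_fun setT (fun u => `|f u|) by exact: measurableT_comp mf.
have fiZ : intg P (fun w => f (Z w)).
  apply/integrableP; split; first exact/measurable_EFinP.
  rewrite /= (ge0_same_law_integral mZ mW law mn)//.
  by have /integrableP[] := fi.
split=> //; have mp : measurable_fun setT (fun u => `|f u| + f u) by exact: measurable_funD.
have p0 u : 0 <= `|f u| + f u by have := ler_norm (- f u); rewrite normrN; lra.
have nW : intg P (fun w => `|f (W w)|) by exact: integrable_norm.
have nZ : intg P (fun w => `|f (Z w)|) by exact: integrable_norm.
have E1 : (\int[P]_w (`|f (Z w)| + f (Z w)))%R = (\int[P]_w (`|f (W w)| + f (W w)))%R.
  by rewrite /Rintegral (ge0_same_law_integral mZ mW law mp).
have E2 : (\int[P]_w (`|f (Z w)|))%R = (\int[P]_w (`|f (W w)|))%R.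
  by rewrite /Rintegral (ge0_same_law_integral mZ mW law mn).
move: E1; rewrite !RintD// E2; lra.
Qed.

Lemma mutually_independent_pair (n : nat) (Z : 'I_n -> T -> U) (i j : 'I_n) :
  mutually_independent P Z -> i != j -> independent2 P (Z i) (Z j).
Proof.
move=> ind ij A B mA mB.
pose C k := if k == i then A else if k == j then B else setT.
have ji : (j == i) = false by rewrite eq_sym (negbTE ij).
have := ind C; rewrite (bigD1 i)//= (bigD1 j)/=; last by rewrite eq_sym.
rewrite big1; last first.
  move=> k /andP[ki kj]; rewrite /C (negbTE ki) (negbTE kj) preimage_setT.
  exact: probability_setT.
rewrite mule1 /C eqxx ji eqxx => H.
rewrite -H; last by move=> k; case: ifP => // _; case: ifP.
congr (P _); apply/seteqP; split=> w /=.
  move=> [Aw Bw] k _ /=; case: eqP => [->//|_]; case: eqP => [->//|_].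
  by [].
move=> Hw; split; first by have := Hw i I; rewrite /= eqxx.
by have := Hw j I; rewrite /= ji eqxx.
Qed.

End IdenticallyDistributed.

(** * Whitening the design *)

Section QuadraticForms.
Context {R : realType} {d : nat}.
Implicit Types (A G S H : 'M[R]_d) (u v : 'cV[R]_d).

Definition qform A v : R := (v^T *m A *m v) ord0 ord0.

Definition inner u v : R := (u^T *m v) ord0 ord0.

Lemma innerE u v : inner u v = \sum_j u j ord0 * v j ord0.
Proof. by rewrite /inner !mxE; apply: eq_bigr => j _; rewrite mxE. Qed.

Lemma sqnormE v : sqnorm v = inner v v.
Proof. by rewrite innerE /sqnorm; apply: eq_bigr => j _; rewrite expr2. Qed.

Lemma sqnorm_ge0 v : 0 <= sqnorm v.
Proof. by apply: sumr_ge0 => j _; exact: sqr_ge0. Qed.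

Lemma sqnorm_eq0 v : sqnorm v = 0 -> v = 0.
Proof.
move=> /eqP; rewrite psumr_eq0; last by move=> j _; exact: sqr_ge0.
move=> /allP v0; apply/matrixP => j k; rewrite ord1 mxE.
by have := v0 j; rewrite mem_index_enum sqrf_eq0 => /(_ isT)/eqP.
Qed.

Lemma innerC u v : inner u v = inner v u.
Proof. by rewrite !innerE; apply: eq_bigr => j _; rewrite mulrC. Qed.

Lemma inner_mxl A u v : inner (A *m u) v = inner u (A^T *m v).
Proof. by rewrite /inner trmx_mul -mulmxA. Qed.

Lemma inner_qform A v : inner v (A *m v) = qform A v.
Proof. by rewrite /inner mulmxA. Qed.

Lemma qformE A v : qform A v =
  \sum_j \sum_k v j ord0 * v k ord0 * A j k.
Proof.
rewrite -inner_qform innerE; apply: eq_bigr => j _; rewrite mxE mulr_sumr.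
by apply: eq_bigr => k _; ring.
Qed.

Lemma innerDl u u' v : inner (u + u') v = inner u v + inner u' v.
Proof. by rewrite /inner linearD mulmxDl mxE. Qed.

Lemma innerBl u u' v : inner (u - u') v = inner u v - inner u' v.
Proof. by rewrite /inner linearB mulmxBl !mxE. Qed.

Lemma innerZl a u v : inner (a *: u) v = a * inner u v.
Proof. by rewrite /inner linearZ -scalemxAl mxE. Qed.

Lemma sqnormZ a v : sqnorm (a *: v) = a ^+ 2 * sqnorm v.
Proof. by rewrite /sqnorm mulr_sumr; apply: eq_bigr => j _; rewrite mxE exprMn. Qed.

(** Cauchy-Schwarz, from the square of [|v|^2 u - <u, v> v]. *)
Lemma inner_sq_le u v : inner u v ^+ 2 <= sqnorm u * sqnorm v.
Proof.
have [v0|v0] := eqVneq (sqnorm v) 0.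
  by rewrite (sqnorm_eq0 v0) /inner mulmx0 mxE expr0n mulr_ge0// sqnorm_ge0.
have vp : 0 < sqnorm v by rewrite lt0r v0 sqnorm_ge0.
have := sqnorm_ge0 (sqnorm v *: u - inner u v *: v).
rewrite [sqnorm (_ - _)]sqnormE innerBl !innerZl ![inner _ (_ - _)]innerC !innerBl !innerZl.
rewrite -!sqnormE [inner v u]innerC => H.
rewrite -subr_ge0 -(pmulr_rge0 _ vp).
by move: H; congr (0 <= _); ring.
Qed.

Lemma projection_contracts A v : A^T = A -> A *m A = A -> qform A v <= sqnorm v.
Proof.
move=> As AA; rewrite -subr_ge0.
have -> : sqnorm v - qform A v = sqnorm (v - A *m v).
  rewrite !sqnormE innerBl ![inner _ (_ - _)]innerC !innerBl.
  rewrite (inner_mxl _ v (A *m v)) As mulmxA AA [inner (A *m v) v]innerC inner_qform.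
  by ring.
exact: sqnorm_ge0.
Qed.

End QuadraticForms.

Section PinvSqrt.
Context {R : realType} {d : nat}.
Variables (G S : 'M[R]_d).
Hypothesis Gsym : G^T = G.
Hypothesis GS : is_pinv_sqrt G S.

(** As [S] is the square root of the pseudo-inverse of [G], this is the
   orthogonal projection onto the range of [G]. *)
Definition range_proj : 'M[R]_d := S *m G *m S.

Lemma sqrt_sym : S^T = S. Proof. by case: GS => -[]. Qed.

Lemma pinv_mul_l : G *m (S *m S) *m G = G. Proof. by case: GS => _ []. Qed.

Lemma range_proj_sym : range_proj^T = range_proj.
Proof. by rewrite /range_proj !trmx_mul sqrt_sym Gsym mulmxA. Qed.

Lemma range_proj_idem : range_proj *m range_proj = range_proj.
Proof.
rewrite /range_proj -[RHS]mulmxA -[in RHS]pinv_mul_l !mulmxA; congr (_ *m _).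
Qed.

(** [S *m G] is the square root of [G], since [S] is that of its pseudo-inverse. *)
Definition gsqrt (D : 'cV[R]_d) : 'cV[R]_d := S *m G *m D.

Lemma range_proj_gsqrt D : range_proj *m gsqrt D = gsqrt D.
Proof.
rewrite /range_proj /gsqrt -!mulmxA; congr (_ *m _).
by rewrite !mulmxA -(mulmxA G) pinv_mul_l.
Qed.

Lemma sqnorm_gsqrt D : sqnorm (gsqrt D) = qform G D.
Proof.
rewrite sqnormE /gsqrt inner_mxl trmx_mul sqrt_sym Gsym mulmxA.
by rewrite -(mulmxA (G *m S)) !mulmxA -(mulmxA G) pinv_mul_l inner_qform.
Qed.

Lemma inner_gsqrt D u : G *m (S *m S) *m u = u ->
  inner (gsqrt D) (S *m u) = inner D u.
Proof.
move=> ur; rewrite /gsqrt inner_mxl trmx_mul sqrt_sym Gsym.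
by rewrite mulmxA -(mulmxA G) ur.
Qed.

Lemma range_proj_whitened (u : 'cV[R]_d) : G *m (S *m S) *m u = u ->
  range_proj *m (S *m u) = S *m u.
Proof.
by move=> ur; rewrite /range_proj; move: ur; rewrite -!mulmxA => ->.
Qed.

End PinvSqrt.

Section Design.
Context {disp : measure_display} {T : measurableType disp} {R : realType}
  (P : probability T R) {d : nat}.
Variable X : {RV P >-> d.-tuple R}.
Hypothesis X2 : forall j, ('E_P[(fun w => tnth (X w) j ^+ 2)%R] < +oo)%E.
Variables (S : 'M[R]_d) (kappa : R).
Let G := gram P X.
Hypothesis GS : is_pinv_sqrt G S.
Hypothesis kurt : kurtosis P X = kappa%:E.
Hypothesis kappa1 : 1 < kappa.

Definition tup (v : 'cV[R]_d) : d.-tuple R := [tuple v j ord0 | j < d].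

Lemma vec_tup v : vec (tup v) = v.
Proof. by apply/matrixP => j k; rewrite mxE tnth_mktuple (ord1 k). Qed.

Lemma dot_inner (u v : d.-tuple R) : dot u v = inner (vec u) (vec v).
Proof. by rewrite innerE; apply: eq_bigr => j _; rewrite !mxE. Qed.

Lemma dotE (u v : d.-tuple R) : dot u v = \sum_j vec u j ord0 * tnth v j.
Proof. by apply: eq_bigr => j _; rewrite mxE. Qed.

Lemma measurable_coord j : measurable_fun setT (fun w => tnth (X w) j).
Proof. exact: measurableT_comp (measurable_tnth j) (measurable_funPT X). Qed.

Lemma measurable_dot (theta : d.-tuple R) :
  measurable_fun setT (fun u : d.-tuple R => dot theta u).
Proof.
rewrite /dot; apply: measurable_sum => j; apply: measurable_funM => //.
exact: measurable_tnth.
Qed.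

Lemma intg_coord2 j : intg P (fun w => tnth (X w) j ^+ 2).
Proof.
apply: ge0_intg; [exact: measurable_funX (measurable_coord j)| |].
- by move=> w; exact: sqr_ge0.
- by have := X2 j; rewrite unlock.
Qed.

Lemma intg_coord_prod i j : intg P (fun w => tnth (X w) i * tnth (X w) j).
Proof.
apply: intg_mul; [exact: measurable_coord|exact: measurable_coord|..];
  exact: intg_coord2.
Qed.

Lemma gramE i j : G i j = (\int[P]_w (tnth (X w) i * tnth (X w) j))%R.
Proof. by rewrite mxE unlock. Qed.

Lemma gram_sym : G^T = G.
Proof.
by apply/matrixP => i j; rewrite mxE !gramE; apply: Rint_eq => w; rewrite mulrC.
Qed.

Lemma dot_sqE (theta u : d.-tuple R) : dot theta u ^+ 2 =
  \sum_j \sum_k vec theta j ord0 * vec theta k ord0 * (tnth u j * tnth u k).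
Proof.
rewrite expr2 dotE mulr_suml; apply: eq_bigr => j _; rewrite mulr_sumr.
by apply: eq_bigr => k _; ring.
Qed.

Lemma second_moment (theta : d.-tuple R) :
  intg P (fun w => dot theta (X w) ^+ 2) /\
  (\int[P]_w (dot theta (X w) ^+ 2))%R = qform G (vec theta).
Proof.
have I j k : intg P (fun w => vec theta j ord0 * vec theta k ord0
   * (tnth (X w) j * tnth (X w) k)) by apply: intgZ; exact: intg_coord_prod.
have E : (fun w => dot theta (X w) ^+ 2) = (fun w => \sum_j \sum_k
   vec theta j ord0 * vec theta k ord0 * (tnth (X w) j * tnth (X w) k)).
  by apply/funext => w; exact: dot_sqE.
have I' j : intg P (fun w => \sum_k vec theta j ord0 * vec theta k ord0
   * (tnth (X w) j * tnth (X w) k)) by apply: intg_sum => k; exact: I.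
rewrite E; split; first by apply: intg_sum => j; exact: I'.
rewrite Rint_sum// qformE; apply: eq_bigr => j _; rewrite Rint_sum//.
by apply: eq_bigr => k _; rewrite RintZ ?gramE//; exact: intg_coord_prod.
Qed.

Definition whiten (u : d.-tuple R) : 'I_d -> R := fun j => (S *m vec u) j ord0.

Lemma measurable_whiten j : measurable_fun setT (fun u => whiten u j).
Proof.
rewrite (_ : (fun u => _) = fun u => \sum_k S j k * tnth u k); last first.
  by apply/funext => u; rewrite /whiten mxE; apply: eq_bigr => k _; rewrite mxE.
by apply: measurable_sum => k; apply: measurable_funM => //; exact: measurable_tnth.
Qed.

Lemma lin_whiten (v : 'cV[R]_d) u : lin (v ^~ ord0) (whiten u) = inner v (S *m vec u).
Proof. by rewrite innerE. Qed.

Lemma lin_whiten_dot (v : 'cV[R]_d) u :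
  lin (v ^~ ord0) (whiten u) = dot (tup (S *m v)) u.
Proof. by rewrite lin_whiten dot_inner vec_tup inner_mxl (sqrt_sym GS). Qed.

Lemma colE (v : 'I_d -> R) : v = (\col_j v j : 'cV[R]_d) ^~ ord0.
Proof. by apply/funext => j; rewrite mxE. Qed.

Lemma nrm2_sqnorm (v : 'cV[R]_d) : nrm2 (v ^~ ord0) = sqnorm v.
Proof. by []. Qed.

Lemma whitened_second_moment (v : 'cV[R]_d) :
  (\int[P]_w (lin (v ^~ ord0) (whiten (X w)) ^+ 2)%:E =
   (qform (range_proj G S) v)%:E)%E.
Proof.
have [I E] := second_moment (tup (S *m v)).
rewrite vec_tup in E.
have -> : qform (range_proj G S) v = qform G (S *m v).
  by rewrite /qform /range_proj trmx_mul (sqrt_sym GS) !mulmxA.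
rewrite -E EFin_Rint//; apply: eq_integral => w _.
by rewrite lin_whiten_dot.
Qed.

Lemma range_proj_le (v : 'cV[R]_d) : qform (range_proj G S) v <= sqnorm v.
Proof.
apply: projection_contracts; first exact: range_proj_sym gram_sym GS.
exact: range_proj_idem GS.
Qed.

(** Whitened directions of norm at most 1 are directions of second moment at
   most 1 of the design, to which the kurtosis applies. *)
Lemma whitened_fourth_moment (v : 'I_d -> R) : nrm2 v <= 1 ->
  (\int[P]_w (lin v (whiten (X w)) ^+ 4)%:E <= kappa%:E)%E.
Proof.
rewrite (colE v) nrm2_sqnorm => v1; set u := \col_j v j.
rewrite -kurt /kurtosis; apply: ereal_sup_ubound => /=.
exists (tup (S *m u)).
  rewrite unlock; have := whitened_second_moment u => E.
  apply: (@le_trans _ _ (qform (range_proj G S) u)%:E); last first.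
    by rewrite lee_fin (le_trans (range_proj_le u)).
  rewrite -E; apply: le_of_eq.
  by apply: eq_integral => w _; rewrite -lin_whiten_dot.
by rewrite unlock; apply: eq_integral => w _; rewrite -lin_whiten_dot.
Qed.

Lemma whitened_coord_second_moment j :
  (\int[P]_w (whiten (X w) j ^+ 2)%:E <= 1)%E.
Proof.
pose e : 'cV[R]_d := \col_k (k == j)%:R.
have eE w : whiten (X w) j = lin (e ^~ ord0) (whiten (X w)).
  rewrite /lin (bigD1 j)//= mxE eqxx mul1r big1 ?addr0// => k /negbTE kj.
  by rewrite mxE kj mul0r.
have e1 : sqnorm e = 1.
  rewrite /sqnorm (bigD1 j)//= mxE eqxx expr1n big1 ?addr0// => k /negbTE kj.
  by rewrite mxE kj expr0n.
under eq_integral do rewrite eE.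
by rewrite whitened_second_moment lee_fin -e1; exact: range_proj_le.
Qed.

(** In dimension 0 the kurtosis is 0. *)
Lemma dim_gt0 : (0 < d)%N.
Proof.
rewrite lt0n; apply/eqP => d0.
have k0 : (kurtosis P X <= 0)%E.
  apply: ge_ereal_sup => _ [theta _ <-]; rewrite unlock.
  rewrite (_ : (fun w => _) = cst 0%E) ?integral0//.
  apply/funext => w; rewrite /dot big1 ?expr0n// => -[j jd]; exfalso.
  by rewrite d0 in jd.
by move: k0; rewrite kurt lee_fin leNgt (lt_trans ltr01).
Qed.

(** Each coordinate of the component of [X] off the range has a second moment
   equal to a diagonal entry of [Q G Q^T], and [Q G = 0]. *)
Lemma design_in_range : {ae P, forall w, G *m (S *m S) *m vec (X w) = vec (X w)}.
Proof.
pose Q := 1%:M - G *m (S *m S).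
have QG : Q *m G = 0.
  by rewrite /Q mulmxBl mul1mx (pinv_mul_l GS) subrr.
have H j : {ae P, forall w, (Q *m vec (X w)) j ord0 = 0}.
  have E w : (Q *m vec (X w)) j ord0 = dot (tup (row j Q)^T) (X w).
    rewrite dotE vec_tup mxE; apply: eq_bigr => k _; rewrite !mxE.
    by [].
  have [I Eq] := second_moment (tup (row j Q)^T).
  have := Rint_sq_eq0 I; rewrite Eq vec_tup /qform trmxK -row_mul QG.
  rewrite row0 mul0mx mxE => /(_ erefl); apply: filterS => w.
  by rewrite E.
have : {ae P, forall w, forall j, (Q *m vec (X w)) j ord0 = 0}.
  exact: filter_forall.
apply: filterS => w Hw; apply/eqP; rewrite eq_sym -subr_eq0.
apply/eqP/matrixP => j k; rewrite ord1 [RHS]mxE -[RHS](Hw j).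
by rewrite /Q mulmxBl mul1mx.
Qed.

End Design.

(** * Excess risk of the empirical risk minimizer *)

(** At [t = c / (g + 1)] the polynomial is [- t^2 (g + 2)], negative unless [c = 0]. *)
Lemma first_order_condition (R : realFieldType) (c g : R) :
  (forall t, 0 <= t ^+ 2 * g - 2 * t * c) -> c = 0.
Proof.
move=> H; apply/eqP/negP => /negP c0.
have g0 : 0 <= g by have := H 1; have := H (-1); lra.
have := H (c / (g + 1)).
have -> : (c / (g + 1)) ^+ 2 * g - 2 * (c / (g + 1)) * c
  = - ((c / (g + 1)) ^+ 2 * (g + 2)) by field; rewrite gt_eqF//; lra.
rewrite oppr_ge0 leNgt mulr_gt0//; last by lra.
by rewrite exprn_even_gt0//= mulf_neq0// invr_neq0// gt_eqF//; lra.
Qed.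

Section Regression.
Context {disp : measure_display} {T : measurableType disp} {R : realType}
  (P : probability T R) {d n : nat}.
Variables (X : {RV P >-> d.-tuple R}) (Y : {RV P >-> R})
  (Xs : 'I_n -> {RV P >-> d.-tuple R}) (Ys : 'I_n -> {RV P >-> R})
  (thetastar : d.-tuple R) (S : 'M[R]_d) (kappa C : R)
  (thetahat : {RV P >-> d.-tuple R}).
Hypothesis LS : least_squares X Y Xs Ys thetastar S kappa C thetahat.

Let X2 := ls_X2 LS.
Let G := gram P X.
Let GS : is_pinv_sqrt G S := ls_sqrt LS.

Definition residual (u : d.-tuple R * R) : R := u.2 - dot thetastar u.1.

Lemma measurable_residual : measurable_fun setT residual.
Proof.
apply: measurable_funB; first exact: measurable_snd.
exact: measurableT_comp (measurable_dot thetastar) measurable_fst.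
Qed.

Let Z0 w := (X w, Y w).
Let Z i w := (Xs i w, Ys i w).

Lemma measurable_pairXY : measurable_fun setT Z0.
Proof. by apply: measurable_fun_pair; exact: measurable_funPT. Qed.

Lemma measurable_sample i : measurable_fun setT (Z i).
Proof. by apply: measurable_fun_pair; exact: measurable_funPT. Qed.

Let xi w := residual (Z0 w).

Lemma intg_residual2 : intg P (fun w => residual (X w, Y w) ^+ 2).
Proof.
have mxi : measurable_fun setT xi := measurableT_comp measurable_residual measurable_pairXY.
apply: (@intg_le _ _ _ _ _ (fun w => 2 * (Y w ^+ 2 + dot thetastar (X w) ^+ 2))).
- by apply: measurable_funX; exact: mxi.
- move=> w; rewrite ger0_norm ?sqr_ge0// /residual /=.
  by have := sqr_ge0 (Y w + dot thetastar (X w)); rewrite sqrrD sqrrB; lra.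
- apply: intgZ; apply: intgD; last exact: (second_moment X2 thetastar).1.
  apply: ge0_intg; first exact: measurable_funX (measurable_funPT Y).
  + by move=> w; exact: sqr_ge0.
  + by have := ls_Y2 LS; rewrite unlock.
Qed.

Lemma intg_residual_coord j : intg P (fun w => residual (X w, Y w) * tnth (X w) j).
Proof.
apply: intg_mul; last exact: intg_coord2.
- exact: measurableT_comp measurable_residual measurable_pairXY.
- exact: measurable_coord.
- exact: intg_residual2.
Qed.

Lemma risk_expansion theta : let D := vec theta - vec thetastar in
  risk P X Y theta = risk P X Y thetastar
    - 2 * (\sum_j D j ord0 * (\int[P]_w (residual (X w, Y w) * tnth (X w) j))%R)
    + qform G D.
Proof.
move=> D; rewrite /risk unlock.
have [I2 E2] := second_moment X2 (tup D); rewrite vec_tup -/G in E2.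
have I1 j := intg_residual_coord j.
have I1' j : intg P (fun w => D j ord0 * (residual (X w, Y w) * tnth (X w) j)).
  exact: intgZ.
have -> : \sum_j D j ord0 * (\int[P]_w (residual (X w, Y w) * tnth (X w) j))%R =
   (\int[P]_w (\sum_j D j ord0 * (residual (X w, Y w) * tnth (X w) j)))%R.
  by rewrite Rint_sum//; apply: eq_bigr => j _; rewrite RintZ.
rewrite -E2 -RintZ; last exact: intg_sum.
rewrite -[fine _]/(\int[P]_w ((Y w - dot theta (X w)) ^+ 2))%R.
rewrite -[X in X - _ + _]/(\int[P]_w (residual (X w, Y w) ^+ 2))%R.
rewrite -RintB; [|exact: intg_residual2|by apply: intgZ; exact: intg_sum].
rewrite -RintD//; last first.
  by apply: intgB; [exact: intg_residual2|apply: intgZ; exact: intg_sum].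
apply: Rint_eq => w.
have E : dot (tup D) (X w) = dot theta (X w) - dot thetastar (X w).
  rewrite !dotE vec_tup -sumrB; apply: eq_bigr => j _.
  by rewrite !mxE mulrBl.
have -> : \sum_j D j ord0 * (residual (X w, Y w) * tnth (X w) j) =
    residual (X w, Y w) * dot (tup D) (X w).
  by rewrite dotE vec_tup mulr_sumr; apply: eq_bigr => j _; ring.
by rewrite E /residual /=; ring.
Qed.

(** The derivative of the risk along the coordinates vanishes at the optimum. *)
Lemma normal_equation j : (\int[P]_w (residual (X w, Y w) * tnth (X w) j))%R = 0.
Proof.
apply: (@first_order_condition _ _ (G j j)) => t.
pose D : 'cV[R]_d := \col_k (t * (k == j)%:R).
have := ls_opt LS (tup (vec thetastar + D)).
have DE : vec thetastar + D - vec thetastar = D by rewrite addrC addKr.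
rewrite (risk_expansion (tup _)) vec_tup DE => H.
have -> : t ^+ 2 * G j j = qform G D.
  rewrite qformE (bigD1 j)//= [X in _ = _ + X]big1 ?addr0; last first.
    move=> i ij; rewrite big1// => k _; rewrite !mxE (negbTE ij).
    by rewrite mulr0 !mul0r.
  rewrite (bigD1 j)//= [X in _ = _ + X]big1 ?addr0; last first.
    by move=> k kj; rewrite !mxE (negbTE kj) mulr0 mulr0 mul0r.
  by rewrite !mxE eqxx !mulr1 expr2.
set I := (\int[P]_w _)%R.
have E : \sum_k D k ord0 * (\int[P]_w (residual (X w, Y w) * tnth (X w) k))%R = t * I.
  rewrite (bigD1 j)//= big1 ?addr0; first by rewrite mxE eqxx mulr1.
  by move=> k kj; rewrite mxE (negbTE kj) mulr0 mul0r.
by move: H; rewrite E; lra.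
Qed.

Lemma risk_quadratic theta :
  risk P X Y theta - risk P X Y thetastar = qform G (vec theta - vec thetastar).
Proof.
rewrite risk_expansion big1; first by ring.
by move=> j _; rewrite normal_equation mulr0.
Qed.

(** The estimation error, in the coordinates where the excess risk is the squared
   Euclidean norm. *)
Definition rooterr (w : T) : 'cV[R]_d :=
  gsqrt G S (vec (thetahat w) - vec thetastar).

Let excess := excess_risk P X Y thetastar thetahat.

Lemma excessE w : excess w = sqnorm (rooterr w).
Proof.
by rewrite /excess /excess_risk risk_quadratic (sqnorm_gsqrt (gram_sym X) GS).
Qed.

Lemma excess_ge0 w : 0 <= excess w.
Proof. by rewrite excessE sqnorm_ge0. Qed.

Lemma measurable_excess : measurable_fun setT excess.
Proof.
have mc j : measurable_fun setT (fun w => vec (thetahat w) j ord0).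
  rewrite (_ : (fun w => _) = fun w => tnth (thetahat w) j).
    exact: measurableT_comp (measurable_tnth j) (measurable_funPT thetahat).
  by apply/funext => w; rewrite mxE.
rewrite (_ : excess = fun w => \sum_j (\sum_k (S *m G) j k *
   (vec (thetahat w) k ord0 - vec thetastar k ord0)) ^+ 2).
  apply: measurable_sum => j; apply: measurable_funX; apply: measurable_sum => k.
  by apply: measurable_funM => //; apply: measurable_funB.
apply/funext => w; rewrite excessE /sqnorm; apply: eq_bigr => j _; congr (_ ^+ 2).
by rewrite mxE; apply: eq_bigr => k _; rewrite !mxE.
Qed.

Lemma empirical_normal_equation w j :
  \sum_i residual (Z i w) * tnth (Xs i w) j =
  \sum_i inner (vec (thetahat w) - vec thetastar) (vec (Xs i w)) * tnth (Xs i w) j.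
Proof.
apply/eqP; rewrite -subr_eq0; apply/eqP.
rewrite -sumrB.
apply: (@first_order_condition _ _ (\sum_i tnth (Xs i w) j ^+ 2)) => t.
pose D : 'cV[R]_d := \col_k (t * (k == j)%:R).
have := ls_erm LS w (tup (vec (thetahat w) + D)); rewrite -subr_ge0 -sumrB.
rewrite !mulr_sumr -sumrB => /le_trans; apply.
apply: le_of_eq; apply: eq_bigr => i _.
have -> : dot (tup (vec (thetahat w) + D)) (Xs i w) =
    dot (thetahat w) (Xs i w) + t * tnth (Xs i w) j.
  rewrite !dotE vec_tup.
  have -> : t * tnth (Xs i w) j = \sum_k D k ord0 * tnth (Xs i w) k.
    rewrite (bigD1 j)//= big1 ?addr0; first by rewrite mxE eqxx mulr1.
    by move=> k kj; rewrite mxE (negbTE kj) mulr0 mul0r.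
  by rewrite -big_split /=; apply: eq_bigr => k _; rewrite !mxE mulrDl.
rewrite innerBl -!dot_inner /residual /=; ring.
Qed.

Definition noisevec (w : T) : 'cV[R]_d := \sum_i residual (Z i w) *: (S *m vec (Xs i w)).

Definition sample_in_range (w : T) : Prop :=
  forall i, G *m (S *m S) *m vec (Xs i w) = vec (Xs i w).

(** The observations have the law of [X], which almost surely lies in the range
   of its Gram matrix. *)
Lemma ae_sample_in_range : {ae P, forall w, sample_in_range w}.
Proof.
apply: filter_forall => i.
pose q (u : d.-tuple R * R) := sqnorm (G *m (S *m S) *m vec u.1 - vec u.1).
have mq : measurable_fun setT q.
  rewrite (_ : q = fun u => \sum_j (\sum_k (G *m (S *m S)) j k * tnth u.1 k - tnth u.1 j) ^+ 2).
    have mt k : measurable_fun setT (fun u : d.-tuple R * R => tnth u.1 k).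
      exact: measurableT_comp (measurable_tnth k) measurable_fst.
    apply: measurable_sum => j; apply: measurable_funX; apply: measurable_funB => //.
    by apply: measurable_sum => k; exact: measurable_funM.
  apply/funext => u; rewrite /q /sqnorm; apply: eq_bigr => j _; rewrite !mxE.
  by congr ((_ - _) ^+ 2); apply: eq_bigr => k _; rewrite !mxE.
have q0 u : 0 <= q u by exact: sqnorm_ge0.
have mqZ : measurable_fun setT (q \o Z i) by exact: measurableT_comp (measurable_sample i).
have mqZ0 : measurable_fun setT (q \o Z0) by exact: measurableT_comp measurable_pairXY.
have E0 : (\int[P]_w (q (Z0 w))%:E = 0)%E.
  rewrite (ae_eq_integral (cst 0%E))//; first by rewrite integral0.
  - exact/measurable_EFinP.
  - have := design_in_range X2 GS; apply: filterS => w Hw _.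
    by rewrite /q /Z0 /= -/G Hw subrr /sqnorm big1// => j _; rewrite mxE expr0n.
have : (\int[P]_w `|(EFin \o (q \o Z i)) w| = 0)%E.
  under eq_integral do rewrite /= ger0_norm ?q0//.
  by rewrite (ge0_same_law_integral (measurable_sample i) measurable_pairXY (ls_law LS i) mq q0) E0.
have mqE : measurable_fun setT (EFin \o (q \o Z i)) by exact/measurable_EFinP.
move/(ae_eq_integral_abs P measurableT mqE); apply: filterS => w /= /(_ I) [].
by move/sqnorm_eq0/eqP; rewrite subr_eq0 => /eqP.
Qed.

(** The normal equations of the empirical risk, whitened: on the range of the
   Gram matrix, [<G^{1/2} D, G^{-1/2} X> = <D, X>]. *)
Lemma rooterr_normal_equation w : sample_in_range w ->
  \sum_i inner (rooterr w) (S *m vec (Xs i w)) *: (S *m vec (Xs i w)) = noisevec w.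
Proof.
move=> rw; rewrite /noisevec.
transitivity (S *m \sum_i inner (vec (thetahat w) - vec thetastar) (vec (Xs i w))
    *: vec (Xs i w)).
  rewrite mulmx_sumr; apply: eq_bigr => i _; rewrite -scalemxAr; congr (_ *: _).
  exact: (inner_gsqrt (gram_sym X) GS _ (rw i)).
transitivity (S *m \sum_i residual (Z i w) *: vec (Xs i w)); last first.
  by rewrite mulmx_sumr; apply: eq_bigr => i _; rewrite scalemxAr.
congr (_ *m _); apply/matrixP => j k; rewrite !summxE ord1.
transitivity (\sum_i inner (vec (thetahat w) - vec thetastar) (vec (Xs i w)) * tnth (Xs i w) j).
  by apply: eq_bigr => i _; rewrite !mxE.
by rewrite -empirical_normal_equation; apply: eq_bigr => i _; rewrite !mxE.
Qed.

Lemma innerZr (a : R) (u v : 'cV[R]_d) : inner u (a *: v) = a * inner u v.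
Proof. by rewrite innerC innerZl innerC. Qed.

Lemma inner_sumr (I : finType) (u : 'cV[R]_d) (v : I -> 'cV[R]_d) :
  inner u (\sum_i v i) = \sum_i inner u (v i).
Proof. by rewrite /inner mulmx_sumr summxE. Qed.

Lemma rooterr_energy w : sample_in_range w ->
  \sum_i inner (rooterr w) (S *m vec (Xs i w)) ^+ 2 = inner (rooterr w) (noisevec w).
Proof.
move=> /rooterr_normal_equation <-; rewrite inner_sumr; apply: eq_bigr => i _.
by rewrite innerZr expr2.
Qed.

(** By Cauchy-Schwarz the energy [<v, W>] is at most [|v| |W|], and it is at least
   [a |v|^2]. *)
Lemma excess_le_noise w (a : R) : 0 < a -> sample_in_range w ->
  a * sqnorm (rooterr w) <= \sum_i inner (rooterr w) (S *m vec (Xs i w)) ^+ 2 ->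
  a ^+ 2 * excess w <= sqnorm (noisevec w).
Proof.
move=> a0 rw; rewrite rooterr_energy// excessE => H.
have e0 := sqnorm_ge0 (rooterr w).
have [->|e1] := eqVneq (sqnorm (rooterr w)) 0; first by rewrite mulr0 sqnorm_ge0.
have ep : 0 < sqnorm (rooterr w) by rewrite lt0r e1.
rewrite -(ler_pM2l ep); apply: le_trans (inner_sq_le _ _).
have -> : sqnorm (rooterr w) * (a ^+ 2 * sqnorm (rooterr w)) =
  (a * sqnorm (rooterr w)) ^+ 2 by ring.
apply: lerXn2r => //; rewrite nnegrE; first by rewrite mulr_ge0// ltW.
by apply: le_trans H; rewrite mulr_ge0// ltW.
Qed.

Lemma noise_level_Rint :
  intg P (fun w => residual (X w, Y w) ^+ 2 * nrm2 (whiten S (X w))) /\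
  (\int[P]_w (residual (X w, Y w) ^+ 2 * nrm2 (whiten S (X w))))%R = C.
Proof.
have E : (\int[P]_w (residual (X w, Y w) ^+ 2 * nrm2 (whiten S (X w)))%:E = C%:E)%E.
  by have := ls_noise LS; rewrite /noise_level unlock.
have mN : measurable_fun setT (fun w => nrm2 (whiten S (X w))).
  apply: measurable_sum => j; apply: measurable_funX.
  exact: measurableT_comp (measurable_whiten S j) (measurable_funPT X).
have mr : measurable_fun setT (fun w => residual (X w, Y w)).
  exact: measurableT_comp measurable_residual measurable_pairXY.
have I : intg P (fun w => residual (X w, Y w) ^+ 2 * nrm2 (whiten S (X w))).
  apply: ge0_intg; last by rewrite E ltry.
  - by apply: measurable_funM => //; exact: measurable_funX.
  - by move=> w; rewrite mulr_ge0 ?sqr_ge0 ?nrm2_ge0.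
by split=> //; apply: EFin_inj; rewrite EFin_Rint.
Qed.

Lemma C_ge0 : 0 <= C.
Proof.
have [_ <-] := noise_level_Rint; apply: Rint_ge0 => w.
by rewrite mulr_ge0 ?sqr_ge0 ?nrm2_ge0.
Qed.

Let a (j : 'I_d) (u : d.-tuple R * R) := residual u * whiten S u.1 j.

Let ma j : measurable_fun setT (a j).
Proof.
apply: measurable_funM; first exact: measurable_residual.
exact: measurableT_comp (measurable_whiten S j) measurable_fst.
Qed.

Let maZ0 j : measurable_fun setT (fun w => a j (Z0 w)).
Proof. exact: measurableT_comp measurable_pairXY. Qed.

Let a2 j : intg P (fun w => a j (Z0 w) ^+ 2).
Proof.
have [I _] := noise_level_Rint; apply: intg_le I.
  exact: measurable_funX.
move=> w; rewrite ger0_norm ?sqr_ge0// /a exprMn ler_wpM2l ?sqr_ge0//.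
by rewrite /nrm2 (bigD1 j)//= lerDl sumr_ge0// => k _; exact: sqr_ge0.
Qed.

Let a1 j : (\int[P]_w a j (Z0 w))%R = 0.
Proof.
rewrite (@Rint_eq _ _ _ P _ (fun w => \sum_k S j k * (residual (X w, Y w) * tnth (X w) k))).
  rewrite Rint_sum; last by move=> k; apply: intgZ; exact: intg_residual_coord.
  by rewrite big1// => k _; rewrite RintZ ?normal_equation ?mulr0//; exact: intg_residual_coord.
move=> w; rewrite /a /whiten mxE mulr_sumr; apply: eq_bigr => k _.
by rewrite mxE /Z0 /=; ring.
Qed.

Let ind_pair i k : i != k -> independent2 P (Z i) (Z k).
Proof. by move=> ik; apply: mutually_independent_pair ik; exact: ls_indep LS. Qed.

Let sZ0 i (f : d.-tuple R * R -> R) : measurable_fun setT f -> intg P (fun w => f (Z0 w)) ->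
  intg P (fun w => f (Z i w)) /\ (\int[P]_w f (Z i w))%R = (\int[P]_w f (Z0 w))%R.
Proof.
by move=> mf fi; apply: same_law_Rint => //; [exact: measurable_sample
  |exact: measurable_pairXY|exact: ls_law LS i].
Qed.

(** The summands are independent, and centred by the normal equation: only the
   diagonal terms remain. *)
Lemma noisevec_second_moment :
  intg P (fun w => sqnorm (noisevec w)) /\
  (\int[P]_w sqnorm (noisevec w))%R = n%:R * C.
Proof.
have E w : sqnorm (noisevec w) = \sum_j \sum_i \sum_k a j (Z i w) * a j (Z k w).
  rewrite /sqnorm; apply: eq_bigr => j _.
  have -> : noisevec w j ord0 = \sum_i a j (Z i w).
    by rewrite /noisevec summxE; apply: eq_bigr => i _; rewrite [LHS]mxE.
  by rewrite expr2 mulr_suml; apply: eq_bigr => i _; rewrite mulr_sumr.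
have m2 j : measurable_fun setT (fun u => a j u ^+ 2) by exact: measurable_funX.
have aI j : intg P (fun w => a j (Z0 w)) by apply: intg_sq.
have H i k j : intg P (fun w => a j (Z i w) * a j (Z k w)) /\
    (\int[P]_w (a j (Z i w) * a j (Z k w)))%R =
    (i == k)%:R * (\int[P]_w a j (Z0 w) ^+ 2)%R.
  have [<-|ik] := eqVneq i k.
    have [I1 E1] := sZ0 i (m2 j) (a2 j); rewrite mul1r -E1.
    by rewrite (_ : (fun w => _) = fun w => a j (Z i w) ^+ 2).
  have [I1 E1] := sZ0 i (ma j) (aI j); have [I2 E2] := sZ0 k (ma j) (aI j).
  have [I3 E3] := indep_Rint (measurable_sample i) (measurable_sample k)
    (ind_pair ik) (ma j) (ma j) I1 I2.
  by split=> //; rewrite E3 E1 a1 !mul0r.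
have I1 j i : intg P (fun w => \sum_k a j (Z i w) * a j (Z k w)).
  by apply: intg_sum => k; have [] := H i k j.
have I2 j : intg P (fun w => \sum_i \sum_k a j (Z i w) * a j (Z k w)).
  by apply: intg_sum => i; exact: I1.
have -> : (fun w => sqnorm (noisevec w)) =
    (fun w => \sum_j \sum_i \sum_k a j (Z i w) * a j (Z k w)) by exact/funext.
split; first by apply: intg_sum => j; exact: I2.
rewrite Rint_sum//.
have [I0 <-] := noise_level_Rint.
rewrite -RintZ//.
rewrite (@Rint_eq _ _ _ P _ (fun w => \sum_j n%:R * a j (Z0 w) ^+ 2)); last first.
  move=> w; rewrite /nrm2 !mulr_sumr; apply: eq_bigr => j _.
  by rewrite /a exprMn.
rewrite Rint_sum; last by move=> j; apply: intgZ; exact: a2.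
apply: eq_bigr => j _; rewrite RintZ//.
rewrite Rint_sum//.
rewrite (eq_bigr (fun=> (\int[P]_w a j (Z0 w) ^+ 2)%R)).
  by rewrite sumr_const card_ord mulr_natl.
move=> i _; rewrite Rint_sum; last by move=> k; have [] := H i k j.
rewrite (bigD1 i)//= big1 ?addr0; first by have [_ ->] := H i i j; rewrite eqxx mul1r.
by move=> k ki; have [_ ->] := H i k j; rewrite eq_sym (negbTE ki) mul0r.
Qed.

End Regression.

(** * Numerical constants *)

Section ConfidenceConstants.
Context {R : realType}.

(** Here [s = lam] and [g = s^2 / 3]: completing the square in [m1] leaves a
   quadratic polynomial in [mu], nonnegative up to [483 / 1000]. *)
Let case_small (s m1 m2 k D mu g : R) :
  0 < s <= 1 -> 0 <= m1 -> 0 <= m2 -> mu = m1 + m2 -> mu <= 483 / 1000 ->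
  g = s ^+ 2 / 3 -> k * s = m1 -> 962 / 100 * D <= m2 ->
  k * s + 3 / 10 * (k * s ^+ 2) + 65 / 10 * D <=
  1 - (1 - g) * (1 - 2 * mu) / (1 - mu).
Proof.
move=> /andP[s0 s1] m10 m20 muE mu1 gE km Dm.
have mup : 0 < 1 - mu by lra.
rewrite -subr_ge0 -(pmulr_rge0 _ mup).
have -> : (1 - mu) * (1 - (1 - g) * (1 - 2 * mu) / (1 - mu)
    - (k * s + 3 / 10 * (k * s ^+ 2) + 65 / 10 * D)) =
  mu + g * (1 - 2 * mu) - (1 - mu) * (k * s + 3 / 10 * (k * s) * s + 65 / 10 * D).
  by field; rewrite gt_eqF.
rewrite km.
have h1 : (1 - mu) * (65 / 10 * D) <= (1 - mu) * (68 / 100 * m2).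
  by rewrite ler_pM2l//; lra.
have h2 := sqr_ge0 (m1 - 3 / 20 * s * (1 - mu)).
have h3 : 0 <= s ^+ 2 * ((1 - 2 * mu) / 3 - 9 / 400 * (1 - mu) ^+ 2).
  by apply: mulr_ge0; [exact: sqr_ge0|nra].
have h4 : m1 ^+ 2 <= mu * m1 by rewrite expr2 muE mulrDl lerDl mulr_ge0.
have h5 : 0 <= mu * m2 by rewrite muE mulr_ge0// addr_ge0.
move: h1 h2 h3; rewrite gE.
have -> : (m1 - 3 / 20 * s * (1 - mu)) ^+ 2 =
  m1 ^+ 2 - 3 / 10 * m1 * s * (1 - mu) + 9 / 400 * (s ^+ 2 * (1 - mu) ^+ 2) by field.
have -> : s ^+ 2 * ((1 - 2 * mu) / 3 - 9 / 400 * (1 - mu) ^+ 2) =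
  s ^+ 2 / 3 * (1 - 2 * mu) - 9 / 400 * (s ^+ 2 * (1 - mu) ^+ 2) by field.
have -> : (1 - mu) * (m1 + 3 / 10 * m1 * s + 65 / 10 * D) =
  m1 - mu * m1 + 3 / 10 * m1 * s * (1 - mu) + (1 - mu) * (65 / 10 * D) by ring.
have -> : (1 - mu) * (68 / 100 * m2) = 68 / 100 * m2 - 68 / 100 * (mu * m2) by ring.
lra.
Qed.

(** Here the temperature is capped at 1, and [t = lam] lies between 1 and 2. As
   [g = t^2 / 3] lies between 1/3 and 4/3, [`|1 - g|] is at most 2/3. *)
Let case_large (t m1 m2 k D mu g : R) :
  1 <= t <= 2 -> 0 <= m1 -> 0 <= m2 -> mu = m1 + m2 ->
  5 * m1 + 829 / 200 * m2 <= 2 - t ->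
  g = t ^+ 2 / 3 -> k * t = m1 -> 962 / 100 * D <= m2 ->
  8 / 10 * k + k * t ^+ 2 / 2 + 59 / 10 * D <=
  1 - `|1 - g| * (1 - 2 * mu) / (1 - mu).
Proof.
move=> /andP[t1 t2] m10 m20 muE c gE km Dm.
have mu1 : mu <= 1 / 4 by lra.
have mup : 0 < 1 - mu by lra.
have kt : 8 / 10 * k + k * t ^+ 2 / 2 <= 14 / 10 * m1.
  have tp : 0 < t by lra.
  have -> : k = m1 / t by rewrite -km mulfK// gt_eqF.
  have -> : 8 / 10 * (m1 / t) + m1 / t * t ^+ 2 / 2 = m1 * (8 / 10 / t + t / 2).
    by field; rewrite gt_eqF.
  rewrite mulrC; apply: ler_wpM2r => //.
  rewrite -(ler_pM2l tp).
  have -> : t * (8 / 10 / t + t / 2) = 8 / 10 + t ^+ 2 / 2 by field; rewrite gt_eqF.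
  by nra.
have [g1|g1] := leP g 1.
  rewrite ger0_norm ?subr_ge0// -subr_ge0 -(pmulr_rge0 _ mup).
  have -> : (1 - mu) * (1 - (1 - g) * (1 - 2 * mu) / (1 - mu)
      - (8 / 10 * k + k * t ^+ 2 / 2 + 59 / 10 * D)) =
    mu + g * (1 - 2 * mu) - (1 - mu) * (8 / 10 * k + k * t ^+ 2 / 2 + 59 / 10 * D).
    by field; rewrite gt_eqF.
  have g3 : 1 / 3 <= g by rewrite gE; nra.
  have h1 : 1 / 3 * (1 - 2 * mu) <= g * (1 - 2 * mu) by rewrite ler_wpM2r//; lra.
  have h2 : (1 - mu) * (8 / 10 * k + k * t ^+ 2 / 2 + 59 / 10 * D) <=
      (1 - mu) * (14 / 10 * m1 + 62 / 100 * m2).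
    by rewrite ler_pM2l//; lra.
  have h3 : (1 - mu) * (14 / 10 * m1 + 62 / 100 * m2) <= 14 / 10 * m1 + 62 / 100 * m2.
    by rewrite ler_piMl//; lra.
  lra.
have g3 : `|1 - g| <= 1 / 3 by rewrite ltr0_norm ?subr_lt0// gE; nra.
have h1 : `|1 - g| * (1 - 2 * mu) / (1 - mu) <= 1 / 3.
  rewrite ler_pdivrMr//.
  apply: (@le_trans _ _ (1 / 3 * (1 - 2 * mu))); first by rewrite ler_wpM2r//; lra.
  by lra.
lra.
Qed.

Lemma sqrtr_eq (a b : R) : 0 <= b -> b ^+ 2 = a -> Num.sqrt a = b.
Proof. by move=> b0 <-; rewrite sqrtr_sqr ger0_norm. Qed.

(** All the numerical constants meet here: beyond [n_eps] the PAC-Bayes bound,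
   for a suitable inverse temperature, implies the announced spectral bound.
   The inverse temperature is [lam], the one that balances the variance against the
   confidence level, capped at 1. *)
Lemma confidence_constants (kappa eps : R) (d n : nat) :
  1 < kappa -> (0 < d)%N -> (0 < n)%N -> 0 < eps < 1 ->
  neps kappa d eps <= n%:R ->
  0 <= mu_ kappa d n eps <= 483 / 1000 /\
  exists2 s : R, 0 < s <= 1 &
    ln eps^-1 + n%:R * (kappa - 1) * (s ^+ 2 / 2 + 3 / 10 * s ^+ 3)
      + 585 / 100 * (n%:R * s * Num.sqrt (kappa * d%:R / n%:R)) + 149 / 100 * d%:R
    <= s * n%:R * (1 - `|1 - gammam kappa d n eps| / (1 + deltahat kappa d n eps)).
Proof.
move=> k1 d0 n0 /andP[e0 e1] ne.
have dR : 1 <= d%:R :> R by rewrite ler1n.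
have nR : 0 < n%:R :> R by rewrite ltr0n.
set k := kappa - 1; have k0 : 0 < k by rewrite subr_gt0.
have l0 : 0 <= ln eps^-1 by apply: ln_ge0; rewrite -invr1 lef_pV2 ?posrE// ltW.
set l := ln eps^-1 in l0 *.
pose L : R := conf d eps.
have LE : L = l + 73 / 100 * d%:R by [].
have Lp : 0 < L by rewrite LE; clear -l0 dR; lra.
pose rn : R := Num.sqrt (n%:R : R).
have rn0 : 0 < rn by rewrite sqrtr_gt0.
have rn2 : rn ^+ 2 = n%:R by rewrite sqr_sqrtr// ltW.
pose D : R := Num.sqrt (kappa * d%:R / n%:R).
have kd0 : 0 < kappa * d%:R by apply: mulr_gt0; [clear -k1|clear -dR]; lra.
have D0 : 0 < D by rewrite sqrtr_gt0 divr_gt0.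
have D2 : D ^+ 2 = kappa * d%:R / n%:R by rewrite sqr_sqrtr// divr_ge0// ltW.
pose lam : R := Num.sqrt (2 * L / (k * n%:R)).
have lam0 : 0 < lam by rewrite sqrtr_gt0 divr_gt0// mulr_gt0.
have lam2 : lam ^+ 2 = 2 * L / (k * n%:R).
  by rewrite sqr_sqrtr// divr_ge0// ltW// mulr_gt0.
have L_lam : L = k * n%:R * lam ^+ 2 / 2 by rewrite lam2; field; rewrite !gt_eqF.
pose m1 : R := k * lam.
have m10 : 0 < m1 by rewrite mulr_gt0.
have m1E : Num.sqrt (2 * (kappa - 1) / n%:R * L) = m1.
  apply: sqrtr_eq; first exact: ltW.
  by rewrite /m1 exprMn lam2 -/k; field; rewrite !gt_eqF.
pose r2 : R := Num.sqrt (2 : R).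
have r22 : r2 ^+ 2 = 2 by rewrite sqr_sqrtr.
have r20 : 0 <= r2 by exact: sqrtr_ge0.
have r2l : 1413 / 1000 <= r2.
  by rewrite -ler_sqr ?nnegrE ?r22; [lra|lra|exact: r20].
have r2u : r2 <= 1416 / 1000.
  by rewrite -ler_sqr ?nnegrE ?r22; [lra|exact: r20|lra].
pose m2 : R := 681 / 100 * (r2 * D).
have m2E : 681 / 100 * Num.sqrt (2 * kappa * d%:R / n%:R) = m2.
  congr (_ * _); apply: sqrtr_eq; first by rewrite mulr_ge0// ltW.
  by rewrite exprMn r22 D2; field; rewrite gt_eqF.
have r2D : 1413 / 1000 * D <= r2 * D by rewrite ler_pM2r.
have r2D' : r2 * D <= 1416 / 1000 * D by rewrite ler_pM2r.
have Dm : 962 / 100 * D <= m2 by rewrite /m2; clear -r2D D0; lra.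
have mD : m2 <= 965 / 100 * D by rewrite /m2; clear -r2D' D0; lra.
have m20 : 0 < m2 by clear -Dm D0; lra.
have muE : mu_ kappa d n eps = m1 + m2 by rewrite /mu_ -/L m1E m2E.
have gE : gammam kappa d n eps = lam ^+ 2 / 3.
  by rewrite /gammam -/L -/k lam2; field; rewrite !gt_eqF.
(* The square root of the condition on the sample size, divided by [rn]. *)
have key : 20 * D + 5 / 2 * m1 + lam / 2 <= 1.
  move: ne; rewrite /neps -/L -rn2.
  have s1 : Num.sqrt (kappa * d%:R) = D * rn.
    apply: sqrtr_eq; first by rewrite mulr_ge0// ltW.
    by rewrite exprMn D2 rn2 divfK// gt_eqF.
  have s2 : Num.sqrt (2 * (kappa - 1) * L) = m1 * rn.
    apply: sqrtr_eq; first by rewrite mulr_ge0// ltW.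
    by rewrite exprMn rn2 /m1 exprMn lam2 -/k; field; rewrite !gt_eqF.
  rewrite s1 s2 -/k.
  have -> : 20 * (D * rn) + (5 / 2 + 1 / (2 * k)) * (m1 * rn) =
     (20 * D + 5 / 2 * m1 + lam / 2) * rn by rewrite /m1; field; rewrite gt_eqF.
  rewrite ler_sqr ?nnegrE; last 2 first.
  - by apply: mulr_ge0; [clear -D0 m10 lam0; lra|exact: ltW].
  - exact: ltW.
  by rewrite -{2}[rn]mul1r ler_pM2r.
set mu := mu_ _ _ _ _ in muE *; set g := gammam _ _ _ _ in gE *.
have mu1 : mu <= 483 / 1000 by rewrite muE; clear -key mD m10 m20 lam0; lra.
have mu0 : 0 <= mu by rewrite muE; clear -m10 m20; lra.
split; first by rewrite mu0.
have mup : 0 < 1 - 2 * mu by clear -mu1; lra.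
have -> : `|1 - g| / (1 + deltahat kappa d n eps) = `|1 - g| * (1 - 2 * mu) / (1 - mu).
  by rewrite /deltahat -/mu; field; rewrite !gt_eqF//; clear -mup mu0; lra.
have [lam1|lam1] := leP lam 1.
  exists lam; first by rewrite lam0.
  have g1 : g <= 1 by rewrite gE; clear -lam0 lam1; nra.
  rewrite ger0_norm ?subr_ge0//.
  have lam01 : 0 < lam <= 1 by rewrite lam0.
  have := case_small lam01 (ltW m10) (ltW m20) muE mu1 gE (erefl m1) Dm.
  set X := 1 - (1 - g) * (1 - 2 * mu) / (1 - mu) => H.
  have dD : 12 / 10 * d%:R <= n%:R * lam * D.
    rewrite -ler_sqr ?nnegrE; last 2 first.
    - by clear -dR; lra.
    - by rewrite !mulr_ge0// ltW.
    have -> : (n%:R * lam * D) ^+ 2 = 2 * d%:R * (L * (kappa / k)).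
      by rewrite !exprMn lam2 D2; field; rewrite !gt_eqF.
    have kk : 1 <= kappa / k by rewrite ler_pdivlMr// mul1r gerBl ler01.
    have Lk : L <= L * (kappa / k) by rewrite ler_peMr// ltW.
    have := ler_wpM2l (_ : 0 <= 2 * d%:R :> R) Lk; rewrite mulr_ge0// => /(_ isT).
    by move: LE l0 dR; clear; nra.
  have nl : 0 < n%:R * lam by rewrite mulr_gt0.
  have := ler_wpM2l (ltW nl) H.
  have -> : n%:R * lam * (k * lam + 3 / 10 * (k * lam ^+ 2) + 65 / 10 * D) =
    2 * L + 3 / 10 * (n%:R * k * lam ^+ 3) + 65 / 10 * (n%:R * lam * D).
    by rewrite L_lam; field.
  have -> : n%:R * k * (lam ^+ 2 / 2 + 3 / 10 * lam ^+ 3) =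
    L + 3 / 10 * (n%:R * k * lam ^+ 3) by rewrite L_lam; field.
  by rewrite -/D [lam * n%:R]mulrC; move: LE dD dR; clear; lra.
exists 1; first by rewrite ltr01 lexx.
have lam12 : 1 <= lam <= 2 by clear -key m10 lam1 D0; lra.
have c : 5 * m1 + 829 / 200 * m2 <= 2 - lam by clear -key mD D0; lra.
have := case_large lam12 (ltW m10) (ltW m20) muE c gE (erefl m1) Dm.
set X := 1 - `|1 - g| * (1 - 2 * mu) / (1 - mu) => H.
have dD : d%:R <= n%:R * D / 20.
  apply: (@le_trans _ _ (n%:R * D ^+ 2)).
    by rewrite D2 mulrC divfK ?gt_eqF// ler_peMl// ltW.
  by rewrite expr2 -!mulrA ler_pM2l// ler_pM2l//; clear -key m10 lam0; lra.
have := ler_wpM2l (ltW nR) H.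
have -> : n%:R * (8 / 10 * k + k * lam ^+ 2 / 2 + 59 / 10 * D) =
  8 / 10 * (n%:R * k) + L + 59 / 10 * (n%:R * D) by rewrite L_lam; field.
by rewrite -/D !expr1n mulr1 mul1r; move: LE dD dR; clear; lra.
Qed.

End ConfidenceConstants.

(** * The confidence event *)

Section SpectralEvent.
Context {disp : measure_display} {T : measurableType disp} {R : realType}
  (P : probability T R) {d n : nat}.
Variables (X : {RV P >-> d.-tuple R}) (Y : {RV P >-> R})
  (Xs : 'I_n -> {RV P >-> d.-tuple R}) (Ys : 'I_n -> {RV P >-> R})
  (thetastar : d.-tuple R) (S : 'M[R]_d) (kappa C : R)
  (thetahat : {RV P >-> d.-tuple R}).
Hypothesis LS : least_squares X Y Xs Ys thetastar S kappa C thetahat.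

Let X2 := ls_X2 LS.
Let G := gram P X.
Let GS : is_pinv_sqrt G S := ls_sqrt LS.
Let kappa1 := ls_kappa LS.
Let nR : 0 < n%:R :> R. Proof. by rewrite ltr0n (ls_size LS). Qed.

Lemma ls_dim_gt0 : (0 < d)%N.
Proof. exact: dim_gt0 (ls_kurtosis LS) kappa1. Qed.

Definition design (w : T) : 'I_n -> 'I_d -> R := fun i => whiten S (Xs i w).

Definition pac_loss (s : R) : R :=
  n%:R * (kappa - 1) * (s ^+ 2 / 2 + 3 / 10 * s ^+ 3)
  + 585 / 100 * (n%:R * s * Num.sqrt (kappa * d%:R / n%:R)) + 149 / 100 * d%:R.

Definition in_range (v : 'cV[R]_d) := range_proj G S *m v = v.

(** Stated through composition, so that no sigma-algebra has to be chosen on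
   ['I_n -> 'I_d -> R]. *)
Definition measurable_statistic (m : ('I_n -> 'I_d -> R) -> R) : Prop :=
  forall d' (T' : measurableType d') (y : T' -> 'I_n -> 'I_d -> R),
    (forall i j, measurable_fun setT (fun t => y t i j)) ->
    measurable_fun setT (fun t => m (y t)).

Lemma measurable_design i j : measurable_fun setT (fun w => design w i j).
Proof. exact: measurableT_comp (measurable_whiten S j) (measurable_funPT (Xs i)). Qed.

(** On the range of the Gram matrix a unit vector has second moment 1; homogeneity
   extends the bound to all its vectors. *)
Lemma sample_frame (s : R) : 0 < s <= 1 ->
  exists m : ('I_n -> 'I_d -> R) -> R,
  [/\ forall xs, 0 < m xs, measurable_statistic m,
      (\int[P]_w (m (design w))%:E <= 1)%E &
      forall xs (v : 'cV[R]_d), in_range v ->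
        s * (n%:R * sqnorm v - \sum_i lin (v ^~ ord0) (xs i) ^+ 2) <=
        sqnorm v * (ln (m xs) + pac_loss s)].
Proof.
move=> s01.
have mx j : measurable_fun setT (fun u : d.-tuple R * R => whiten S u.1 j).
  exact: measurableT_comp (measurable_whiten S j) measurable_fst.
have [m [m0 mm Em Hm]] := @gram_lower_bound _ _ _ _ _ P d
  (fun u : d.-tuple R * R => whiten S u.1) (fun w => (X w, Y w)) kappa mx
  (measurable_pairXY X Y) (whitened_coord_second_moment X2 GS)
  (whitened_fourth_moment X2 GS (ls_kurtosis LS)) n (fun i w => (Xs i w, Ys i w))
  (measurable_sample Xs Ys) (ls_indep LS) (ls_law LS) ls_dim_gt0 (ls_size LS)
  (ltW kappa1) s s01.
exists m; split=> // xs v vr.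
have [v0|v0] := eqVneq (sqnorm v) 0.
  rewrite v0 (sqnorm_eq0 v0) mul0r mulr0 big1 ?subr0 ?mulr0// => i _.
  by rewrite /lin big1 ?expr0n// => j _; rewrite mxE mul0r.
have vp : 0 < sqnorm v by rewrite lt0r v0 sqnorm_ge0.
pose r := Num.sqrt (sqnorm v).
have r0 : 0 < r by rewrite sqrtr_gt0.
have r2 : r ^+ 2 = sqnorm v by rewrite sqr_sqrtr// ltW.
pose u := r^-1 *: v.
have u1 : sqnorm u = 1 by rewrite sqnormZ exprVn r2 mulVf.
have uE : qform (range_proj G S) u = 1.
  by rewrite -inner_qform -scalemxAr vr -sqnormE u1.
have Eu := whitened_second_moment X2 GS u; rewrite uE in Eu.
have := Hm (u ^~ ord0) u1 Eu xs.
rewrite /pac_loss !addrA => H.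
rewrite -ler_pdivrMl// mulrC; apply: le_trans H; apply: le_of_eq.
rewrite sumrB sumr_const card_ord -mulrA; congr (_ * _).
rewrite mulrBl mulfK// mulr_suml; congr (_ - _); apply: eq_bigr => i _.
have -> : lin (u ^~ ord0) (xs i) = r^-1 * lin (v ^~ ord0) (xs i).
  by rewrite /lin mulr_sumr; apply: eq_bigr => j _; rewrite mxE mulrA.
by rewrite exprMn exprVn r2 mulrC.
Qed.

Lemma markov_le (f : T -> R) (e : R) : measurable_fun setT f ->
  (forall w, 0 < f w) -> (\int[P]_w (f w)%:E <= 1)%E -> 0 < e ->
  measurable [set w | f w <= e^-1] /\ ((1 - e)%:E <= P [set w | (f w <= e^-1)%R])%E.
Proof.
move=> mf f0 Ef e0; set A := [set w | _].
have mA : measurable A by exact: measurable_level.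
split=> //; have mAC := measurableC mA.
have PAC : (P (~` A) <= e%:E)%E.
  have H : ((e^-1)%:E * P (~` A) <= 1)%E.
    apply: le_trans Ef; rewrite -[X in (_ * P X)%E]setIT -integral_indic//.
    rewrite -ge0_Eint_Zl ?invr_ge0 ?(ltW e0)//.
    apply: ge0_Eint_le => //.
    - by apply: measurable_funM => //; exact: measurable_indic.
    - by move=> w; rewrite mulr_ge0 ?invr_ge0 ?(ltW e0)// indicE.
    - move=> w; rewrite indicE; have [|_] := boolP (w \in _).
        by rewrite inE /A /= => /negP; rewrite -ltNge mulr1 => /ltW.
      by rewrite mulr0 ltW.
  have PF : P (~` A) \is a fin_num by rewrite fin_num_measure.
  move: H; rewrite -(fineK PF) -EFinM !lee_fin.
  by rewrite ler_pdivrMl// mulr1.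
have := probability_setC P mA => PE; move: PAC; rewrite PE.
have PF : P A \is a fin_num by rewrite fin_num_measure.
rewrite -(fineK PF) -EFinB !lee_fin; lra.
Qed.

Let excess := excess_risk P X Y thetastar thetahat.
Let noise w := sqnorm (noisevec Xs Ys thetastar S w).

Lemma measurable_noise : measurable_fun setT noise.
Proof. by have [/intg_meas] := noisevec_second_moment LS. Qed.

(** The lower bound on the quadratic form turns the excess risk into the noise,
   whose second moment is [n%:R * C] over the whole space. *)
Lemma integral_excess_le (Om : set T) (a : R) : measurable Om -> 0 < a ->
  (forall w v, Om w -> in_range v ->
     n%:R * a * sqnorm v <= \sum_i lin (v ^~ ord0) (design w i) ^+ 2) ->
  (\int[P]_(w in Om) (excess w)%:E <= (C / (n%:R * a ^+ 2))%:E)%E.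
Proof.
move=> mOm a0 H; pose b := (n%:R * a) ^- 2.
have na0 : 0 < n%:R * a by rewrite mulr_gt0.
have b0 : 0 <= b by rewrite invr_ge0 sqr_ge0.
have mn := measurable_noise.
have n0 w : 0 <= noise w by exact: sqnorm_ge0.
apply: (@le_trans _ _ (\int[P]_(w in Om) (b * noise w)%:E)%E).
  apply: ae_ge0_le_integral => //.
  - by move=> w _; rewrite lee_fin (excess_ge0 LS).
  - by apply/measurable_EFinP; apply: measurable_funTS; exact: measurable_excess LS.
  - by move=> w _; rewrite lee_fin mulr_ge0.
  - by apply/measurable_EFinP; apply: measurable_funTS; exact: measurable_funM.
  have := ae_sample_in_range LS; apply: filterS => w rw Omw.
  rewrite lee_fin mulrC ler_pdivlMr ?exprn_gt0// mulrC.
  apply: (excess_le_noise LS na0 rw).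
  have vr : in_range (rooterr X thetastar S thetahat w) := range_proj_gsqrt GS _.
  have := H w _ Omw vr; move/le_trans; apply; apply: le_of_eq.
  by apply: eq_bigr => i _; rewrite lin_whiten.
apply: (@le_trans _ _ (\int[P]_w (b * noise w)%:E)%E).
  apply: ge0_subset_integral => //.
  - by apply/measurable_EFinP; exact: measurable_funM.
  - by move=> w _; rewrite lee_fin mulr_ge0.
have [I E] := noisevec_second_moment LS.
rewrite ge0_Eint_Zl// -EFin_Rint// E -EFinM lee_fin; apply: le_of_eq.
by rewrite /b; field; rewrite !gt_eqF.
Qed.

Lemma frame_event (s a : R) (m : ('I_n -> 'I_d -> R) -> R) (e : R) xs
    (v : 'cV[R]_d) : 0 < s -> 0 < e -> (forall xs, 0 < m xs) -> m xs <= e^-1 ->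
  ln e^-1 + pac_loss s <= s * n%:R * (1 - a) ->
  s * (n%:R * sqnorm v - \sum_i lin (v ^~ ord0) (xs i) ^+ 2) <=
    sqnorm v * (ln (m xs) + pac_loss s) ->
  n%:R * a * sqnorm v <= \sum_i lin (v ^~ ord0) (xs i) ^+ 2.
Proof.
move=> s0 e0 m0 me la H.
have lm : ln (m xs) <= ln e^-1 by rewrite ler_ln ?posrE ?invr_gt0.
have v0 := sqnorm_ge0 v.
have H1 : sqnorm v * (ln (m xs) + pac_loss s) <= sqnorm v * (s * n%:R * (1 - a)).
  by rewrite ler_wpM2l//; lra.
rewrite -(ler_pM2l s0); move: H H1; set Q := \sum_i _.
lra.
Qed.

(** Markov's inequality for the mixture of likelihood ratios. The event is a level
   set of a statistic of the design alone, which the conditional bound needs. *)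
Lemma confidence_event (eps : R) : 0 < eps < 1 -> neps kappa d eps <= n%:R ->
  gammam kappa d n eps != 1 ->
  let a := `|1 - gammam kappa d n eps| / (1 + deltahat kappa d n eps) in
  0 < a /\
  exists m : ('I_n -> 'I_d -> R) -> R,
  [/\ measurable_statistic m,
      ((1 - eps)%:E <= P [set w | (m (design w) <= eps^-1)%R])%E &
      forall xs v, m xs <= eps^-1 -> in_range v ->
        n%:R * a * sqnorm v <= \sum_i lin (v ^~ ord0) (xs i) ^+ 2].
Proof.
move=> e01 ne g1 a; have /andP[e0 e1] := e01.
have [/andP[mu0 mu1] [s s01 Hs]] :=
  confidence_constants kappa1 ls_dim_gt0 (ls_size LS) e01 ne.
have /andP[s0 _] := s01.
split.
  apply: divr_gt0; first by rewrite normr_gt0 subr_eq0 eq_sym.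
  by rewrite /deltahat ltr_pwDl ?ltr01// divr_ge0//; lra.
have [m [m0 mm Em Hm]] := sample_frame s01.
have mmd : measurable_fun setT (fun w => m (design w)).
  by apply: mm => i j; exact: measurable_design.
exists m; split=> //.
  by have [] := markov_le mmd (fun w => m0 _) Em e0.
move=> xs v me vr; apply: (frame_event s0 e0 m0 me _ (Hm xs v vr)).
by rewrite /pac_loss !addrA.
Qed.

(** On the complement of the confidence event, of probability at most [eps], the
   truncated excess risk is at most [M]. *)
Lemma truncated_excess_le (eps M : R) : 0 < eps -> 0 < M ->
  neps kappa d eps <= n%:R -> gammam kappa d n eps != 1 ->
  (\int[P]_w (Num.min (excess w) M)%:E <=
    ((1 + deltahat kappa d n eps) ^+ 2 * C
       / ((1 - gammam kappa d n eps) ^+ 2 * n%:R) + eps * M)%:E)%E.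
Proof.
move=> e0 M0 ne g1.
have mex : measurable_fun setT excess := measurable_excess LS.
have ex0 w : 0 <= excess w := excess_ge0 LS w.
have mmin : measurable_fun setT (fun w => Num.min (excess w) M).
  exact: measurable_minr.
have min0 w : 0 <= Num.min (excess w) M by rewrite le_min ex0 ltW.
have minM w : Num.min (excess w) M <= M by rewrite ge_min lexx orbT.
have [e1|e1] := leP 1 eps.
  apply: (@le_trans _ _ M%:E).
    rewrite -[X in (_ <= X)%E](Eint_cst P); apply: ge0_Eint_le => //.
  rewrite lee_fin; have : 0 <= (1 + deltahat kappa d n eps) ^+ 2 * C /
     ((1 - gammam kappa d n eps) ^+ 2 * n%:R).
    by rewrite divr_ge0// mulr_ge0 ?sqr_ge0// (C_ge0 LS).
  have : M <= eps * M by rewrite ler_peMl// ltW.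
  lra.
have e01 : 0 < eps < 1 by rewrite e0.
have [a0 [m [mm Pm Hm]]] := confidence_event e01 ne g1.
set Om := [set w | _] in Pm; set a := _ / _ in a0 Hm.
have mOm : measurable Om.
  by apply: measurable_level; apply: mm => i j; exact: measurable_design.
have H1 := integral_excess_le mOm a0 (fun w v Omw vr => Hm _ v Omw vr).
rewrite -(setUv Om) ge0_integral_setU//; last 4 first.
- exact: measurableC.
- by rewrite setUv; exact/measurable_EFinP.
- by move=> w _; rewrite lee_fin.
- by apply/disj_set2P; rewrite setICr.
rewrite EFinD; apply: leeD.
  have -> : (1 + deltahat kappa d n eps) ^+ 2 * C /
     ((1 - gammam kappa d n eps) ^+ 2 * n%:R) = C / (n%:R * a ^+ 2).
    rewrite /a exprMn -normrX ger0_norm ?sqr_ge0// exprVn.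
    by rewrite !invfM invrK; ring.
  apply: le_trans H1; apply: ge0_le_integral => //.
  - by move=> w _; rewrite lee_fin.
  - by apply/measurable_EFinP; exact: measurable_funTS.
  - by apply/measurable_EFinP; exact: measurable_funTS.
  - by move=> w _; rewrite lee_fin ge_min lexx.
apply: (@le_trans _ _ (\int[P]_(w in ~` Om) (cst M%:E) w)%E).
  apply: ge0_le_integral => //.
  - exact: measurableC.
  - by move=> w _; rewrite lee_fin.
  - by apply/measurable_EFinP; exact: measurable_funTS.
  - by move=> w _; rewrite lee_fin.
rewrite integral_cst; last exact: measurableC.
rewrite [X in (_ * X)%E](probability_setC P mOm).
have PF : P Om \is a fin_num by rewrite fin_num_measure.
move: Pm; rewrite -(fineK PF) -EFinB -EFinM !lee_fin => Pm.
by rewrite mulrC ler_pM2r//; lra.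
Qed.

Lemma conditional_excess_le (eps : R) : 0 < eps < 1 ->
  neps kappa d eps <= n%:R -> gammam kappa d n eps != 1 ->
  exists Om : set T,
  [/\ measurable Om, ((1 - eps)%:E <= P Om)%E &
      ((n%:R / C)%:E * cond_expectation_event P excess Om <=
        ((1 + deltahat kappa d n eps) ^+ 2
          / ((1 - gammam kappa d n eps) ^+ 2 * fine (P Om)))%:E)%E].
Proof.
move=> e01 ne g1; have /andP[e0 e1] := e01.
have [a0 [m [mm Pm Hm]]] := confidence_event e01 ne g1.
set Om := [set w | _] in Pm; set a := _ / _ in a0 Hm.
have mOm : measurable Om.
  by apply: measurable_level; apply: mm => i j; exact: measurable_design.
have H1 := integral_excess_le mOm a0 (fun w v Omw vr => Hm _ v Omw vr).
exists Om; split=> //.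
have PF : P Om \is a fin_num by rewrite fin_num_measure.
have Pp : 0 < fine (P Om) by move: Pm; rewrite -(fineK PF) lee_fin; lra.
have -> : (1 + deltahat kappa d n eps) ^+ 2 /
    ((1 - gammam kappa d n eps) ^+ 2 * fine (P Om)) = (fine (P Om))^-1 * (a ^+ 2)^-1.
  rewrite /a exprMn -normrX ger0_norm ?sqr_ge0// exprVn.
  by rewrite !invfM invrK; ring.
have [C0|C0] := eqVneq C 0.
  rewrite C0 invr0 mulr0 mul0e lee_fin.
  by rewrite mulr_ge0// invr_ge0 ?sqr_ge0// ltW.
have Cp : 0 < C by rewrite lt0r C0 (C_ge0 LS).
rewrite /cond_expectation_event muleA -EFinM.
apply: le_trans (lee_wpmul2l _ H1) _.
  by rewrite lee_fin mulr_ge0// ?invr_ge0 ?divr_ge0// ltW.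
rewrite -EFinM lee_fin; apply: le_of_eq.
by field; rewrite !gt_eqF.
Qed.

End SpectralEvent.

(** * Sharp bound on the truncated excess risk *)

Section SharpReal.
Context {R : realType}.
Implicit Types a t y m e N J s n loss : R.

(** Fenchel inequality for the entropy. *)
Lemma entropy_young a t y : 0 <= a <= y -> 1 <= y -> a * t <= a * ln y + expR t.
Proof.
move=> /andP[a0 ay] y1.
have [->|a1] := eqVneq a 0; first by rewrite !mul0r add0r expR_ge0.
have ap : 0 < a by rewrite lt0r a1.
have lay : ln a <= ln y by rewrite ler_ln ?posrE// (lt_le_trans ltr01).
have : a * (1 + (t - ln a)) <= expR t.
  rewrite -[X in expR X](subrK (ln a) t) expRD lnK ?posrE// mulrC ler_pM2r//.
  exact: expR_ge1Dx.
have : a * ln a <= a * ln y by rewrite ler_pM2l.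
by rewrite !mulrDr mulrN mulr1; lra.
Qed.

(** [q] is the normalized excess risk, [z] the normalized noise, and [1 - J] the
   lower bound on the Gram matrix, with [m] the mixture of likelihood ratios. For
   [0 <= J <= 1/2] the factor [(1 - J)^{-2}] is at most [1 + 6 J], and the product of
   [ln m] with the truncated noise is split by [entropy_young]. For [J > 1/2] the
   mixture is exponentially large, which its mean makes unlikely. *)
Lemma truncated_ratio_le (q z y m J s n loss : R) :
  0 < s -> 0 < n -> 0 < m -> 0 <= q -> 0 <= z -> 1 <= y -> 0 <= loss ->
  J = (ln m + loss) / (s * n) ->
  (J < 1 -> (1 - J) ^+ 2 * q <= z) ->
  Num.min q y <= Num.min z y
    + 6 / (s * n) * (Num.min z y * (loss + ln y) + m + 1)
    + y * expR (loss - s * n / 2) * m.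
Proof.
move=> s0 n0 m0 q0 z0 y1 l0 JE H.
have sn0 : 0 < s * n by rewrite mulr_gt0.
have y0 : 0 < y by lra.
have ly : 0 <= ln y := ln_ge0 y1.
set a := Num.min z y.
have a0 : 0 <= a by rewrite le_min z0 ltW.
have ay : a <= y by rewrite ge_min lexx orbT.
have t1 : 0 <= 6 / (s * n) * (a * (loss + ln y) + m + 1).
  apply: mulr_ge0; first by rewrite divr_ge0// ltW.
  by rewrite !addr_ge0// ?(ltW m0)// mulr_ge0// addr_ge0.
have t2 : 0 <= y * expR (loss - s * n / 2) * m.
  by rewrite !mulr_ge0 ?expR_ge0// ltW.
have [J1|J1] := leP J 2^-1; last first.
  apply: (@le_trans _ _ y); first by rewrite ge_min lexx orbT.
  apply: (@le_trans _ _ (y * expR (loss - s * n / 2) * m)); last by lra.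
  rewrite -mulrA ler_peMr ?(ltW y0)// -[m]lnK ?posrE// -expRD.
  rewrite -[leLHS]expR0 ler_expR.
  move: J1; rewrite JE ltr_pdivlMr//; lra.
pose t := Num.max (ln m) 0.
have t0 : 0 <= t by rewrite le_max lexx orbT.
pose K := (t + loss) / (s * n).
have K0 : 0 <= K by rewrite divr_ge0 ?addr_ge0// ltW.
have JK : J <= K by rewrite JE ler_pM2r ?invr_gt0// lerD2r le_max lexx.
have Hq : (1 - J) ^+ 2 * q <= z by apply: H; lra.
have qK : q <= (1 + 6 * K) * z.
  have Jq : q <= (1 + 6 * K) * ((1 - J) ^+ 2 * q).
    have [J0|J0] := leP J 0.
      have h1 : 1 <= (1 - J) ^+ 2 by nra.
      have h2 : q <= (1 - J) ^+ 2 * q by rewrite ler_peMl.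
      have h3 : 0 <= 6 * K * ((1 - J) ^+ 2 * q).
        by apply: mulr_ge0; [lra|apply: mulr_ge0 => //; exact: sqr_ge0].
      by rewrite mulrDl mul1r; lra.
    have h1 : 1 <= (1 + 6 * J) * (1 - J) ^+ 2.
      have -> : (1 + 6 * J) * (1 - J) ^+ 2 = 1 + J * (1 - 2 * J) * (4 - 3 * J) by ring.
      by rewrite lerDl; apply: mulr_ge0; [apply: mulr_ge0|]; lra.
    have h2 : (1 + 6 * J) * (1 - J) ^+ 2 <= (1 + 6 * K) * (1 - J) ^+ 2.
      by rewrite ler_wpM2r ?sqr_ge0//; lra.
    by rewrite mulrA ler_peMl// (le_trans h1).
  by apply: le_trans Jq _; rewrite ler_wpM2l//; lra.
have step : Num.min q y <= (1 + 6 * K) * a.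
  rewrite /a; have K1 : 1 <= 1 + 6 * K by lra.
  case: (leP z y) => zy.
    by rewrite (le_trans _ qK)// ge_min lexx.
  by apply: (@le_trans _ _ y); rewrite ?ge_min ?lexx ?orbT// ler_peMl// ltW.
apply: le_trans step _.
have ex : expR t <= m + 1.
  rewrite /t; case: (leP (ln m) 0) => lm; rewrite ?expR0 ?lnK ?posrE//; lra.
have yg : a * t <= a * ln y + expR t by apply: entropy_young; rewrite ?a0.
have : a * K <= (s * n)^-1 * (a * (loss + ln y) + m + 1).
  rewrite /K mulrA [leLHS]mulrC ler_pM2l ?invr_gt0//.
  by rewrite !mulrDr; lra.
have -> : 6 / (s * n) * (a * (loss + ln y) + m + 1) =
  6 * ((s * n)^-1 * (a * (loss + ln y) + m + 1)) by ring.
have -> : (1 + 6 * K) * a = a + 6 * (a * K) by ring.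
lra.
Qed.

Lemma ln_le_2sqrt (z : R) : 0 < z -> ln z <= 2 * Num.sqrt z.
Proof.
move=> z0; have r0 : 0 < Num.sqrt z by rewrite sqrtr_gt0.
rewrite -{1}(sqr_sqrtr (ltW z0)) lnXn// mulr2n.
have := ln_sublinear r0; lra.
Qed.

(** The exponential pays for the bounded range of the truncation level in small
   samples, see [small_sample]. *)
Definition sharp_const : R := 100 * 100 * expR (100 * 300).

Let E30 : 1 <= expR (100 * 300) :> R.
Proof. by rewrite -expR0 ler_expR mulr_ge0// ler0n. Qed.

(** With [z = n / kappa], the sample size condition reads [c (t - ln z) <= z]; if
   [z] is also below a multiple of [t], then [z] and [t] are bounded, and so is
   the truncation level [y]. *)
Lemma small_sample (t y z d : R) : 0 < z -> 1 <= y -> 1 <= d -> t = d + ln y ->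
  z < 16 * 100 * t -> sharp_const * (t - ln z) <= z ->
  y <= 1 + sharp_const * Num.sqrt (t / z).
Proof.
move=> z0 y1 d1 tE zt Hc.
set r := Num.sqrt z.
have r0 : 0 < r by rewrite sqrtr_gt0.
have r2 : r ^+ 2 = z by rewrite sqr_sqrtr// ltW.
have y0 : 0 < y by lra.
have ly : 0 <= ln y := ln_ge0 y1.
have lz : ln z <= 2 * r := ln_le_2sqrt z0.
have c3200 : 32 * 100 <= sharp_const by have := E30; rewrite /sharp_const; lra.
have H1 : 32 * 100 * (t - ln z) <= z.
  have [tz|tz] := leP 0 (t - ln z).
    by apply: le_trans Hc; rewrite ler_wpM2r.
  by apply: le_trans (ltW z0); rewrite pmulr_rle0// ltW.
have r6400 : r <= 64 * 100.
  have : r ^+ 2 <= 64 * 100 * r by rewrite r2; lra.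
  by rewrite expr2 ler_pM2r.
have t3 : t <= 100 * 300.
  have : z <= 64 * 100 * r by rewrite -r2 expr2 ler_pM2r.
  lra.
have yE : y <= expR (100 * 300).
  by rewrite -[y]lnK ?posrE// ler_expR; lra.
have t1 : 1 <= t by lra.
have sq : (64 * 100)^-1 <= Num.sqrt (t / z).
  rewrite -[leLHS](ger0_norm (_ : 0 <= (64 * 100)^-1)) ?invr_ge0// -sqrtr_sqr.
  rewrite ler_sqrt ?divr_ge0//; try lra.
  rewrite ler_pdivlMr//; apply: (@le_trans _ _ 1); last by [].
  rewrite -r2 exprVn ler_pdivrMl ?exprn_gt0// mulr1.
  by apply: lerXn2r => //; rewrite nnegrE ltW.
have : sharp_const * (64 * 100)^-1 <= sharp_const * Num.sqrt (t / z).
  by rewrite ler_wpM2l//; lra.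
have : expR (100 * 300) <= sharp_const * (64 * 100)^-1.
  by rewrite /sharp_const; have := E30; lra.
lra.
Qed.

(** The temperature of the large sample regime balances variance and entropy. *)
Lemma large_sample (t y kappa n d : R) : 1 < kappa -> 1 <= d -> 0 < n -> 1 <= y ->
  t = d + ln y -> 16 * 100 * t <= n / kappa ->
  exists2 s : R, 0 < s <= 1 &
    forall loss, loss = n * (kappa - 1) * (s ^+ 2 / 2 + 3 / 10 * s ^+ 3)
        + 585 / 100 * (n * s * Num.sqrt (kappa * d / n)) + 149 / 100 * d ->
    0 <= loss /\
    1 + 6 / (s * n) * (loss + ln y + 2) + y * expR (loss - s * n / 2)
      <= 1 + sharp_const * Num.sqrt (kappa * t / n).
Proof.
move=> k1 d1 n0 y1 tE tn.
have ly : 0 <= ln y := ln_ge0 y1.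
have t1 : 1 <= t by lra.
have t0 : 0 < t by lra.
have k0 : 0 < kappa by lra.
pose z := n / kappa.
have z0 : 0 < z by rewrite divr_gt0.
pose r := Num.sqrt (z / t).
have r0 : 0 < r by rewrite sqrtr_gt0 divr_gt0.
have r2 : r ^+ 2 = z / t by rewrite sqr_sqrtr// divr_ge0 ?ltW.
have r40 : 40 <= r.
  rewrite -[leLHS](ger0_norm (ler0n R 40)) -sqrtr_sqr ler_sqrt; last by apply: divr_ge0; exact: ltW.
  by rewrite ler_pdivlMr//; apply: le_trans tn; rewrite ler_pM2r// expr2; lra.
have nE : n = kappa * t * r ^+ 2 by rewrite r2 /z; field; rewrite !gt_eqF.
pose s := (kappa * r)^-1.
have r1 : 1 <= r by clear -r40; lra.
have kr : 1 <= kappa * r by rewrite mulr_ege1// ltW.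
have s0 : 0 < s by rewrite invr_gt0 mulr_gt0.
have s1 : s <= 1 by rewrite invf_le1// mulr_gt0.
exists s; first by rewrite s0.
move=> loss lE.
have snE : s * n = t * r by rewrite nE /s; field; rewrite !gt_eqF.
have nsD : n * s * Num.sqrt (kappa * d / n) <= t.
  rewrite [n * s]mulrC snE.
  have -> : kappa * d / n = d / (t * r ^+ 2) by rewrite nE; field; rewrite !gt_eqF.
  apply: (@le_trans _ _ (t * r * Num.sqrt (t / (t * r ^+ 2)))); last first.
    rewrite (@sqrtr_eq _ _ r^-1) ?invr_ge0 ?(ltW r0)//; first by rewrite mulfK// gt_eqF.
    by field; rewrite !gt_eqF.
  apply: ler_wpM2l; first by rewrite mulr_ge0// ltW.
  rewrite ler_sqrt; last by rewrite ltW// divr_gt0 ?mulr_gt0 ?exprn_gt0.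
  by rewrite ler_pM2r ?invr_gt0 ?mulr_gt0 ?exprn_gt0//; lra.
have nsD0 : 0 <= n * s * Num.sqrt (kappa * d / n).
  by rewrite !mulr_ge0 ?sqrtr_ge0// ltW.
have s2 : 0 <= s ^+ 2 by exact: sqr_ge0.
have s3 : s ^+ 3 <= s ^+ 2 by rewrite exprS ler_piMl.
have s30 : 0 <= s ^+ 3 by rewrite exprn_ge0// ltW.
have v0 : 0 <= n * (kappa - 1) * (s ^+ 2 / 2 + 3 / 10 * s ^+ 3).
  by apply: mulr_ge0; [apply: mulr_ge0; lra|lra].
have v1 : n * (kappa - 1) * (s ^+ 2 / 2 + 3 / 10 * s ^+ 3) <= 8 / 10 * t.
  apply: (@le_trans _ _ (n * kappa * (8 / 10 * s ^+ 2))).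
    apply: ler_pM; [apply: mulr_ge0| |rewrite ler_pM2l//|];
      by clear -n0 k1 s2 s3 s30; lra.
  apply: le_of_eq.
  by rewrite nE /s; field; rewrite !gt_eqF.
have l0 : 0 <= loss by rewrite lE; clear -v0 nsD0 d1; lra.
have l1 : loss <= 815 / 100 * t by rewrite lE; clear -v1 nsD d1 tE ly; lra.
split=> //.
have -> : Num.sqrt (kappa * t / n) = r^-1.
  by apply: sqrtr_eq; rewrite ?invr_ge0 ?(ltW r0)// nE; field; rewrite !gt_eqF.
have p1 : 6 / (s * n) * (loss + ln y + 2) <= 67 / r.
  rewrite snE; apply: (@le_trans _ _ (6 / (t * r) * (1115 / 100 * t))).
    by rewrite ler_wpM2l ?divr_ge0 ?mulr_ge0 ?(ltW t0) ?(ltW r0)//;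
       clear -l1 tE d1 t1; lra.
  have -> : 6 / (t * r) * (1115 / 100 * t) = 669 / 10 / r by field; rewrite !gt_eqF.
  by rewrite ler_pM2r ?invr_gt0//; clear; lra.
have p2 : y * expR (loss - s * n / 2) <= 4 / r.
  have y0 : 0 < y by clear -y1; lra.
  rewrite -{1}[y]lnK ?posrE// -expRD snE.
  apply: (@le_trans _ _ (expR (- (r / 4)))).
    by rewrite ler_expR; clear -l1 tE d1 t1 r40; nra.
  rewrite expRN -[leRHS]invrK lef_pV2 ?posrE ?expR_gt0 ?invr_gt0 ?divr_gt0//.
  by rewrite invfM invrK mulrC; have := expR_ge1Dx (r / 4); clear; lra.
have : 71 / r <= sharp_const * r^-1.
  by rewrite ler_pM2r ?invr_gt0// /sharp_const; have := E30; clear; lra.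
have -> : 71 / r = 67 / r + 4 / r by rewrite -mulrDl; congr (_ / _); clear; lra.
by clear -p1 p2; lra.
Qed.

End SharpReal.

Section SharpTruncated.
Context {disp : measure_display} {T : measurableType disp} {R : realType}
  (P : probability T R) {d n : nat}.
Variables (X : {RV P >-> d.-tuple R}) (Y : {RV P >-> R})
  (Xs : 'I_n -> {RV P >-> d.-tuple R}) (Ys : 'I_n -> {RV P >-> R})
  (thetastar : d.-tuple R) (S : 'M[R]_d) (kappa C : R)
  (thetahat : {RV P >-> d.-tuple R}).
Hypothesis LS : least_squares X Y Xs Ys thetastar S kappa C thetahat.

Let excess := excess_risk P X Y thetastar thetahat.
Let noise w := sqnorm (noisevec Xs Ys thetastar S w).

(** No confidence level is fixed: the pointwise bound of [truncated_ratio_le] is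
   integrated, where both the mixture and the normalized noise have expectation at
   most one. *)
Lemma sharp_truncated_excess (C' M : R) : 0 < C' -> C <= C' -> 0 < M ->
  sharp_const * (kappa * (d%:R + ln (kappa * M / C'))) <= n%:R ->
  (\int[P]_w (Num.min (excess w) M)%:E <=
   (C' / n%:R * (1 + sharp_const *
      Num.sqrt (kappa * (d%:R + ln (M * n%:R / C')) / n%:R)))%:E)%E.
Proof.
move=> C'0 CC' M0 Hn.
have n0 : 0 < n%:R :> R by rewrite ltr0n (ls_size LS).
have d1 : 1 <= d%:R :> R by rewrite ler1n (ls_dim_gt0 LS).
have k1 := ls_kappa LS.
have k0 : 0 < kappa by lra.
have Cn0 : 0 < C' / n%:R by rewrite divr_gt0.
have mex : measurable_fun setT excess := measurable_excess LS.
have ex0 w : 0 <= excess w := excess_ge0 LS w.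
have mmin : measurable_fun setT (fun w => Num.min (excess w) M).
  exact: measurable_minr.
have min0 w : 0 <= Num.min (excess w) M by rewrite le_min ex0 ltW.
have leM : (\int[P]_w (Num.min (excess w) M)%:E <= M%:E)%E.
  rewrite -[X in (_ <= X)%E](Eint_cst P); apply: ge0_Eint_le => // w.
  by rewrite ge_min lexx orbT.
have c0 : 0 <= sharp_const :> R by rewrite /sharp_const !mulr_ge0 ?expR_ge0.
set q := Num.sqrt _.
have q0 : 0 <= q by exact: sqrtr_ge0.
pose y := M * n%:R / C'.
have y0 : 0 < y by rewrite divr_gt0 ?mulr_gt0.
have ME : M = C' / n%:R * y by rewrite /y; field; rewrite !gt_eqF.
have [y1|y1] := ltP y 1.
  apply: le_trans leM _; rewrite lee_fin ME ler_pM2l//.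
  by rewrite (le_trans (ltW y1))// lerDl mulr_ge0.
pose t := d%:R + ln y.
have ly : 0 <= ln y := ln_ge0 y1.
pose z := n%:R / kappa.
have z0 : 0 < z by rewrite divr_gt0.
have qE : q = Num.sqrt (t / z).
  by rewrite /q; congr Num.sqrt; rewrite /t /z -/y; field; rewrite !gt_eqF.
have [zt|zt] := ltP z (16 * 100 * t).
  apply: le_trans leM _; rewrite lee_fin [leLHS]ME ler_pM2l// qE.
  apply: (small_sample (d := d%:R)) => //.
  have E : d%:R + ln (kappa * M / C') = t - ln z.
    rewrite /t -addrA -ln_div ?posrE//; congr (_ + ln _).
    by rewrite /y /z; field; rewrite !gt_eqF.
  by move: Hn; rewrite E /z ler_pdivlMr// => Hn; apply: le_trans Hn; rewrite mulrCA mulrC.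
have [s s01 Hs] := large_sample k1 d1 n0 y1 (erefl t) zt.
have [l0 Hs'] := Hs (@pac_loss R d n kappa s) (erefl _).
have /andP[s0 s1] := s01.
set loss := @pac_loss R d n kappa s in l0 Hs'.
have [m [m0 mm Em Hm]] := sample_frame LS s01.
pose mw w := m (design Xs S w).
have mmw : measurable_fun setT mw by apply: mm => i j; exact: measurable_design.
have mw0 w : 0 < mw w by exact: m0.
pose zz w := (n%:R * C')^-1 * noise w.
have nC0 : 0 < n%:R * C' by rewrite mulr_gt0.
have mzz : measurable_fun setT zz.
  by apply: measurable_funM => //; exact: measurable_noise LS.
have zz0 w : 0 <= zz w by rewrite mulr_ge0 ?invr_ge0 ?(ltW nC0)// sqnorm_ge0.
pose a w := Num.min (zz w) y.
have ma : measurable_fun setT a by exact: measurable_minr.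
have a0 w : 0 <= a w by rewrite le_min zz0 ltW.
have sn0 : 0 < s * n%:R by rewrite mulr_gt0.
have Ez : (\int[P]_w (a w)%:E <= 1)%E.
  apply: (@le_trans _ _ (\int[P]_w (zz w)%:E)%E).
    by apply: ge0_Eint_le => // w; rewrite ge_min lexx.
  have [I E] := noisevec_second_moment LS.
  rewrite ge0_Eint_Zl ?invr_ge0 ?(ltW nC0)//; last first.
  - by move=> w; exact: sqnorm_ge0.
  - exact: measurable_noise LS.
  rewrite -EFin_Rint// E -EFinM lee_fin.
  by rewrite invfM mulrACA mulVf ?gt_eqF// mul1r ler_pdivrMl// mulr1.
pose c1 := 1 + 6 / (s * n%:R) * (loss + ln y).
pose c2 := 6 / (s * n%:R) + y * expR (loss - s * n%:R / 2).
pose c3 := 6 / (s * n%:R).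
have c30 : 0 <= c3 by rewrite divr_ge0// ltW.
have c10 : 0 <= c1 by rewrite addr_ge0// mulr_ge0// addr_ge0.
have c20 : 0 <= c2 by rewrite addr_ge0// mulr_ge0 ?expR_ge0// ltW.
have pw : {ae P, forall w, setT w ->
    ((Num.min (excess w) M)%:E <=
     (C' / n%:R * (c1 * a w + c2 * mw w + c3))%:E)%E}.
  have := ae_sample_in_range LS; apply: filterS => w rw _.
  rewrite lee_fin.
  have -> : Num.min (excess w) M = C' / n%:R * Num.min (n%:R / C' * excess w) y.
    rewrite minr_pMr ?(ltW Cn0)// -ME mulrA (_ : C' / n%:R * (n%:R / C') = 1) ?mul1r//.
    by field; rewrite !gt_eqF.
  rewrite ler_pM2l//.
  have := @truncated_ratio_le R (n%:R / C' * excess w) (zz w) y (mw w)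
    ((ln (mw w) + loss) / (s * n%:R)) s n%:R loss s0 n0 (mw0 w) _ (zz0 w) y1 l0 erefl.
  rewrite mulr_ge0 ?divr_ge0 ?(ltW n0) ?(ltW C'0)// => /(_ isT) H.
  apply: le_trans (H _) _; last first.
    by apply: le_of_eq; rewrite /c1 /c2 /c3 /a; ring.
  set J := _ / (s * n%:R) => J1.
  have b0 : 0 < n%:R * (1 - J) by rewrite mulr_gt0// subr_gt0.
  have vr : in_range X S (rooterr X thetastar S thetahat w).
    exact: range_proj_gsqrt (ls_sqrt LS) _.
  have F := Hm (design Xs S w) _ vr.
  have := excess_le_noise LS b0 rw.
  have -> : \sum_i inner (rooterr X thetastar S thetahat w) (S *m vec (Xs i w)) ^+ 2
     = \sum_i lin (rooterr X thetastar S thetahat w ^~ ord0) (design Xs S w i) ^+ 2.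
    by apply: eq_bigr => i _; rewrite lin_whiten.
  set Q := \sum_i _ in F *; set E := sqnorm _ in F *.
  have HQ : n%:R * (1 - J) * E <= Q.
    rewrite -(ler_pM2l s0).
    have -> : s * (n%:R * (1 - J) * E) = s * (n%:R * E) - E * (s * n%:R * J) by ring.
    have -> : s * n%:R * J = ln (mw w) + loss by rewrite /J mulrC divfK// gt_eqF.
    by move: F; rewrite mulrBr /loss /mw; lra.
  move=> /(_ HQ) HN.
  rewrite /zz ler_pdivlMl//; apply: le_trans HN.
  apply: le_of_eq; rewrite -/(excess w).
  by field; rewrite !gt_eqF.
apply: (@le_trans _ _ (\int[P]_w (C' / n%:R * (c1 * a w + c2 * mw w + c3))%:E)%E).
  apply: ae_ge0_le_integral => //.
  - by move=> w _; rewrite lee_fin.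
  - exact/measurable_EFinP.
  - move=> w _; rewrite lee_fin mulr_ge0 ?(ltW Cn0)//.
    by rewrite !addr_ge0// mulr_ge0// ltW.
  - by apply/measurable_EFinP; meas.
have mw0' w : 0 <= mw w by exact: ltW.
have t10 w : 0 <= c1 * a w by rewrite mulr_ge0.
have t20 w : 0 <= c2 * mw w by rewrite mulr_ge0.
rewrite ge0_Eint_Zl ?(ltW Cn0)//; [|by meas|by move=> w; rewrite !addr_ge0].
rewrite [leRHS]EFinM; apply: lee_wpmul2l; first by rewrite lee_fin ltW.
rewrite ge0_Eint_D//; [|by meas|by move=> w; rewrite addr_ge0].
rewrite ge0_Eint_D//; [|by meas|by meas].
rewrite Eint_cst ge0_Eint_Zl// ge0_Eint_Zl//.
apply: (@le_trans _ _ (c1%:E * 1 + c2%:E * 1 + c3%:E)%E).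
  by apply: leeD => //; apply: leeD; apply: lee_wpmul2l.
rewrite !mule1 -!EFinD lee_fin.
apply: (@le_trans _ _ (1 + 6 / (s * n%:R) * (loss + ln y + 2)
  + y * expR (loss - s * n%:R / 2))).
  by apply: le_of_eq; rewrite /c1 /c2 /c3; ring.
have -> : q = Num.sqrt (kappa * t / n%:R) by [].
exact: Hs'.
Qed.

End SharpTruncated.

(** * Independence of tuples *)

Section TupleIndependence.
Context {disp dU : measure_display} {T : measurableType disp}
  {U : measurableType dU} {R : realType} (P : probability T R) {n : nat}.

Definition box (B : 'I_n -> set U) : set (n.-tuple U) :=
  [set t | forall i, B i (tnth t i)].

Lemma measurable_box (B : 'I_n -> set U) :
  (forall i, measurable (B i)) -> measurable (box B).
Proof.
move=> mB; rewrite (_ : box B = \bigcap_(i in [set: 'I_n]) ((fun t => tnth t i) @^-1` B i)).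
  apply: fin_bigcap_measurable => // i _.
  rewrite -[X in measurable X]setTI; exact: (measurable_tnth i).
by apply/seteqP; split=> t /= H i; [move=> _|]; exact: H.
Qed.

Definition boxes : set (set (n.-tuple U)) :=
  [set A | exists2 B : 'I_n -> set U, (forall i, measurable (B i)) & A = box B].

Lemma boxes_setI : setI_closed boxes.
Proof.
move=> _ _ [A mA ->] [B mB ->]; exists (fun i => A i `&` B i).
  by move=> i; exact: measurableI.
apply/seteqP; split=> t /=; first by move=> [HA HB] i; split.
by move=> H; split=> i; have [] := H i.
Qed.

Lemma box_setT : box (fun=> setT) = setT.
Proof. by apply/seteqP; split. Qed.

(** A cylinder is a box with all sides but one full. *)
Lemma measurable_boxes : @measurable _ (n.-tuple U) = <<s boxes >>.
Proof.
apply/seteqP; split; last first.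
  apply: smallest_sub; first exact: sigma_algebra_measurable.
  by move=> _ [B mB ->]; exact: measurable_box.
apply: smallest_sub; first exact: smallest_sigma_algebra.
move=> A; rewrite -bigcup_seq /= => -[i _ [B mB <-]].
apply: sub_sigma_algebra; exists (fun j => if j == i then B else setT).
  by move=> j; case: ifP.
apply/seteqP; split=> t /=.
  by move=> [_ Bt] j; case: eqP => // ->.
by move=> H; split=> //; have := H i; rewrite eqxx.
Qed.

Variable Z : T -> n.-tuple U.
Hypothesis mZ : measurable_fun setT Z.

Let mZ_mixin := isMeasurableFun.Build _ _ _ _ _ mZ.
Let mZ_pack : {mfun T >-> n.-tuple U} := HB.pack Z mZ_mixin.

(** Both sides are finite measures in [A], and boxes form a pi-system that
   generates the product sigma-algebra. *)
Lemma indep_event_tuple (D : set T) : measurable D ->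
  (forall B, (forall i, measurable (B i)) ->
     (P (Z @^-1` box B `&` D) = P (Z @^-1` box B) * P D)%E) ->
  forall A, measurable A -> (P (Z @^-1` A `&` D) = P (Z @^-1` A) * P D)%E.
Proof.
move=> mD H A mA.
have PD : P D \is a fin_num by rewrite fin_num_measure.
have pd0 : 0 <= fine (P D) by apply: fine_ge0; exact: measure_ge0.
pose m1 := pushforward (mrestr P mD) mZ_pack.
pose m2 := mscale (NngNum pd0) (pushforward P mZ_pack).
suff : m1 A = m2 mZ A.
  change (P (Z @^-1` A `&` D) = (fine (P D))%:E * P (Z @^-1` A) ->
    P (Z @^-1` A `&` D) = P (Z @^-1` A) * P D)%E.
  by rewrite fineK// muleC.
apply: (measure_unique boxes (fun=> setT)) => //.
- exact: measurable_boxes.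
- exact: boxes_setI.
- by move=> _; exists (fun=> setT) => //; rewrite box_setT.
- by rewrite bigcup_const//; exists 0%N.
- move=> _ [B mB ->].
  change (P (Z @^-1` box B `&` D) = (fine (P D))%:E * P (Z @^-1` box B))%E.
  by rewrite fineK// muleC; exact: H.
- move=> _; change (P (Z @^-1` setT `&` D) < +oo)%E.
  by rewrite preimage_setT setTI ltey_eq PD.
Qed.

End TupleIndependence.

(** * The regularized empirical Gram matrix *)

Section RegularizedGram.
Context {R : realType} {d n : nat}.
Variables (Pi : 'M[R]_d).

(** The empirical Gram matrix completed, on the kernel of the Gram matrix, into an
   invertible matrix. Its inverse is written with the adjugate, whose entries are
   polynomial in the design, hence measurable. *)
Definition reg_gram (x : 'I_n -> 'cV[R]_d) : 'M[R]_d :=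
  \sum_i x i *m (x i)^T + n%:R *: (1%:M - Pi).

Definition reg_inv (x : 'I_n -> 'cV[R]_d) : 'M[R]_d :=
  (\det (reg_gram x))^-1 *: \adj (reg_gram x).

Hypothesis Pis : Pi^T = Pi.
Hypothesis PiPi : Pi *m Pi = Pi.
Variables (x : 'I_n -> 'cV[R]_d) (a : R).
Hypothesis n0 : (0 < n)%N.
Hypothesis a01 : 0 < a <= 1.
Hypothesis xr : forall i, Pi *m x i = x i.
Hypothesis frame : forall v : 'cV[R]_d, Pi *m v = v ->
  n%:R * a * sqnorm v <= \sum_i inner v (x i) ^+ 2.

Let B := reg_gram x.
Let Binv := reg_inv x.
Let nR : 0 < n%:R :> R. Proof. by rewrite ltr0n. Qed.

Lemma outer_mul (u v w : 'cV[R]_d) : (u *m v^T) *m w = inner v w *: u.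
Proof.
rewrite -mulmxA (mx11_scalar (v^T *m w)) mul_mx_scalar.
by rewrite /inner.
Qed.

Lemma reg_gram_mul (z : 'cV[R]_d) :
  B *m z = \sum_i inner z (x i) *: x i + n%:R *: (z - Pi *m z).
Proof.
rewrite /B /reg_gram mulmxDl mulmx_suml -scalemxAl mulmxBl mul1mx; congr (_ + _).
by apply: eq_bigr => i _; rewrite outer_mul innerC.
Qed.

Lemma reg_gram_sym : B^T = B.
Proof.
rewrite /B /reg_gram linearD linearZ /= linearB /= Pis trmx1; congr (_ + _).
rewrite linear_sum /=; apply: eq_bigr => i _.
by rewrite trmx_mul trmxK.
Qed.

Lemma reg_gram_form (z : 'cV[R]_d) : inner z (B *m z) =
  \sum_i inner z (x i) ^+ 2 + n%:R * (sqnorm z - qform Pi z).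
Proof.
rewrite reg_gram_mul innerC innerDl innerZl innerBl -sqnormE; congr (_ + _).
  rewrite innerC inner_sumr; apply: eq_bigr => i _.
  by rewrite innerZr expr2.
by congr (_ * (_ - _)); rewrite innerC inner_qform.
Qed.

Lemma reg_gram_ge (z : 'cV[R]_d) : n%:R * a * sqnorm z <= inner z (B *m z).
Proof.
have /andP[a0 a1] := a01.
have E : sqnorm (Pi *m z) = qform Pi z.
  by rewrite sqnormE inner_mxl Pis mulmxA PiPi inner_qform.
have F : n%:R * a * sqnorm (Pi *m z) <= \sum_i inner (Pi *m z) (x i) ^+ 2.
  by apply: frame; rewrite mulmxA PiPi.
rewrite reg_gram_form.
have -> : \sum_i inner z (x i) ^+ 2 = \sum_i inner (Pi *m z) (x i) ^+ 2.
  by apply: eq_bigr => i _; rewrite inner_mxl Pis xr.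
move: F; rewrite E => F.
have q1 : qform Pi z <= sqnorm z by exact: projection_contracts.
have : n%:R * a * (sqnorm z - qform Pi z) <= n%:R * (sqnorm z - qform Pi z).
  by rewrite ler_wpM2r ?subr_ge0// ler_piMr// ltW.
rewrite mulrBr; lra.
Qed.

Let na0 : 0 < n%:R * a. Proof. by have /andP[a0 _] := a01; rewrite mulr_gt0. Qed.

Lemma reg_gram_ker (z : 'cV[R]_d) : B *m z = 0 -> z = 0.
Proof.
move=> Bz; apply: sqnorm_eq0; apply/eqP; rewrite eq_le sqnorm_ge0 andbT.
by have := reg_gram_ge z; rewrite Bz /inner mulmx0 mxE pmulr_rle0.
Qed.

Lemma reg_gram_det : \det B != 0.
Proof.
apply/negP => /det0P[u u0 uB].
have : B *m u^T = 0 by rewrite -[B]reg_gram_sym -trmx_mul uB trmx0.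
move/reg_gram_ker => /(congr1 trmx); rewrite trmxK trmx0 => uE.
by rewrite uE eqxx in u0.
Qed.

Lemma reg_gramK : B *m Binv = 1%:M.
Proof.
rewrite /Binv /reg_inv -scalemxAr mul_mx_adj scale_scalar_mx mulVf//.
exact: reg_gram_det.
Qed.

Lemma reg_invK : Binv *m B = 1%:M.
Proof. exact: mulmx1C reg_gramK. Qed.

Lemma reg_inv_sym : Binv^T = Binv.
Proof.
have : Binv^T *m B = 1%:M by rewrite -[B in LHS]reg_gram_sym -trmx_mul reg_gramK trmx1.
by move=> H; rewrite -[LHS]mulmx1 -reg_gramK mulmxA H mul1mx.
Qed.

(** For [u = B z], [n a |z|^2 <= <z, u>] and Cauchy-Schwarz give
   [n a <z, u> <= |u|^2]. *)
Lemma reg_inv_form_le (u : 'cV[R]_d) : inner (Binv *m u) u <= sqnorm u / (n%:R * a).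
Proof.
set z := Binv *m u.
have Bz : B *m z = u by rewrite /z mulmxA reg_gramK mul1mx.
have H := reg_gram_ge z; rewrite Bz in H.
have zu0 : 0 <= inner z u by apply: le_trans H; rewrite mulr_ge0 ?sqnorm_ge0// ltW.
have [->|zu] := eqVneq (inner z u) 0; first by rewrite divr_ge0 ?sqnorm_ge0// ltW.
have zup : 0 < inner z u by rewrite lt0r zu.
rewrite ler_pdivlMr// -(ler_pM2l zup).
have := inner_sq_le z u; have := ler_wpM2r (sqnorm_ge0 u) H.
have -> : n%:R * a * sqnorm z * sqnorm u = n%:R * a * (sqnorm z * sqnorm u) by ring.
move=> H1 H2; have := ler_wpM2l (ltW na0) H2; rewrite expr2; lra.
Qed.

(** The left-hand side is the trace of [B^{-1} (sum x_i x_i^T) B^{-1}], and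
   [sum x_i x_i^T <= B]: it is at most the trace of [B^{-1}]. *)
Lemma reg_inv_frob_le : \sum_i sqnorm (Binv *m x i) <= d%:R / (n%:R * a).
Proof.
pose e k : 'cV[R]_d := delta_mx k ord0.
have eE k (u : 'cV[R]_d) : inner u (e k) = u k ord0.
  rewrite innerE (bigD1 k)//= mxE !eqxx mulr1 big1 ?addr0// => j jk.
  by rewrite mxE (negbTE jk) mulr0.
have e1 k : sqnorm (e k) = 1 by rewrite sqnormE eE mxE !eqxx.
have -> : \sum_i sqnorm (Binv *m x i) = \sum_k \sum_i inner (Binv *m e k) (x i) ^+ 2.
  rewrite exchange_big /=; apply: eq_bigr => i _; apply: eq_bigr => k _.
  by rewrite inner_mxl reg_inv_sym innerC eE.
have -> : d%:R / (n%:R * a) = \sum_(k < d) (n%:R * a)^-1.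
  by rewrite sumr_const card_ord mulr_natl.
apply: ler_sum => k _.
have := reg_inv_form_le (e k); rewrite e1 mul1r; apply: le_trans.
have Be : B *m (Binv *m e k) = e k by rewrite mulmxA reg_gramK mul1mx.
rewrite -[X in inner _ X]Be reg_gram_form lerDl mulr_ge0 ?(ltW nR)// subr_ge0.
exact: projection_contracts.
Qed.

Lemma reg_inv_solve (v w : 'cV[R]_d) : Pi *m v = v ->
  \sum_i inner v (x i) *: x i = w -> v = Binv *m w.
Proof.
move=> vr <-; have : B *m v = \sum_i inner v (x i) *: x i.
  by rewrite reg_gram_mul vr subrr scaler0 addr0.
by move=> <-; rewrite mulmxA reg_invK mul1mx.
Qed.

End RegularizedGram.

(** * Noise independent of the design *)

Section IndependentNoise.
Context {disp : measure_display} {T : measurableType disp} {R : realType}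
  (P : probability T R) {d n : nat}.
Variables (X : {RV P >-> d.-tuple R}) (Y : {RV P >-> R})
  (Xs : 'I_n -> {RV P >-> d.-tuple R}) (Ys : 'I_n -> {RV P >-> R})
  (thetastar : d.-tuple R) (S : 'M[R]_d) (kappa C : R)
  (thetahat : {RV P >-> d.-tuple R}).
Hypothesis LS : least_squares X Y Xs Ys thetastar S kappa C thetahat.
Variables (eta : {RV P >-> R}) (sigma : R).
Hypothesis YE : forall w, Y w = dot thetastar (X w) + eta w.
Hypothesis ind : independent2 P eta X.
Hypothesis eta0 : 'E_P[eta] = 0%E.
Hypothesis eta2 : 'E_P[fun w => eta w ^+ 2] = (sigma ^+ 2)%:E.

Let meta : measurable_fun setT eta := measurable_funPT eta.
Let mX : measurable_fun setT X := measurable_funPT X.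
Let res := residual thetastar.
Let Z0 w := (X w, Y w).
Let Z i w := (Xs i w, Ys i w).
Let mZ i : measurable_fun setT (Z i) := measurable_sample Xs Ys i.
Let mZ0 : measurable_fun setT Z0 := measurable_pairXY X Y.
Let mres : measurable_fun setT res := measurable_residual thetastar.
Let etas i w := res (Z i w).

Let resE w : res (Z0 w) = eta w.
Proof. by rewrite /res /residual /= YE addrC addKr. Qed.

Let Ieta2 : intg P (fun w => eta w ^+ 2) /\ (\int[P]_w (eta w ^+ 2))%R = sigma ^+ 2.
Proof.
have E : (\int[P]_w (eta w ^+ 2)%:E = (sigma ^+ 2)%:E)%E by have := eta2; rewrite unlock.
have I : intg P (fun w => eta w ^+ 2).
  apply: ge0_intg; first exact: measurable_funX.
  - by move=> w; exact: sqr_ge0.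
  - by rewrite E ltry.
by split=> //; apply: EFin_inj; rewrite EFin_Rint.
Qed.

Let Ieta : intg P eta /\ (\int[P]_w (eta w))%R = 0.
Proof.
have I : intg P eta by apply: intg_sq => //; exact: Ieta2.1.
by split=> //; apply: EFin_inj; rewrite EFin_Rint//; have := eta0; rewrite unlock.
Qed.

(** The noise factors out, and the whitened design has second moment at most [d]. *)
Lemma noise_level_le : C <= sigma ^+ 2 * d%:R.
Proof.
have [I <-] := noise_level_Rint LS.
have mN : measurable_fun setT (fun u => nrm2 (whiten S u)).
  by apply: measurable_sum => j; apply: measurable_funX; exact: measurable_whiten.
have mNX : measurable_fun setT (fun w => nrm2 (whiten S (X w))) by exact: (measurableT_comp mN mX).
have EN : (\int[P]_w (nrm2 (whiten S (X w)))%:E <= d%:R%:E)%E.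
  rewrite /nrm2 ge0_Eint_sum.
  - apply: (@le_trans _ _ (\sum_(j < d) 1%:E)%E).
      apply: lee_sum => j _.
      exact: (whitened_coord_second_moment (ls_X2 LS) (ls_sqrt LS)).
    by rewrite sumEFin sumr_const card_ord.
  - move=> j; apply: measurable_funX.
    exact: measurableT_comp (measurable_whiten S j) mX.
  - by move=> j w; exact: sqr_ge0.
have [IN EN'] := ge0_Rint_lt mNX (fun w => nrm2_ge0 _) EN.
have mx2 : measurable_fun setT (fun r : R => r ^+ 2) by apply: measurable_funX.
have [_ E] := indep_Rint meta mX ind mx2 mN Ieta2.1 IN.
rewrite (@Rint_eq _ _ _ P _ (fun w => eta w ^+ 2 * nrm2 (whiten S (X w)))); last first.
  by move=> w; rewrite -[residual _ _]/(res (Z0 w)) resE.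
rewrite E Ieta2.2; apply: ler_wpM2l EN'; exact: sqr_ge0.
Qed.

Let etat w : n.-tuple R := [tuple etas i w | i < n].
Let W w : n.-tuple (d.-tuple R) := [tuple Xs i w | i < n].

Let metas i : measurable_fun setT (etas i). Proof. exact: measurableT_comp (mZ i). Qed.

Let metat : measurable_fun setT etat.
Proof.
apply/measurable_fun_tnthP => i.
by rewrite (_ : _ \o _ = etas i)//; apply/funext => w; rewrite /= tnth_mktuple.
Qed.

Let mW : measurable_fun setT W.
Proof.
apply/measurable_fun_tnthP => i.
by rewrite (_ : _ \o _ = Xs i)//; apply/funext => w; rewrite /= tnth_mktuple.
Qed.

Let box_indep (A : 'I_n -> set R) (B : 'I_n -> set (d.-tuple R)) :
  (forall i, measurable (A i)) -> (forall i, measurable (B i)) ->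
  (P (etat @^-1` box A `&` W @^-1` box B) =
   \prod_(i < n) (P (eta @^-1` A i) * P (X @^-1` B i)))%E.
Proof.
move=> mA mB.
pose D i : set (d.-tuple R * R) := res @^-1` A i `&` fst @^-1` B i.
have mD i : measurable (D i).
  apply: measurableI; first exact: measurable_preimage mres (mA i).
  exact: measurable_preimage measurable_fst (mB i).
have -> : etat @^-1` box A `&` W @^-1` box B = \bigcap_(i in [set: 'I_n]) (Z i @^-1` D i).
  apply/seteqP; split=> w /=.
    move=> [HA HB] i _; have := HA i; have := HB i.
    by rewrite !tnth_mktuple.
  move=> H; split=> i; have [] := H i I; rewrite /= tnth_mktuple//.
rewrite (ls_indep LS)//; apply: eq_bigr => i _.
rewrite (ls_law LS i)// -ind//; congr (P _).
apply/seteqP; split=> w /=.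
  by move=> [] /=; rewrite -[res _]/(res (Z0 w)) resE.
by move=> [h1 h2]; split=> //=; rewrite -[res _]/(res (Z0 w)) resE.
Qed.

(** On boxes the product rule is that of the sample, factor by factor; the two
   tuples are then extended to all events one after the other. *)
Lemma noise_design_indep : independent2 P etat W.
Proof.
have PT1 (V : {RV P >-> R}) : P (V @^-1` setT) = 1%E.
  by rewrite preimage_setT; exact: probability_setT.
have PT2 (V : {RV P >-> d.-tuple R}) : P (V @^-1` setT) = 1%E.
  by rewrite preimage_setT; exact: probability_setT.
have box1 A : (forall i, measurable (A i)) ->
    P (etat @^-1` box A) = (\prod_(i < n) P (eta @^-1` A i))%E.
  move=> mA; have := @box_indep A (fun=> setT) mA (fun=> measurableT).
  rewrite box_setT preimage_setT setIT => ->.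
  by apply: eq_bigr => i _; rewrite [X in (_ * X)%E]PT2 mule1.
have box2 B : (forall i, measurable (B i)) ->
    P (W @^-1` box B) = (\prod_(i < n) P (X @^-1` B i))%E.
  move=> mB; have := @box_indep (fun=> setT) B (fun=> measurableT) mB.
  rewrite box_setT preimage_setT setTI => ->.
  by apply: eq_bigr => i _; rewrite [X in (X * _)%E]PT1 mul1e.
move=> A B mA mB.
apply: (indep_event_tuple metat) => //; first exact: measurable_preimage mW mB.
move=> A' mA'; rewrite setIC muleC.
apply: (indep_event_tuple mW) => //.
  exact: measurable_preimage metat (measurable_box mA').
by move=> B' mB'; rewrite setIC box_indep// box1// box2// big_split /= muleC.
Qed.

Let Iprod i j : intg P (fun w => etas i w * etas j w) /\
  (\int[P]_w (etas i w * etas j w))%R = (i == j)%:R * sigma ^+ 2.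
Proof.
have m2 : measurable_fun setT (fun u => res u ^+ 2) by exact: measurable_funX.
have E1 : (fun w => res (Z0 w)) = eta by apply/funext.
have E2 : (fun w => res (Z0 w) ^+ 2) = (fun w => eta w ^+ 2).
  by apply/funext => w; rewrite resE.
have [<-|ij] := eqVneq i j.
  have [I E] := same_law_Rint (mZ i) mZ0 (ls_law LS i) m2 (eq_ind_r (intg P) Ieta2.1 E2).
  split; first by rewrite (_ : (fun w => _) = fun w => res (Z i w) ^+ 2).
  rewrite mul1r -Ieta2.2 -(@Rint_eq _ _ _ P _ _ (fun w => congr1 (fun r => r ^+ 2) (resE w))).
  by rewrite -E; apply: Rint_eq => w; rewrite -expr2.
have [I1 F1] := same_law_Rint (mZ i) mZ0 (ls_law LS i) mres (eq_ind_r (intg P) Ieta.1 E1).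
have [I2 F2] := same_law_Rint (mZ j) mZ0 (ls_law LS j) mres (eq_ind_r (intg P) Ieta.1 E1).
have [I3 F3] := indep_Rint (mZ i) (mZ j)
  (mutually_independent_pair (ls_indep LS) ij) mres mres I1 I2.
split=> //; rewrite F3 F1 mul0r (@Rint_eq _ _ _ P _ _ resE).
by rewrite Ieta.2 mul0r.
Qed.

(** The conditional covariance of the noise given the design is [sigma^2] times the
   identity, tested against functions of the design. *)
Let prod_design i j (h : n.-tuple (d.-tuple R) -> R) : measurable_fun setT h ->
  intg P (fun w => h (W w)) ->
  intg P (fun w => etas i w * etas j w * h (W w)) /\
  (\int[P]_w (etas i w * etas j w * h (W w)))%R =
    (i == j)%:R * sigma ^+ 2 * (\int[P]_w h (W w))%R.
Proof.
move=> mh hi; pose f (t : n.-tuple R) := tnth t i * tnth t j.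
have mf : measurable_fun setT f.
  by apply: measurable_funM; exact: measurable_tnth.
have fE w : f (etat w) = etas i w * etas j w by rewrite /f !tnth_mktuple.
have FE : (fun w => f (etat w)) = (fun w => etas i w * etas j w) by exact/funext.
have [I0 E0] := Iprod i j.
have If : intg P (fun w => f (etat w)) by rewrite FE.
have [I1 E1] := indep_Rint metat mW noise_design_indep mf mh If hi.
have FE' : (fun w => f (etat w) * h (W w)) = (fun w => etas i w * etas j w * h (W w)).
  by apply/funext => w; rewrite fE.
by rewrite -FE' -E0 -FE.
Qed.

Let excess := excess_risk P X Y thetastar thetahat.
Let G := gram P X.
Let Pi := range_proj G S.
Let GS : is_pinv_sqrt G S := ls_sqrt LS.
Let xc (t : n.-tuple (d.-tuple R)) (i : 'I_n) : 'cV[R]_d := S *m vec (tnth t i).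
Let b t i : 'cV[R]_d := reg_inv Pi (xc t) *m xc t i.
Let g i j t := inner (b t i) (b t j).

Let measurable_entry (F : n.-tuple (d.-tuple R) -> 'cV[R]_d) :=
  forall j, measurable_fun setT (fun t => F t j ord0).

Let mxc i : measurable_entry (fun t => xc t i).
Proof.
move=> j; apply: (measurableT_comp (measurable_whiten S j)).
exact: measurable_tnth.
Qed.

Lemma measurable_det (m : nat) d' (T' : measurableType d') (A : T' -> 'M[R]_m) :
  (forall i j, measurable_fun setT (fun t => A t i j)) ->
  measurable_fun setT (fun t => \det (A t)).
Proof.
move=> mA; rewrite (_ : (fun t => _) = fun t =>
  \sum_(s : {perm 'I_m}) (-1) ^+ s * \prod_i A t i (s i)); last by apply/funext.
apply: measurable_sum => s; apply: measurable_funM => //.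
by apply: measurable_prod => i _.
Qed.

(** [x^-1 = x (x^2)^-1], where the inverse of a nonnegative number is a power. *)
Lemma measurable_funV d' (T' : measurableType d') (f : T' -> R) :
  measurable_fun setT f -> measurable_fun setT (fun t => (f t)^-1).
Proof.
move=> mf; rewrite (_ : (fun t => _) = fun t => f t * (f t ^+ 2) `^ (-1)).
  apply: measurable_funM => //; apply: (@measurableT_comp _ _ _ _ _ _ (fun r : R => r `^ (-1))).
    exact: measurable_powR.
  exact: measurable_funX.
apply/funext => t; rewrite powR_inv1 ?sqr_ge0//.
have [->|f0] := eqVneq (f t) 0; first by rewrite invr0 mul0r.
by rewrite expr2 invfM mulrA mulfV// mul1r.
Qed.

Let mreg j k : measurable_fun setT (fun t => reg_inv Pi (xc t) j k).
Proof.
have mB j' k' : measurable_fun setT (fun t => reg_gram Pi (xc t) j' k').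
  rewrite (_ : (fun t => _) = fun t => \sum_i xc t i j' ord0 * xc t i k' ord0
      + (n%:R *: (1%:M - Pi)) j' k'); last first.
    apply/funext => t; rewrite /reg_gram mxE summxE; congr (_ + _).
    by apply: eq_bigr => i _; rewrite mxE big_ord1 [X in _ * X]mxE.
  apply: measurable_funD => //; apply: measurable_sum => i.
  by apply: measurable_funM; exact: mxc.
rewrite (_ : (fun t => _) = fun t => (\det (reg_gram Pi (xc t)))^-1 *
    ((-1) ^+ (k + j) * \det (row' k (col' j (reg_gram Pi (xc t)))))); last first.
  by apply/funext => t; rewrite /reg_inv mxE [in X in _ * X]mxE.
apply: measurable_funM.
  by apply: measurable_funV; exact: measurable_det.
apply: measurable_funM => //; apply: measurable_det => j' k'.
rewrite (_ : (fun t => _) = fun t => reg_gram Pi (xc t) (lift k j') (lift j k'))//.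
by apply/funext => t; rewrite !mxE.
Qed.

Let mg i j : measurable_fun setT (g i j).
Proof.
have mb k : measurable_entry (fun t => b t k).
  move=> l; rewrite (_ : (fun t => _) = fun t =>
    \sum_m reg_inv Pi (xc t) l m * xc t k m ord0); last first.
    by apply/funext => t; rewrite /b mxE.
  by apply: measurable_sum => m; apply: measurable_funM => //; exact: mxc.
rewrite (_ : g i j = fun t => \sum_l b t i l ord0 * b t j l ord0); last first.
  by apply/funext => t; rewrite /g innerE.
by apply: measurable_sum => l; apply: measurable_funM; exact: mb.
Qed.

Section OnTheFrameEvent.
Variables (m0 : ('I_n -> 'I_d -> R) -> R) (c a : R).
Hypothesis mm0 : measurable_statistic m0.
Hypothesis a01 : 0 < a <= 1.
Hypothesis frame : forall xs v, m0 xs <= c -> in_range X S v ->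
  n%:R * a * sqnorm v <= \sum_i lin (v ^~ ord0) (xs i) ^+ 2.

Let des (t : n.-tuple (d.-tuple R)) : 'I_n -> 'I_d -> R := fun i => whiten S (tnth t i).
Let off_range t := \sum_i sqnorm (Pi *m xc t i - xc t i).
(** The confidence event, as a set of designs; being in the range is an almost sure
   property, imposed through a measurable function. *)
Let K : set (n.-tuple (d.-tuple R)) := [set t | m0 (des t) <= c] `&` [set t | off_range t <= 0].

Let mK : measurable K.
Proof.
apply: measurableI; apply: measurable_level.
  apply: mm0 => i j; apply: (measurableT_comp (measurable_whiten S j)).
  exact: measurable_tnth.
apply: measurable_sum => i; apply: measurable_sum => j; apply: measurable_funX.
rewrite (_ : (fun t => _) = fun t => \sum_k Pi j k * xc t i k ord0 - xc t i j ord0).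
  apply: measurable_funB; last exact: mxc.
  by apply: measurable_sum => k; apply: measurable_funM => //; exact: mxc.
by apply/funext => t; rewrite !mxE.
Qed.

Let K_range t i : K t -> Pi *m xc t i = xc t i.
Proof.
move=> [_ /= H]; apply/eqP; rewrite -subr_eq0; apply/eqP/sqnorm_eq0.
have : off_range t = 0.
  by apply/eqP; rewrite eq_le H sumr_ge0// => j _; exact: sqnorm_ge0.
move/eqP; rewrite psumr_eq0; last by move=> j _; exact: sqnorm_ge0.
by move=> /allP/(_ i); rewrite mem_index_enum => /(_ isT)/eqP.
Qed.

Let K_frame t (v : 'cV[R]_d) : K t -> Pi *m v = v ->
  n%:R * a * sqnorm v <= \sum_i inner v (xc t i) ^+ 2.
Proof.
move=> [mt _] vr; have := frame mt vr; move/le_trans; apply.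
by apply: le_of_eq; apply: eq_bigr => i _; rewrite lin_whiten.
Qed.

Let Pis : Pi^T = Pi := range_proj_sym (gram_sym X) GS.
Let PiPi : Pi *m Pi = Pi := range_proj_idem GS.
Let n0 : (0 < n)%N := ls_size LS.
Let bnd : R := d%:R / (n%:R * a).

Let b_le t : K t -> \sum_i sqnorm (b t i) <= bnd.
Proof.
move=> Kt; apply: (reg_inv_frob_le Pis PiPi n0 a01).
- by move=> i; exact: K_range.
- by move=> v; exact: K_frame.
Qed.

Let bnd0 : 0 <= bnd.
Proof. by have /andP[a0 _] := a01; rewrite divr_ge0// mulr_ge0// ltW. Qed.

(** The normal equations are solved by the inverse of the regularized Gram matrix:
   the excess risk is a quadratic form of the noise with coefficients in the
   design. *)
Let rooterr_solve w : K (W w) -> sample_in_range X Xs S w ->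
  excess w = \sum_i \sum_j etas i w * etas j w * g i j (W w).
Proof.
move=> Kw rw; have xcW i : xc (W w) i = S *m vec (Xs i w) by rewrite /xc tnth_mktuple.
have vr : Pi *m rooterr X thetastar S thetahat w = rooterr X thetastar S thetahat w.
  exact: range_proj_gsqrt GS _.
have := rooterr_normal_equation LS rw.
rewrite (eq_bigr (fun i => inner (rooterr X thetastar S thetahat w) (xc (W w) i)
    *: xc (W w) i)); last first.
  by move=> i _; rewrite xcW.
move=> /(reg_inv_solve Pis PiPi n0 a01 (fun i => K_range i Kw)
  (fun v => @K_frame _ v Kw) vr) E.
rewrite [LHS](excessE LS) E /noisevec mulmx_sumr.
have -> : \sum_i reg_inv Pi (xc (W w))
    *m (residual thetastar (Xs i w, Ys i w) *: (S *m vec (Xs i w)))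
   = \sum_i etas i w *: b (W w) i.
  by apply: eq_bigr => i _; rewrite -scalemxAr /b xcW.
rewrite sqnormE inner_sumr.
rewrite exchange_big /=; apply: eq_bigr => i _.
rewrite innerC inner_sumr; apply: eq_bigr => j _.
by rewrite innerZr innerZl /g [inner (b _ i) _]innerC; ring.
Qed.

(** Integrating the noise out: the conditional variance of the estimator is a
   trace, bounded by the dimension over the smallest eigenvalue. *)
Lemma integral_excess_design (A : set (n.-tuple (d.-tuple R))) : measurable A ->
  (\int[P]_(w in W @^-1` (K `&` A)) (excess w)%:E <=
   (sigma ^+ 2 * bnd)%:E * P (W @^-1` (K `&` A)))%E.
Proof.
move=> mA; set KA := K `&` A; have mKA : measurable KA by exact: measurableI.
have mD : measurable (W @^-1` KA) by exact: measurable_preimage mW mKA.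
pose h i j t := \1_KA t * g i j t.
have mh i j : measurable_fun setT (h i j).
  by apply: measurable_funM => //; exact: measurable_indic.
have mhW i j : measurable_fun setT (fun w => h i j (W w)).
  exact: (measurableT_comp (mh i j) mW).
have b_i t i : K t -> sqnorm (b t i) <= bnd.
  move=> Kt; apply: le_trans (b_le Kt); rewrite (bigD1 i)//= lerDl.
  by apply: sumr_ge0 => j _; exact: sqnorm_ge0.
have h_le i j t : `|h i j t| <= bnd.
  rewrite /h indicE; have [|_] := boolP (t \in KA); last by rewrite mul0r normr0.
  rewrite inE => -[Kt _]; rewrite mul1r -ler_sqr ?nnegrE// real_normK ?num_real//.
  apply: le_trans (inner_sq_le _ _) _; rewrite expr2.
  by apply: ler_pM; rewrite ?sqnorm_ge0// b_i.
have Ih i j : intg P (fun w => h i j (W w)).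
  by apply: intg_le (intg_cst P bnd) => // w; exact: h_le.
have I2 i j := prod_design i j (mh i j) (Ih i j).
pose F w := \sum_i \sum_j etas i w * etas j w * h i j (W w).
have If i : intg P (fun w => \sum_j etas i w * etas j w * h i j (W w)).
  by apply: intg_sum => j; have [] := I2 i j.
have IF : intg P F by apply: intg_sum.
have EF : (\int[P]_w F w)%R = sigma ^+ 2 * (\int[P]_w (\sum_i h i i (W w)))%R.
  rewrite /F Rint_sum// Rint_sum// mulr_sumr; apply: eq_bigr => i _.
  rewrite Rint_sum; last by move=> j; have [] := I2 i j.
  rewrite (bigD1 i)//= big1 ?addr0; first by have [_ ->] := I2 i i; rewrite eqxx mul1r.
  by move=> j ji; have [_ ->] := I2 i j; rewrite eq_sym (negbTE ji) !mul0r.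
have mI : measurable_fun setT (fun w => \1_KA (W w) : R).
  apply: (@measurableT_comp _ _ _ _ _ _ (\1_KA : _ -> R)) mW; exact: measurable_indic.
have E1 : (\int[P]_(w in W @^-1` KA) (excess w)%:E = \int[P]_w (F w)%:E)%E.
  rewrite integral_mkcond; apply: ae_eq_integral => //.
  - apply/(measurable_restrictT _ mD); apply/measurable_EFinP.
    by apply: measurable_funTS; exact: (measurable_excess LS).
  - by apply/measurable_EFinP; exact: intg_meas IF.
  - have := ae_sample_in_range LS; apply: filterS => w rw _.
    rewrite patchE; have [|wK] := boolP (w \in W @^-1` KA).
      rewrite inE => wK; congr EFin; have [Kw _] := wK.
      rewrite (rooterr_solve Kw rw); apply: eq_bigr => i _; apply: eq_bigr => j _.
      by rewrite /h indicE mem_set// mul1r.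
    rewrite /F big1// => i _; rewrite big1// => j _.
    rewrite /h indicE; have [wK'|_] := boolP (W w \in KA); last by rewrite mul0r mulr0.
    by move: wK; rewrite notin_setE /= => /(_ (set_mem wK')).
rewrite E1 -EFin_Rint// EF EFinM.
have PD : P (W @^-1` KA) \is a fin_num by rewrite fin_num_measure.
rewrite -(fineK PD) -!EFinM lee_fin -[leRHS]mulrA; apply: ler_wpM2l; first exact: sqr_ge0.
have I1 : intg P (fun w => \1_KA (W w) : R).
  apply: intg_le (intg_cst P 1) => // w; rewrite indicE.
  by case: (_ \in _); rewrite ?normr1 ?normr0.
have -> : bnd * fine (P (W @^-1` KA)) = (\int[P]_w (bnd * \1_KA (W w)))%R.
  rewrite RintZ//; congr (_ * _); apply: EFin_inj.
  by rewrite fineK// EFin_Rint// integral_indic_comp.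
apply: Rint_le.
- by apply: intg_sum => i; exact: Ih.
- exact: intgZ.
move=> w; rewrite /h -mulr_sumr mulrC indicE.
have [|_] := boolP (W w \in KA); last by rewrite !mulr0.
rewrite inE !mulr1 => -[Kw _]; apply: le_trans (b_le Kw).
by apply: ler_sum => i _; rewrite /g -sqnormE.
Qed.

Let F_sigma : g_sigma_preimage (fun i w => Xs i w) =
  preimage_set_system setT W measurable.
Proof.
rewrite -[RHS](@g_sigma_preimage_comp _ _ n _ (fun i (t : n.-tuple (d.-tuple R)) => tnth t i) _ W).
congr (g_sigma_preimage _); apply/funext => i; apply/funext => w /=.
by rewrite tnth_mktuple.
Qed.

(** The set where [Z'] exceeds the bound is an event [A] of the design; its part on
   the confidence event is null, since [Z' - bound] is positive there and has a
   nonpositive integral. *)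
Lemma conditional_expectation_le (Z' : T -> \bar R) (e : R) :
  ((1 - e)%:E <= P [set w | (m0 (design Xs S w) <= c)%R])%E ->
  is_cond_expectation P (g_sigma_preimage (fun i w => Xs i w)) excess Z' ->
  ((1 - e)%:E <= P [set w | (Z' w <= (sigma ^+ 2 * bnd)%:E)%E])%E.
Proof.
move=> Pm [Z0' FZ EZ].
set beta := sigma ^+ 2 * bnd.
have beta0 : 0 <= beta by rewrite mulr_ge0// sqr_ge0.
have FA B : measurable B -> exists2 A, measurable A & Z' @^-1` B = W @^-1` A.
  move=> mB; have := FZ B mB; rewrite F_sigma => -[A mA].
  by rewrite setTI => <-; exists A.
have mZ' : measurable_fun setT Z'.
  move=> _ B mB; rewrite setTI; have [A mA ->] := FA B mB.
  exact: measurable_preimage mW mA.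
pose Big : set (\bar R) := [set y | (beta%:E < y)%E].
have mBig : measurable Big.
  rewrite (_ : Big = `]beta%:E, +oo[%classic); first exact: emeasurable_itv.
  by apply/seteqP; split=> y /=; rewrite in_itv /= andbT.
have [A mA AE] := FA _ mBig.
pose D := W @^-1` (K `&` A).
have mD : measurable D by exact: measurable_preimage mW (measurableI _ _ mK mA).
have FD : g_sigma_preimage (fun i w => Xs i w) D.
  by rewrite F_sigma; exists (K `&` A); [exact: measurableI|rewrite setTI].
have DB w : D w -> (beta%:E < Z' w)%E.
  by move=> [_ Aw]; have : (Z' @^-1` Big) w by rewrite AE.
have PD : P D \is a fin_num by rewrite fin_num_measure.
have IZ : (\int[P]_(w in D) Z' w <= beta%:E * P D)%E.
  by rewrite EZ//; exact: integral_excess_design.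
have PD0 : P D = 0%E.
  pose f w := (Z' w - beta%:E)%E.
  have mf : measurable_fun D f.
    apply: emeasurable_funB; first exact: measurable_funTS.
    exact: measurable_cst.
  have f0 w : D w -> (0 <= f w)%E by move=> Dw; rewrite sube_ge0 ?ltW ?DB.
  have IS : (\int[P]_(w in D) Z' w = \int[P]_(w in D) f w + beta%:E * P D)%E.
    rewrite -(integral_cst P mD beta%:E) -ge0_integralD//.
    by apply: eq_integral => w _; rewrite /f subeK.
  have If0 : (\int[P]_(w in D) f w = 0)%E.
    apply/eqP; rewrite eq_le integral_ge0// andbT.
    move: IZ; rewrite IS -(fineK PD) -EFinM.
    by rewrite -[X in (_ <= X)%E]add0e leeD2rE.
  have : (\int[P]_(w in D) `|f w| = 0)%E.
    rewrite -[RHS]If0; apply: eq_integral => w; rewrite inE => Dw.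
    by rewrite gee0_abs// f0.
  move/(ae_eq_integral_abs P mD mf) => [N [mN PN HN]].
  apply/eqP; rewrite eq_le measure_ge0 andbT -PN; apply: le_measure; rewrite ?inE//.
  move=> w Dw; apply: HN => /= /(_ Dw) fw.
  by have := DB w Dw; rewrite -sube_gt0 -/(f w) fw ltxx.
pose OK := W @^-1` K.
have mOK : measurable OK by exact: measurable_preimage mW mK.
have POK : ((1 - e)%:E <= P OK)%E.
  apply: le_trans Pm _; apply: le_of_eq.
  have mL : measurable [set w | (m0 (design Xs S w) <= c)%R].
    by apply: measurable_level; apply: mm0 => i j; exact: measurable_design.
  have [N [mN PN HN]] := ae_sample_in_range LS.
  apply/eqP; rewrite eq_le; apply/andP; split; last first.
    apply: le_measure; rewrite ?inE// => w [/= mw _].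
    by move: mw; congr (is_true (m0 _ <= c)); apply/funext => i; rewrite /des tnth_mktuple.
  apply: (@le_trans _ _ (P (OK `|` N))).
    apply: le_measure; rewrite ?inE//; first exact: measurableU.
    move=> w /= mw; have [Nw|Nw] := pselect (N w); first by right.
    left; split=> /=.
      by move: mw; congr (is_true (m0 _ <= c)); apply/funext => i; rewrite /des tnth_mktuple.
    have rw : sample_in_range X Xs S w by apply: contrapT => rw; apply: Nw; exact: HN.
    rewrite /off_range big1// => i _; rewrite /xc tnth_mktuple.
    rewrite (range_proj_whitened (rw i)) subrr /sqnorm big1// => j _.
    by rewrite mxE expr0n.
  apply: le_trans (measureU2 _ _ _) _ => //.
  by rewrite [X in (_ + X)%E](_ : _ = 0%E) ?adde0//; exact: PN.
have mG : measurable [set w | (Z' w <= beta%:E)%E].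
  rewrite (_ : [set w | _] = ~` (Z' @^-1` Big)).
    by apply: measurableC; exact: measurable_preimage mZ' mBig.
  by apply/seteqP; split=> w /=; rewrite /Big /= ltNge; [move=> ->|move/negP/negPn].
apply: le_trans POK _.
apply: (@le_trans _ _ (P ([set w | (Z' w <= beta%:E)%E] `|` D))).
  apply: le_measure; rewrite ?inE//; first exact: measurableU.
  move=> w OKw; have [h|h] := leP (Z' w) beta%:E; first by left.
  right; split=> //; have : (Z' @^-1` Big) w by [].
  by rewrite AE.
apply: le_trans (measureU2 _ _ _) _ => //.
by rewrite [X in (_ + X)%E](_ : _ = 0%E) ?adde0.
Qed.

End OnTheFrameEvent.

End IndependentNoise.

(** * Explicit rates *)

Section ExplicitBounds.
Context {R : realType}.
Implicit Types kappa eps m : R.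

Definition size_const m : R := 800 + 4 * (5 / 2 + 1 / (2 * m)) ^+ 2.

Definition rate_const m : R := (100 * 100 + 2 / m) / m ^+ 2.

(** The factor 64 is what [neps_truncation_lt] needs to absorb a logarithm. *)
Definition degenerate_const m : R := 64 * size_const m ^+ 2 + rate_const m.

Lemma size_const_ge1 m : 1 <= size_const m.
Proof. by rewrite /size_const; have := sqr_ge0 (5 / 2 + 1 / (2 * m)); lra. Qed.

Lemma rate_const_ge0 m : 0 < m -> 0 < rate_const m.
Proof. by move=> m0; rewrite divr_gt0 ?exprn_gt0// addr_gt0// divr_gt0. Qed.

Lemma size_const_le m : 0 < m -> size_const m <= degenerate_const m.
Proof.
move=> m0; have := size_const_ge1 m; have := rate_const_ge0 m0.
rewrite /degenerate_const; set u := size_const m; set v := rate_const m.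
by clear; nra.
Qed.

Lemma conf_bounds (d : nat) eps : 0 <= ln eps^-1 ->
  0 <= conf d eps <= d%:R + ln eps^-1.
Proof. by move=> l0; rewrite /conf; have := ler0n R d; lra. Qed.

(** Expanding the square; [kappa - 1] is bounded below by [m] in the inverse and
   above by [kappa] in the square root. *)
Lemma neps_le kappa m eps (d : nat) : 0 < m -> 1 + m <= kappa -> 0 <= ln eps^-1 ->
  neps kappa d eps <= size_const m * (kappa * (d%:R + ln eps^-1)).
Proof.
move=> m0 mk l0; have /andP[L0 LU] := conf_bounds d l0.
rewrite /neps /size_const.
have d0 := ler0n R d; set t := d%:R + ln eps^-1 in LU *.
have k0 : 0 < kappa - 1 by lra.
have kd : 0 <= kappa * d%:R by apply: mulr_ge0 => //; lra.
have kL : 0 <= 2 * (kappa - 1) * conf d eps by apply: mulr_ge0 => //; lra.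
set a := Num.sqrt _; set b := Num.sqrt _.
have a2 : a ^+ 2 = kappa * d%:R by rewrite sqr_sqrtr.
have b2 : b ^+ 2 = 2 * (kappa - 1) * conf d eps by rewrite sqr_sqrtr.
set B := 5 / 2 + 1 / (2 * (kappa - 1)); set B' := 5 / 2 + 1 / (2 * m).
have BB : B ^+ 2 <= B' ^+ 2.
  have i0 : 0 <= 1 / (2 * (kappa - 1)) by rewrite divr_ge0//; lra.
  have ii : 1 / (2 * (kappa - 1)) <= 1 / (2 * m).
    by rewrite ler_pM2l// lef_pV2 ?posrE; lra.
  by apply: lerXn2r; rewrite ?nnegrE /B /B'; lra.
have h : (20 * a + B * b) ^+ 2 <= 800 * a ^+ 2 + 2 * (B ^+ 2 * b ^+ 2).
  by have := sqr_ge0 (20 * a - B * b); clear; rewrite !expr2; lra.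
apply: le_trans h _; rewrite a2 b2.
have kt : kappa * d%:R <= kappa * t by apply: ler_wpM2l; rewrite /t; lra.
have kLt : 2 * (kappa - 1) * conf d eps <= 2 * (kappa * t).
  by rewrite -mulrA ler_pM2l//; apply: ler_pM; lra.
have := ler_pM (sqr_ge0 B) kL BB kLt; lra.
Qed.

(** [kappa ln (n / kappa)] is at most [2 sqrt (kappa n)], which the condition on [n]
   makes a small fraction of [n]: this absorbs the [ln n] hidden in the
   confidence parameter [C / (M n^2)]. *)
Lemma neps_truncation_lt kappa m C M (d n : nat) : 0 < m -> 1 + m <= kappa ->
  0 < C -> C <= M -> (0 < d)%N -> (0 < n)%N ->
  degenerate_const m * (kappa * (d%:R + ln (kappa * M / C))) < n%:R ->
  neps kappa d (C / (M * n%:R ^+ 2)) < n%:R.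
Proof.
move=> m0 mk C0 CM d0 n0.
have M0 : 0 < M by exact: lt_le_trans CM.
have dR : 1 <= d%:R :> R by rewrite ler1n.
have nR : 1 <= n%:R :> R by rewrite ler1n.
have n0R : 0 < n%:R :> R by lra.
have k0 : 0 < kappa by lra.
have lMC : 0 <= ln (M / C) by rewrite ln_ge0// ler_pdivlMr// mul1r.
have lk : 0 <= ln kappa by rewrite ln_ge0//; lra.
have ln0 : 0 <= ln (n%:R : R) by exact: ln_ge0.
have MC0 : 0 < M / C by rewrite divr_gt0.
have epsE : ln (C / (M * n%:R ^+ 2))^-1 = ln (M / C) + 2 * ln n%:R.
  have -> : (C / (M * n%:R ^+ 2))^-1 = M / C * n%:R ^+ 2.
    by field; rewrite !gt_eqF.
  by rewrite lnM ?posrE ?exprn_gt0// lnXn// mulr_natl.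
have -> : ln (kappa * M / C) = ln kappa + ln (M / C) by rewrite -mulrA lnM ?posrE.
set A := kappa * _ => Hn.
have kA : kappa <= A by rewrite /A ler_peMr; lra.
have A0 : 0 < A by lra.
have eps0 : 0 <= ln (C / (M * n%:R ^+ 2))^-1 by rewrite epsE; lra.
apply: le_lt_trans (neps_le d m0 mk eps0) _; rewrite epsE.
set u := size_const m in Hn *; have u1 : 1 <= u := size_const_ge1 m.
have Hu : 64 * u ^+ 2 * A < n%:R.
  apply: le_lt_trans Hn; rewrite ler_pM2r// /degenerate_const.
  by rewrite -/u; have := rate_const_ge0 m0; lra.
pose r : R := Num.sqrt (kappa * n%:R).
have r0 : 0 <= r by exact: sqrtr_ge0.
have r2 : r ^+ 2 = kappa * n%:R by rewrite sqr_sqrtr// mulr_ge0// ltW.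
have lnk : kappa * ln n%:R <= kappa * ln kappa + 2 * r.
  have -> : ln (n%:R : R) = ln kappa + ln (n%:R / kappa).
    by rewrite -lnM ?posrE ?divr_gt0//; congr ln; field; rewrite gt_eqF.
  rewrite mulrDr lerD2l.
  have := ln_le_2sqrt (divr_gt0 n0R k0); rewrite -(ler_pM2l k0).
  move/le_trans; apply; rewrite mulrCA ler_pM2l//.
  rewrite -ler_sqr ?nnegrE ?mulr_ge0 ?sqrtr_ge0 ?(ltW k0)//.
  rewrite exprMn sqr_sqrtr ?divr_ge0 ?(ltW k0)// r2; apply: le_of_eq.
  by field; rewrite gt_eqF.
have ru : 8 * u * r < n%:R.
  rewrite -ltr_sqr ?nnegrE; [|by rewrite !mulr_ge0//; lra|by lra].
  have -> : (8 * u * r) ^+ 2 = 64 * u ^+ 2 * kappa * n%:R by rewrite !exprMn r2; ring.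
  rewrite [ltRHS]expr2 ltr_pM2r//; apply: le_lt_trans Hu.
  by rewrite ler_pM2l// mulr_gt0// exprn_gt0//; lra.
have step : kappa * (d%:R + (ln (M / C) + 2 * ln n%:R)) <= 2 * A + 4 * r.
  have kd : 0 <= kappa * d%:R by rewrite mulr_ge0// ltW.
  have kl : 0 <= kappa * ln (M / C) by rewrite mulr_ge0// ltW.
  by rewrite /A !mulrDr; lra.
have u0 : 0 < u by lra.
apply: (@le_lt_trans _ _ (u * (2 * A + 4 * r))); first by rewrite ler_pM2l.
have uA : 64 * (u * A) <= 64 * u ^+ 2 * A.
  by rewrite -mulrA ler_pM2l// expr2 -mulrA ler_peMl//; nra.
have uA0 : 0 < u * A by rewrite mulr_gt0.
by rewrite mulrDr; lra.
Qed.

Lemma gammam_ge0 kappa eps (d n : nat) : 1 < kappa -> 0 <= ln eps^-1 ->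
  0 <= gammam kappa d n eps.
Proof.
move=> k1 l0; have /andP[L0 _] := conf_bounds d l0.
by rewrite /gammam divr_ge0 ?mulr_ge0//; lra.
Qed.

(** Below 1, [gammam] is at most its square root, which is of the order of the
   rate; [mu_] is of that order directly. *)
Lemma excess_ratio_le kappa m eps (d n : nat) : 0 < m -> 1 + m <= kappa ->
  (0 < n)%N -> 0 <= ln eps^-1 ->
  0 <= mu_ kappa d n eps <= 483 / 1000 -> gammam kappa d n eps <= 1 - m ->
  (1 + deltahat kappa d n eps) ^+ 2 / (1 - gammam kappa d n eps) ^+ 2
    <= 1 + degenerate_const m * Num.sqrt (kappa * (d%:R + ln eps^-1) / n%:R).
Proof.
move=> m0 mk n0 l0 /andP[mu0 mu1] gm.
have k1 : 1 < kappa by lra.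
have g0 := gammam_ge0 d n k1 l0.
have /andP[L0 LU] := conf_bounds d l0.
have n0R : 0 < n%:R :> R by rewrite ltr0n.
have dR := ler0n R d.
set t := d%:R + ln eps^-1 in LU *.
have kt : 0 <= kappa * t by apply: mulr_ge0; rewrite /t; lra.
have q0 : 0 <= kappa * t / n%:R by rewrite divr_ge0// ltW.
set r := Num.sqrt _; have r0 : 0 <= r by exact: sqrtr_ge0.
have r2 : r ^+ 2 = kappa * t / n%:R by rewrite sqr_sqrtr.
have r4 : 0 <= 4 * (kappa * t / n%:R) by lra.
have s4 : Num.sqrt (4 * (kappa * t / n%:R)) = 2 * r.
  by apply: sqrtr_eq; [lra|rewrite exprMn r2; lra].
have mur : mu_ kappa d n eps <= 16 * r.
  have a1 : Num.sqrt (2 * (kappa - 1) / n%:R * conf d eps) <= 2 * r.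
    rewrite -s4 ler_sqrt//.
    have -> : 2 * (kappa - 1) / n%:R * conf d eps =
      2 * ((kappa - 1) * conf d eps) / n%:R by ring.
    rewrite [leRHS]mulrA ler_pM2r ?invr_gt0//.
    have : (kappa - 1) * conf d eps <= kappa * t by apply: ler_pM; clear -k1 L0 LU; lra.
    by move: kt; clear; lra.
  have a2 : Num.sqrt (2 * kappa * d%:R / n%:R) <= 2 * r.
    rewrite -s4 ler_sqrt// [leRHS]mulrA ler_pM2r ?invr_gt0//.
    have : kappa * d%:R <= kappa * t by apply: ler_wpM2l; rewrite /t; clear -k1 l0; lra.
    have : 0 <= kappa * d%:R by apply: mulr_ge0; clear -k1 dR; lra.
    by clear; lra.
  by rewrite /mu_; lra.
set g := gammam _ _ _ _ in g0 gm *; set mu := mu_ _ _ _ _ in mu0 mu1 mur.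
rewrite /deltahat -/mu; set de := mu / _.
have p0 : 0 < 1 - 2 * mu by lra.
have de0 : 0 <= de by rewrite divr_ge0// ltW.
have de1 : de <= 15 by rewrite ler_pdivrMr//; clear -mu1; lra.
have de2 : de <= 30 * mu.
  rewrite ler_pdivrMr// [30 * mu]mulrC -mulrA ler_peMr//; clear -mu0 mu1; lra.
have x1 : (1 + de) ^+ 2 <= 1 + 100 * 90 * r.
  have : de * de <= 15 * de by rewrite ler_wpM2r.
  by rewrite sqrrD expr1n mul1r expr2; clear -de2 mur r0; lra.
have gr : g <= r * (1 / m).
  have gE : g * m <= r ^+ 2.
    rewrite r2 /g /gammam.
    have -> : 2 * conf d eps / (3 * (kappa - 1) * n%:R) * m =
      2 / 3 * conf d eps * (m / (kappa - 1)) / n%:R.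
      by field; rewrite !gt_eqF// subr_gt0.
    rewrite ler_pM2r ?invr_gt0//.
    apply: (@le_trans _ _ (t * 1)); last by rewrite mulr1 ler_peMl; rewrite /t; clear -k1 l0 dR; lra.
    apply: ler_pM; [|rewrite divr_ge0//| |rewrite ler_pdivrMr];
      by clear -L0 LU m0 mk; lra.
  have gm0 : 0 <= g * m := mulr_ge0 g0 (ltW m0).
  have : (g * m) ^+ 2 <= r ^+ 2.
    apply: le_trans gE; rewrite expr2 ler_piMr//.
    by rewrite mulr_ile1// ?(ltW m0)//; clear -g0 gm m0; lra.
  rewrite ler_sqr ?nnegrE// => h.
  by rewrite mulrA mulr1 ler_pdivlMr.
have g1 : m <= 1 - g by clear -gm; lra.
have w0 : 0 < 1 - g by clear -g1 m0; lra.
have w2 : m ^+ 2 <= (1 - g) ^+ 2 by apply: lerXn2r; rewrite ?nnegrE; clear -g1 m0 w0; lra.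
have m2 : 0 < m ^+ 2 by exact: exprn_gt0.
have rate : (1 + de) ^+ 2 / (1 - g) ^+ 2 <= 1 + rate_const m * r.
  rewrite ler_pdivrMr ?exprn_gt0// mulrDl mul1r.
  have h1 : (100 * 100 + 2 / m) * r <= rate_const m * r * (1 - g) ^+ 2.
    rewrite /rate_const; set Q := _ + _.
    have Q0 : 0 <= Q * r by rewrite mulr_ge0// addr_ge0// divr_ge0// ltW.
    rewrite (_ : Q / m ^+ 2 * r * (1 - g) ^+ 2 = Q * r * ((1 - g) ^+ 2 / m ^+ 2)).
      by rewrite ler_peMr// ler_pdivlMr// mul1r.
    by field; rewrite gt_eqF.
  have g2 : 1 - 2 * g <= (1 - g) ^+ 2 by rewrite -subr_ge0; have := sqr_ge0 g; lra.
  have e : (100 * 100 + 2 / m) * r = 100 * 100 * r + 2 * (r * (1 / m)) by ring.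
  lra.
apply: le_trans rate _; rewrite lerD2l ler_wpM2r// /degenerate_const.
by have := sqr_ge0 (size_const m); lra.
Qed.

End ExplicitBounds.

(** * Risk bounds for least squares *)

(* c0 is a numerical constant. The constants c m are uniform over all kappa at
   distance at least m from 1 and, where a clause assumes it, gammam at
   distance at least m below 1: those estimates degenerate as kappa tends to 1
   or gammam tends to 1, so no numerical constant exists for them. *)
Theorem proposition4p10 (R : realType) :
  exists (c0 : R) (c : R -> R),
  0 < c0 /\ (forall m, 0 < m -> 0 < c m) /\
  forall (disp : measure_display) (T : measurableType disp)
    (P : probability T R) (d n : nat)
    (X : {RV P >-> d.-tuple R}) (Y : {RV P >-> R})
    (Xs : 'I_n -> {RV P >-> d.-tuple R}) (Ys : 'I_n -> {RV P >-> R})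
    (thetastar : d.-tuple R) (S : 'M[R]_d) (kappa C : R)
    (thetahat : {RV P >-> d.-tuple R}),
  least_squares X Y Xs Ys thetastar S kappa C thetahat ->
  let excess := excess_risk P X Y thetastar thetahat in
  let n_ := neps kappa d in
  let delta := deltahat kappa d n in
  let gamma := gammam kappa d n in
  (* (1) *)
  (forall eps : R, 0 < eps < 1 ->
    (forall m, 0 < m -> 1 + m <= kappa ->
      n_ eps <= c m * (kappa * (d%:R + ln eps^-1))) /\
    (n_ eps <= n%:R -> gamma eps != 1 ->
      exists Om : set T,
      [/\ measurable Om,
          ((1 - eps)%:E <= P Om)%E,
          ((n%:R / C)%:E * cond_expectation_event P excess Om <=
            ((1 + delta eps) ^+ 2
              / ((1 - gamma eps) ^+ 2 * fine (P Om)))%:E)%E &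
          forall m, 0 < m -> 1 + m <= kappa -> gamma eps <= 1 - m ->
            (1 + delta eps) ^+ 2 / ((1 - gamma eps) ^+ 2 * fine (P Om)) <=
            (1 + c m * Num.sqrt (kappa * (d%:R + ln eps^-1) / n%:R))
              * (1 - eps)^-1])) /\
  (* (2) *)
  (forall eps M : R, 0 < eps -> 0 < M -> n_ eps < n%:R -> gamma eps != 1 ->
    ('E_P[fun w => Num.min (excess w) M] <=
      ((1 + delta eps) ^+ 2 * C / ((1 - gamma eps) ^+ 2 * n%:R)
        + eps * M)%:E)%E) /\
  (* (3) *)
  (0 < C -> forall M : R, 0 < M ->
    (forall m, 0 < m -> 1 + m <= kappa -> C <= M ->
      c m * (kappa * (d%:R + ln (kappa * M / C))) < n%:R ->
      n_ (C / (M * n%:R ^+ 2)) < n%:R) /\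
    (c0 * (kappa * (d%:R + ln (kappa * M / C))) < n%:R ->
      ((n%:R / C)%:E * 'E_P[fun w => Num.min (excess w) M] <=
        (1 + c0 * Num.sqrt (kappa * (d%:R + ln (M * n%:R / C)) / n%:R))%:E)%E))
  /\
  (* (4) *)
  (forall (eta : {RV P >-> R}) (sigma : R),
    (forall w, Y w = dot thetastar (X w) + eta w) ->
    independent2 P eta X ->
    'E_P[eta] = 0%E ->
    0 < sigma ^+ 2 -> 'E_P[fun w => eta w ^+ 2] = (sigma ^+ 2)%:E ->
    (forall M : R, 0 < M ->
      c0 * (kappa * (d%:R + ln (kappa * M / sigma ^+ 2))) <= n%:R ->
      ('E_P[fun w => Num.min (excess w) M] <=
        ((1 + c0 * Num.sqrt
            (kappa * (d%:R + ln (M * n%:R / sigma ^+ 2)) / n%:R))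
          * (sigma ^+ 2 * d%:R / n%:R))%:E)%E) /\
    (forall eps : R, 0 < eps < 1 ->
      c0 * (kappa * (d%:R + ln eps^-1)) <= n%:R ->
      n_ eps < n%:R -> gamma eps < 1 ->
      let bound := (1 + delta eps) * d%:R * sigma ^+ 2
                     / ((1 - gamma eps) * n%:R) in
      (forall Z : T -> \bar R,
        is_cond_expectation P (g_sigma_preimage (fun i w => Xs i w)) excess Z ->
        ((1 - eps)%:E <= P [set w | Z w <= bound%:E])%E) /\
      (forall m, 0 < m -> 1 + m <= kappa -> gamma eps <= 1 - m ->
        bound <=
        (1 + c m * Num.sqrt (kappa * (d%:R + ln eps^-1) / n%:R))
          * (d%:R * sigma ^+ 2 / n%:R)))).
Proof.
have sc0 : 0 < sharp_const :> R by rewrite /sharp_const mulr_gt0 ?expR_gt0.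
exists sharp_const, degenerate_const; split=> //; split=> [m m0|].
  by have := size_const_le m0; have := size_const_ge1 m; lra.
move=> disp T P d n X Y Xs Ys thetastar S kappa C thetahat LS excess n_ delta gamma.
have k1 := ls_kappa LS; have n0 : (0 < n)%N := ls_size LS.
have d0 : (0 < d)%N := ls_dim_gt0 LS.
have n0R : 0 < n%:R :> R by rewrite ltr0n.
have d1R : 1 <= d%:R :> R by rewrite ler1n.
have k0 : 0 < kappa by lra.
have lneps (eps : R) : 0 < eps < 1 -> 0 <= ln eps^-1.
  by move=> /andP[e0 e1]; apply: ln_ge0; rewrite -invr1 lef_pV2 ?posrE// ltW.
have E f : ('E_P[f] = \int[P]_w (f w)%:E)%E by rewrite unlock.
split; [|split; [|split]].
- move=> eps e01; have l0 := lneps eps e01; have /andP[e0 e1] := e01; split.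
    move=> m m0 mk; apply: le_trans (neps_le d m0 mk l0) _.
    by rewrite ler_wpM2r ?size_const_le// mulr_ge0 ?addr_ge0// ltW.
  move=> ne g1; have [Om [mOm POm HOm]] := conditional_excess_le LS e01 ne g1.
  exists Om; split=> // m m0 mk gm.
  have [mu01 _] := confidence_constants k1 d0 n0 e01 ne.
  have := excess_ratio_le m0 mk n0 l0 mu01 gm.
  rewrite -/(gamma eps) -/(delta eps) => H.
  have PF : P Om \is a fin_num by rewrite fin_num_measure.
  have Pe : 1 - eps <= fine (P Om) by move: POm; rewrite -(fineK PF) lee_fin.
  have e2 : 0 < 1 - eps by lra.
  rewrite invfM mulrA; apply: ler_pM => //.
  + by rewrite divr_ge0 ?sqr_ge0.
  + by rewrite invr_ge0 (le_trans (ltW e2)).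
  + by rewrite lef_pV2 ?posrE// (lt_le_trans e2).
- move=> eps M e0 M0 ne g1; rewrite E.
  by apply: (truncated_excess_le LS e0 M0 _ g1); exact: ltW.
- move=> C0 M M0; split=> [m m0 mk CM|Hn].
    exact: neps_truncation_lt.
  rewrite E; apply: le_trans (lee_wpmul2l _ (sharp_truncated_excess LS C0 (lexx C) M0 (ltW Hn))) _.
    by rewrite lee_fin divr_ge0// ltW.
  rewrite -EFinM lee_fin mulrA (_ : n%:R / C * (C / n%:R) = 1) ?mul1r//.
  by field; rewrite !gt_eqF.
- move=> eta sigma YE ind eta0 s0 eta2; split=> [M M0 Hn|eps e01 _ ne g1 bound].
    (* The sharp bound, with the noise level replaced by its upper bound. *)
    have C'0 : 0 < sigma ^+ 2 * d%:R by rewrite mulr_gt0// ltr0n.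
    have s2d : (sigma ^+ 2 * d%:R)^-1 <= (sigma ^+ 2)^-1.
      by rewrite lef_pV2 ?posrE// ler_peMr// ltW.
    have lnle x : 0 < x -> ln (x / (sigma ^+ 2 * d%:R)) <= ln (x / sigma ^+ 2).
      by move=> x0; rewrite ler_ln ?posrE ?divr_gt0// ler_pM2l.
    have Hn' : sharp_const * (kappa * (d%:R + ln (kappa * M / (sigma ^+ 2 * d%:R)))) <= n%:R.
      apply: le_trans Hn; rewrite !ler_pM2l// lerD2l.
      by apply: lnle; rewrite mulr_gt0.
    have CC' := noise_level_le LS YE ind eta2.
    rewrite E; apply: le_trans (sharp_truncated_excess LS C'0 CC' M0 Hn') _.
    rewrite lee_fin mulrC ler_wpM2r ?divr_ge0 ?(ltW C'0)// lerD2l ler_pM2l//.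
    apply: ler_wsqrtr; rewrite ler_pM2r ?invr_gt0// ler_pM2l// lerD2l.
    by apply: lnle; rewrite mulr_gt0.
  have l0 := lneps eps e01; have /andP[e0 e1] := e01.
  have ne' := ltW ne.
  have g1' : gamma eps != 1 by rewrite lt_eqF.
  have g0 : 0 <= gamma eps := gammam_ge0 d n k1 l0.
  have [mu01 _] := confidence_constants k1 d0 n0 e01 ne'.
  have de0 : 0 <= delta eps.
    by have /andP[mu0 mu1] := mu01; rewrite divr_ge0//; lra.
  have D0 : 0 < 1 + delta eps by lra.
  have W0 : 0 < 1 - gamma eps by lra.
  split=> [Z EZ|m m0 mk gm].
    have := confidence_event LS e01 ne' g1'.
    rewrite -/(gamma eps) -/(delta eps) ger0_norm ?(ltW W0)//.
    move=> [a0 [m [mm Pm Hm]]].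
    have a01 : 0 < (1 - gamma eps) / (1 + delta eps) <= 1.
      by rewrite a0 ler_pdivrMr//; lra.
    have := conditional_expectation_le LS YE ind eta0 eta2 mm a01 Hm Pm EZ.
    suff -> : bound = sigma ^+ 2 * (d%:R / (n%:R * ((1 - gamma eps) / (1 + delta eps)))) by [].
    by rewrite /bound; field; rewrite !gt_eqF.
  set r := Num.sqrt _.
  have := excess_ratio_le m0 mk n0 l0 mu01 gm.
  rewrite -/(gamma eps) -/(delta eps) -/r => H.
  have -> : bound = (1 + delta eps) / (1 - gamma eps) * (d%:R * sigma ^+ 2 / n%:R).
    by rewrite /bound; field; rewrite !gt_eqF.
  apply: ler_wpM2r; first by rewrite divr_ge0// mulr_ge0// ltW.
  apply: le_trans H; rewrite -expr_div_n expr2 ler_peMl ?divr_ge0 ?(ltW D0) ?(ltW W0)//.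
  by rewrite ler_pdivlMr//; lra.
Qed.
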